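(* Let $X$ be a Noetherian $\mathbb{F}_1$-scheme. Then the zeta function of $X$ over $\mathbb{F}_1$ is a finite product $$\zeta_X(s)=\prod_{x\in X}\zeta_{X_x}(s)$$ where $X_x$ denotes the constituent of $X$ over the residue field $\kappa(x)=\mathbb{F}_1[\mathcal O_{X,x}^\times]$ and $\mathcal O_{X,x}^\times$ is a finitely generated abelian group, $\mathcal O_{X,x}^\times=H\times\mathbb{Z}^n$ with $H$ a finite torsion group ($H$ and $n$ depending on $x$). The zeta function of each constituent $X_x$ takes the form $$\zeta_{X_x}(s)=\prod_{k\geq0}\zeta(\mathbb{F}_1[H],s-n+k)^{(-1)^k\binom nk}$$ where $\zeta(\mathbb{F}_1[H],s)$ is the product $$\zeta(\mathbb{F}_1[H],s)=\prod_{d\,\mid\,|H|}\xi_d(s)^{\gamma(H,d)},$$ $\gamma(H,d)$ being the number of cyclic subgroups $C\subset H$ of order $d$.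
   Context: Monoids. $\mathfrak{Mo}$ is the category of commutative monoids with unit $1$ and absorbing element $0\ne 1$. For an abelian group $H$, $\mathbb{F}_1[H]=H\cup\{0\}$; $\mathbb{F}_{1^n}=\mathbb{F}_1[\mathbb{Z}/n\mathbb{Z}]$. A geometric $\mathfrak{Mo}$-scheme is a topological space with a sheaf of such monoids which admits an open cover by prime spectra $\mathrm{Spec}(M)$ (set of prime ideals, topology and structure sheaf defined as for rings); morphisms are required to be local on stalks, i.e. stalk maps $\rho$ satisfy $\rho^{-1}(\text{units})=\text{units}$. An $\mathfrak{Mo}$-scheme is a functor $\mathfrak{Mo}\to\mathfrak{Sets}$ admitting an open cover by representable sub-functors; it is equivalent to a geometric $\mathfrak{Mo}$-scheme $X$, via $M\mapsto\mathrm{Hom}(\mathrm{Spec}\,M,X)$. $\mathbb{F}_1$-schemes. Let $\beta:\mathfrak{Mo}\to\mathfrak{Ring}$, $\beta(M)=\mathbb{Z}[M]$ (with the zero of $M$ identified with $0$), and its right adjoint $\beta^*:\mathfrak{Ring}\to\mathfrak{Mo}$, $\beta^*(R)=R$ (multiplicative monoid). Let $\mathfrak{MR}=\mathfrak{Ring}\cup_{\beta,\beta^*}\mathfrak{Mo}$ be the category glued along this adjunction (objects of both; morphisms within each; and $\mathrm{Hom}(M,R)=\mathrm{Hom}_{\mathfrak{Mo}}(M,\beta^*(R))\cong \mathrm{Hom}_{\mathfrak{Ring}}(\beta(M),R)$, no morphisms from rings to monoids). An $\mathbb{F}_1$-scheme is a covariant functor $\mathcal X:\mathfrak{MR}\to\mathfrak{Sets}$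 whose restriction $X_{\mathbb{Z}}$ to $\mathfrak{Ring}$ is a $\mathbb{Z}$-scheme, whose restriction $\underline X$ to $\mathfrak{Mo}$ is an $\mathfrak{Mo}$-scheme, and such that the natural transformation $e:\underline X\circ\beta^*\to X_{\mathbb{Z}}$ evaluated at any field is a bijection. It is Noetherian if $X_{\mathbb{Z}}$ and the $\mathfrak{Mo}$-scheme are Noetherian, the latter meaning that there is a finite open cover by spectra of Noetherian (equivalently finitely generated) monoids. $X$ denotes the geometric $\mathfrak{Mo}$-scheme which is the geometric realization of $\underline X$, and one refers to $X$ as the $\mathbb{F}_1$-scheme. The constituent $X_x$ at a point $x$ is $\mathrm{Spec}(\mathbb{F}_1[\mathcal O_{X,x}^\times])$. Counting function. $N_X(n+1)=\#X(\mathbb{F}_{1^n})=\#\mathrm{Hom}(\mathrm{Spec}\,\mathbb{F}_{1^n},X)=\sum_{x\in X}\#\mathrm{Hom}(\mathcal O_{X,x}^\times,\mathbb{Z}/n\mathbb{Z})$. It extends to a function on $\mathbb{Z}$ of the form $\sum_jT_j(n)n^j$ (finite sum, $T_j$ periodic). Any real function of this form has a canonical extension to an entire function $N(z)=f(z)+\cos(\pi z)Q(z)$, obtained by writing $T_j(n)=\sum_{\alpha\in I}t_{j,\alpha}e^{2\pi i\alpha n}+s_j(-1)^n$ with $I\subset(-\frac12,\frac12)$ a finite set of rationals, and setting $f(z)=\sum_j\sum_\alpha t_{j,\alpha}e^{2\pi i\alpha z}z^j$, $Q(z)=\sum_js_jz^j$. The function $N_X(u)$, $u\in[1,\infty)$,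 is the restriction of this canonical extension. For $X_x$ one uses in the same way the function $N_{X_x}(n+1)=\#\mathrm{Hom}(\mathcal O_{X,x}^\times,\mathbb{Z}/n\mathbb{Z})$. Zeta function. For a continuous real function $N$ on $[1,\infty)$ with $|N(q)|\le Cq^k$, the zeta function $\zeta_N(s)$ over $\mathbb{F}_1$ is defined (up to a multiplicative constant) by its logarithmic derivative $$\frac{\partial_s\zeta_N(s)}{\zeta_N(s)}=-\lim_{q\to1^+}F(q,s)=-\int_1^\infty N(u)u^{-s}\frac{du}{u},\qquad F(q,s)=-\partial_s\sum_{r\ge1}N(q^r)\frac{q^{-rs}}{r},\qquad\Re(s)>k,$$ and $\zeta_X=\zeta_{N_X}$, $\zeta_{X_x}=\zeta_{N_{X_x}}$. The functions $\xi_d$. For real $a\ne0$, $f(s,a)$ is the entire function of $s$ which for $\Re(s)>0$ equals $\int_1^\infty e^{iau}u^{-s}\frac{du}{u}$. With $\varphi$ the Euler totient function, $$\xi_d(s)=s^{-\frac{\varphi(d)}d}\,e^{-\frac{\varphi(d)}dH_d(s)},$$ where $H_d$ is the primitive, vanishing for $\Re(s)\to\infty$, of the entire function $$\partial_sH_d(s)=\sum_{|k|\le d/2,\,k\ne0}e^{-i\frac{2\pi k}d}f\Big(s,\frac{2\pi k}d\Big),$$ where, when $d$ is even, the contributions of $k=\pm\frac d2$ are divided by $2$.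
   Formalization: For d≥2 no primitive H_d vanishing as Re(s)→∞ exists, since its derivative behaves like (d-1)/s; the formal statement lets H_d be any primitive, so ξ_d is fixed only up to a nonzero constant factor, and the formulas hold up to such a factor, as zeta functions are defined. *)

(* Defs.v *)
From HB Require Import structures.
From mathcomp Require Import all_boot all_order all_algebra all_fingroup.
From mathcomp Require Import all_solvable complex.
From mathcomp Require Import all_classical all_reals all_analysis.

Set Implicit Arguments.
Unset Strict Implicit.
Unset Printing Implicit Defensive.

Import Order.TTheory GRing.Theory Num.Theory.
Import numFieldNormedType.Exports.

Local Open Scope classical_set_scope.

(* The condition 0 <> 1 is split off into [Mo]: the sections of a sheaf over
   the empty set form the trivial monoid, which is not an object of [Mo]. *)
Record cmon := CMon {
  cm_sort :> Type;
  cm0 : cm_sort;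
  cm1 : cm_sort;
  cm_mul : cm_sort -> cm_sort -> cm_sort;
  cm_mulA : associative cm_mul;
  cm_mulC : commutative cm_mul;
  cm_mul1 : left_id cm1 cm_mul;
  cm_mul0 : left_zero cm0 cm_mul }.

Arguments cm0 {c}.
Arguments cm1 {c}.
Arguments cm_mul {c}.
Infix "**" := cm_mul (at level 40, left associativity).

Record Mo := MkMo {
  mo_cmon :> cmon;
  mo_nontrivial : cm0 <> cm1 :> mo_cmon }.

Record cmhom (A B : cmon) := CMHom {
  cmhom_fun :> A -> B;
  cmhom0 : cmhom_fun cm0 = cm0;
  cmhom1 : cmhom_fun cm1 = cm1;
  cmhomM : forall a b, cmhom_fun (a ** b) = cmhom_fun a ** cmhom_fun b }.

Lemma cmhom_eq (A B : cmon) (f g : cmhom A B) : f =1 g -> f = g.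
Proof.
case: f g => [f f0 f1 fM] [g g0 g1 gM] /= /funext fg; subst g.
by congr CMHom; apply: Prop_irrelevance.
Qed.

Definition cmhom_id (A : cmon) : cmhom A A :=
  @CMHom A A idfun erefl erefl (fun _ _ => erefl).

Definition cmhom_comp (A B C : cmon) (g : cmhom B C) (f : cmhom A B) :
  cmhom A C.
Proof.
by exists (g \o f) => [||a b] /=; rewrite ?(cmhom0, cmhom1, cmhomM).
Defined.

Section CmonTheory.
Variable M : cmon.
Implicit Types a b c d : M.

Lemma cm_mulr1 a : a ** cm1 = a.
Proof. by rewrite cm_mulC cm_mul1. Qed.

Lemma cm_mulACA a b c d : (a ** b) ** (c ** d) = (a ** c) ** (b ** d).
Proof. by rewrite !cm_mulA -(cm_mulA a b c) (cm_mulC b c) cm_mulA. Qed.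

Lemma cm_mulAC a b c : a ** b ** c = a ** c ** b.
Proof. by rewrite -!cm_mulA (cm_mulC b). Qed.

HB.instance Definition _ :=
  Monoid.isComLaw.Build M cm1 cm_mul (@cm_mulA M) (@cm_mulC M) (@cm_mul1 M).

Definition is_unit a := exists b, a ** b = cm1.

Lemma is_unit1 : is_unit cm1. Proof. by exists cm1; rewrite cm_mul1. Qed.

Lemma is_unitM a b : is_unit a -> is_unit b -> is_unit (a ** b).
Proof.
by move=> [a' aa'] [b' bb']; exists (a' ** b'); rewrite cm_mulACA aa' bb' cm_mul1.
Qed.

Definition cm_inv a (ua : is_unit a) : M := sval (cid ua).

Lemma cm_invP a (ua : is_unit a) : a ** cm_inv ua = cm1.
Proof. exact: (svalP (cid ua)). Qed.

Lemma is_unitV a (ua : is_unit a) : is_unit (cm_inv ua).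
Proof. by exists a; rewrite cm_mulC cm_invP. Qed.

(* The group of units, as an abelian group in additive notation. *)
Definition units := {a : M | is_unit a}.

Lemma units_eq (u v : units) : sval u = sval v -> u = v.
Proof. by move: u v => [a ua] [b ub] /= ab; subst b; congr exist; exact: Prop_irrelevance. Qed.

HB.instance Definition _ := gen_eqMixin units.
HB.instance Definition _ := gen_choiceMixin units.

Definition units_zero : units := exist _ cm1 is_unit1.
Definition units_add (u v : units) : units :=
  exist _ (sval u ** sval v) (is_unitM (svalP u) (svalP v)).
Definition units_opp (u : units) : units :=
  exist _ (cm_inv (svalP u)) (is_unitV (svalP u)).

Lemma units_addA : associative units_add.
Proof. by move=> u v w; apply: units_eq; rewrite /= cm_mulA. Qed.
Lemma units_addC : commutative units_add.
Proof. by move=> u v; apply: units_eq; rewrite /= cm_mulC. Qed.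
Lemma units_add0 : left_id units_zero units_add.
Proof. by move=> u; apply: units_eq; rewrite /= cm_mul1. Qed.
Lemma units_addN : left_inverse units_zero units_opp units_add.
Proof. by move=> u; apply: units_eq; rewrite /= cm_mulC cm_invP. Qed.

HB.instance Definition _ :=
  GRing.isZmodule.Build units units_addA units_addC units_add0 units_addN.

End CmonTheory.

(* F_1[H] = H u {0}, where H is written additively. *)
Section F1.
Variable H : zmodType.

Definition F1_mul (a b : option H) : option H :=
  if a is Some x then if b is Some y then Some (x + y)%R else None else None.

Lemma F1_mulA : associative F1_mul.
Proof. by move=> [x|] [y|] [z|] //=; rewrite addrA. Qed.
Lemma F1_mulC : commutative F1_mul.
Proof. by move=> [x|] [y|] //=; rewrite addrC. Qed.
Lemma F1_mul1 : left_id (Some 0%R) F1_mul.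
Proof. by move=> [x|] //=; rewrite add0r. Qed.
Lemma F1_mul0 : left_zero None F1_mul.
Proof. by []. Qed.
Lemma F1_nontrivial : None <> Some (0%R : H). Proof. by []. Qed.

Definition F1 : Mo :=
  @MkMo (CMon F1_mulA F1_mulC F1_mul1 F1_mul0) F1_nontrivial.
End F1.

(* The multiplicative monoid beta^* R of a ring; for R = 0 it is trivial. *)
Section Beta.
Definition beta_star (R : comPzRingType) : cmon :=
  CMon (@mulrA R) (@mulrC R) (@mul1r R) (@mul0r R).

Definition beta_starM (R S : comPzRingType) (f : {rmorphism R -> S}) :
  cmhom (beta_star R) (beta_star S) :=
  @CMHom (beta_star R) (beta_star S) f (rmorph0 f) (rmorph1 f) (rmorphM f).

Lemma beta_star_nontrivial (R : comNzRingType) : cm0 <> cm1 :> beta_star R.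
Proof. by apply/eqP; rewrite eq_sym oner_eq0. Qed.

Definition beta_starMo (R : comNzRingType) : Mo :=
  MkMo (@beta_star_nontrivial R).
End Beta.

(* Operations satisfying the laws of [cmon] modulo a congruence. *)
Record precmon := PreCMon {
  pc_sort :> Type;
  pc_eq : pc_sort -> pc_sort -> Prop;
  pc0 : pc_sort;
  pc1 : pc_sort;
  pc_mul : pc_sort -> pc_sort -> pc_sort;
  pc_refl : forall x, pc_eq x x;
  pc_sym : forall x y, pc_eq x y -> pc_eq y x;
  pc_trans : forall x y z, pc_eq x y -> pc_eq y z -> pc_eq x z;
  pc_mulE : forall x x' y y',
    pc_eq x x' -> pc_eq y y' -> pc_eq (pc_mul x y) (pc_mul x' y');
  pc_mulA : forall x y z, pc_eq (pc_mul x (pc_mul y z)) (pc_mul (pc_mul x y) z);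
  pc_mulC : forall x y, pc_eq (pc_mul x y) (pc_mul y x);
  pc_mul1 : forall x, pc_eq (pc_mul pc1 x) x;
  pc_mul0 : forall x, pc_eq (pc_mul pc0 x) pc0 }.

Section Quotient.
Variable P : precmon.

Definition quot_sort := {A : set P | exists x, A = [set y | pc_eq x y]}.

Definition quot_pi (x : P) : quot_sort :=
  exist _ [set y | pc_eq x y] (ex_intro _ x erefl).

Definition quot_repr (t : quot_sort) : P := sval (cid (svalP t)).

Lemma quot_pi_repr t : quot_pi (quot_repr t) = t.
Proof.
rewrite /quot_repr; case: cid => x; case: t => A hA /= AE; subst A.
by rewrite /quot_pi; congr exist; exact: Prop_irrelevance.
Qed.

Lemma quot_piE x y : quot_pi x = quot_pi y <-> pc_eq x y.
Proof.
split=> [[/(congr1 (fun A => A y)) /= ->]|xy]; first exact: pc_refl.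
rewrite /quot_pi; set A := [set z | pc_eq x z]; set B := [set z | pc_eq y z].
have AB : A = B.
  apply/seteqP; split => z /= h; last exact: pc_trans h.
  exact: pc_trans (pc_sym xy) h.
move: (ex_intro _ _ _) (ex_intro _ _ _); rewrite AB => p q.
by congr exist; exact: Prop_irrelevance.
Qed.

Lemma quot_repr_pi x : pc_eq (quot_repr (quot_pi x)) x.
Proof. by apply/quot_piE; rewrite quot_pi_repr. Qed.

Definition quot_mul (s t : quot_sort) := quot_pi (pc_mul (quot_repr s) (quot_repr t)).

Lemma quot_mulE x y : quot_mul (quot_pi x) (quot_pi y) = quot_pi (pc_mul x y).
Proof. by apply/quot_piE; apply: pc_mulE; exact: quot_repr_pi. Qed.

Lemma quot_mulA : associative quot_mul.
Proof.
move=> s t u; rewrite -(quot_pi_repr s) -(quot_pi_repr t) -(quot_pi_repr u) !quot_mulE.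
by apply/quot_piE; exact: pc_mulA.
Qed.

Lemma quot_mulC : commutative quot_mul.
Proof.
by move=> s t; rewrite -(quot_pi_repr s) -(quot_pi_repr t) !quot_mulE; apply/quot_piE/pc_mulC.
Qed.

Lemma quot_mul1 : left_id (quot_pi (pc1 P)) quot_mul.
Proof. by move=> s; rewrite -(quot_pi_repr s) quot_mulE; apply/quot_piE/pc_mul1. Qed.

Lemma quot_mul0 : left_zero (quot_pi (pc0 P)) quot_mul.
Proof. by move=> s; rewrite -(quot_pi_repr s) quot_mulE; apply/quot_piE/pc_mul0. Qed.

Definition quotient : cmon := CMon quot_mulA quot_mulC quot_mul1 quot_mul0.
End Quotient.

Record spec (M : cmon) := Spec {
  prime_set :> M -> Prop;
  prime0 : prime_set cm0;
  primeMl : forall a b, prime_set b -> prime_set (a ** b);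
  prime1 : ~ prime_set cm1;
  primeM : forall a b, prime_set (a ** b) -> prime_set a \/ prime_set b }.

HB.instance Definition _ (M : cmon) := gen_eqMixin (spec M).
HB.instance Definition _ (M : cmon) := gen_choiceMixin (spec M).

Lemma spec_eq (M : cmon) (p q : spec M) : prime_set p = prime_set q -> p = q.
Proof.
case: p q => [p p0 pl p1 pM] [q q0 ql q1 qM] /= pq; subst q.
by congr Spec; exact: Prop_irrelevance.
Qed.

Section SpecTopology.
Variable M : cmon.

(* [spec_open E] is the complement of the closed set of the primes containing
   the ideal generated by E. *)
Definition spec_open (E : set M) : set (spec M) :=
  [set p : spec M | exists2 a, E a & ~ p a].

Definition zariski : set_system (spec M) :=
  [set U | exists E, U = spec_open E].

Lemma zariskiT : zariski setT.
Proof.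
exists [set cm1]; apply/seteqP; split=> // p _.
by exists cm1 => //; exact: prime1.
Qed.

Lemma zariskiI : setI_closed zariski.
Proof.
move=> _ _ [E ->] [F ->].
exists [set c | exists a b, [/\ E a, F b & c = a ** b]].
apply/seteqP; split => p /=.
  move=> [[a Ea pa] [b Fb pb]]; exists (a ** b); first by exists a, b.
  by move=> /primeM [].
move=> [_ [a [b [Ea Fb ->]]] pab]; split.
  by exists a => // pa; apply: pab; rewrite cm_mulC; exact: primeMl.
by exists b => // pb; apply: pab; exact: primeMl.
Qed.

Lemma zariski_bigU (I : Type) (f : I -> set (spec M)) :
  (forall i, zariski (f i)) -> zariski (\bigcup_i f i).
Proof.
move=> h; exists [set a | exists i, sval (cid (h i)) a].
apply/seteqP; split => p /=.
  move=> [i _ fip]; move: (fip); rewrite (svalP (cid (h i))) => -[a ha pa].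
  by exists a => //; exists i.
move=> [a [i ha] pa]; exists i => //.
by rewrite (svalP (cid (h i))); exists a.
Qed.

HB.instance Definition _ :=
  isOpenTopological.Build (spec M) zariskiT zariskiI zariski_bigU.
End SpecTopology.

Section Loc.
Variables (M : cmon) (p : spec M).

Definition frac_pre := (M * {f : M | ~ p f})%type.

Definition frac_eq (x y : frac_pre) :=
  exists2 u, ~ p u & u ** (x.1 ** sval y.2) = u ** (y.1 ** sval x.2).

Lemma compl1 : ~ p cm1. Proof. exact: prime1. Qed.
Lemma complM f g : ~ p f -> ~ p g -> ~ p (f ** g).
Proof. by move=> pf pg /primeM []. Qed.

Definition mkfrac (a f : M) (pf : ~ p f) : frac_pre :=
  (a, exist (fun f => ~ p f) f pf).

Definition frac_mul (x y : frac_pre) : frac_pre :=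
  mkfrac (x.1 ** y.1) (complM (svalP x.2) (svalP y.2)).

Lemma frac_refl x : frac_eq x x.
Proof. by exists cm1; first exact: compl1. Qed.

Lemma frac_sym x y : frac_eq x y -> frac_eq y x.
Proof. by move=> [u pu e]; exists u. Qed.

Lemma frac_trans x y z : frac_eq x y -> frac_eq y z -> frac_eq x z.
Proof.
move: x y z => [a [f pf]] [b [g pg]] [c [h ph]] [u /= pu e1] [v /= pv e2].
exists (u ** v ** g); first by apply: complM => //; exact: complM.
rewrite /= (_ : u ** v ** g ** (a ** h) = u ** (a ** g) ** (v ** h)); last first.
  by rewrite (AC (3*2) ((1*(4*3))*(2*5))).
rewrite e1 (_ : _ ** (v ** h) = v ** (b ** h) ** (u ** f)); last first.
  by rewrite (AC ((1*2)*2) ((4*(2*5))*(1*3))).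
by rewrite e2 (AC ((1*2)*2) ((4*1*3)*(2*5))).
Qed.

Lemma frac_mulE x x' y y' :
  frac_eq x x' -> frac_eq y y' -> frac_eq (frac_mul x y) (frac_mul x' y').
Proof.
move: x x' y y' => [a [f pf]] [a' [f' pf']] [b [g pg]] [b' [g' pg']].
move=> [u /= pu e1] [v /= pv e2]; exists (u ** v); first exact: complM.
rewrite /= (AC (2*(2*2)) ((1*(3*5))*(2*(4*6)))) /= e1 e2.
by rewrite [RHS](AC (2*(2*2)) ((1*(3*5))*(2*(4*6)))).
Qed.

Lemma frac_mulA x y z :
  frac_eq (frac_mul x (frac_mul y z)) (frac_mul (frac_mul x y) z).
Proof. by exists cm1; [exact: compl1|rewrite /= !cm_mulA]. Qed.

Lemma frac_mulC x y : frac_eq (frac_mul x y) (frac_mul y x).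
Proof.
exists cm1; first exact: compl1.
by rewrite /= (cm_mulC x.1) (cm_mulC (sval x.2)).
Qed.

Definition frac_one : frac_pre := mkfrac cm1 compl1.
Definition frac_zero : frac_pre := mkfrac cm0 compl1.

Lemma frac_mul1 x : frac_eq (frac_mul frac_one x) x.
Proof. by exists cm1; [exact: compl1|rewrite /= !cm_mul1]. Qed.

Lemma frac_mul0 x : frac_eq (frac_mul frac_zero x) frac_zero.
Proof. by exists cm1; [exact: compl1|rewrite /= !cm_mul0]. Qed.

Definition frac_precmon : precmon :=
  PreCMon frac_refl frac_sym frac_trans frac_mulE frac_mulA frac_mulC
    frac_mul1 frac_mul0.

Definition loc : cmon := quotient frac_precmon.

Definition frac (a f : M) (pf : ~ p f) : loc :=
  quot_pi (mkfrac a pf : frac_precmon).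

Lemma fracE a f (pf : ~ p f) b g (pg : ~ p g) :
  frac a pf = frac b pg <-> exists2 u, ~ p u & u ** (a ** g) = u ** (b ** f).
Proof. exact: (@quot_piE frac_precmon). Qed.

Lemma fracP (t : loc) : exists a f (pf : ~ p f), t = frac a pf.
Proof.
rewrite -(quot_pi_repr t); case: (quot_repr t) => [a [f pf]].
by exists a, f, pf.
Qed.

Lemma frac_one_unique f (pf : ~ p f) : frac f pf = cm1.
Proof. by apply/fracE; exists cm1; [exact: compl1|rewrite (cm_mulC f)]. Qed.

Lemma mul_frac a f (pf : ~ p f) b g (pg : ~ p g) :
  frac a pf ** frac b pg = frac (a ** b) (complM pf pg).
Proof.
by rewrite [LHS](@quot_mulE frac_precmon); apply/quot_piE; exists cm1; [exact: compl1|].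
Qed.

Lemma is_unit_frac a f (pf : ~ p f) : is_unit (frac a pf) <-> ~ p a.
Proof.
split=> [[t]|pa].
  case: (fracP t) => b [g [pg ->]]; rewrite mul_frac.
  move=> /(@fracE _ _ _ cm1 cm1 compl1)[u pu e] pa.
  have : ~ p (u ** (cm1 ** (f ** g))).
    by apply: complM => //; apply: complM; [exact: compl1|exact: complM].
  apply; rewrite -e; apply: primeMl; rewrite cm_mulC; apply: primeMl.
  by rewrite cm_mulC; exact: primeMl.
exists (frac f pa); rewrite mul_frac -(frac_one_unique (complM pf pa)).
by apply/fracE; exists cm1; [exact: compl1|rewrite (cm_mulC a)].
Qed.
End Loc.

Section SpecMap.
Variables (M N : cmon) (r : cmhom M N).

Definition comap (q : spec N) : spec M.
Proof.
exists (fun a => q (r a)) => [|a b|| a b]; rewrite ?(cmhom0, cmhom1, cmhomM).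
- exact: prime0.
- exact: primeMl.
- exact: prime1.
- exact: primeM.
Defined.

Lemma comap_continuous : continuous comap.
Proof.
apply/continuousP => U [E ->]; exists (r @` E).
apply/seteqP; split => q /=.
  by move=> [a Ea qa]; exists (r a) => //; exists a.
by move=> [_ [a Ea <-] qa]; exists a.
Qed.

Variable q : spec N.

Definition locmap_fun (t : loc (comap q)) : loc q :=
  let x := quot_repr t in
  @frac N q (r x.1) (r (sval x.2)) (svalP x.2).

Lemma locmap_frac a f (pf : ~ comap q f) :
  locmap_fun (frac a pf) = @frac N q (r a) (r f) pf.
Proof.
apply/fracE; case: (@quot_repr_pi (frac_precmon (comap q)) (mkfrac a pf)) => u pu e.
by exists (r u) => //; rewrite -!cmhomM; congr (r _).
Qed.

Lemma locmap0 : locmap_fun cm0 = cm0.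
Proof.
rewrite (locmap_frac cm0 (@compl1 _ (comap q))).
by apply/fracE; exists cm1; [exact: compl1|rewrite cmhom0 !cm_mul0].
Qed.

Lemma locmap1 : locmap_fun cm1 = cm1.
Proof.
rewrite (locmap_frac cm1 (@compl1 _ (comap q))).
by apply/fracE; exists cm1; [exact: compl1|rewrite cmhom1].
Qed.

Lemma locmapM t u : locmap_fun (t ** u) = locmap_fun t ** locmap_fun u.
Proof.
case: (fracP t) => a [f [pf ->]]; case: (fracP u) => b [g [pg ->]].
rewrite mul_frac !locmap_frac mul_frac.
by apply/fracE; exists cm1; [exact: compl1|rewrite !cmhomM].
Qed.

Definition locmap : cmhom (loc (comap q)) (loc q) :=
  CMHom locmap0 locmap1 locmapM.
End SpecMap.

Section Opens.
Variable T : topologicalType.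

Record opens := Opens { oset :> T -> Prop; openO : open oset }.

Lemma opens_eq (U V : opens) : oset U = oset V -> U = V.
Proof.
by case: U V => [U oU] [V oV] /= UV; subst V; congr Opens; exact: Prop_irrelevance.
Qed.

Definition opensT := Opens openT.
Definition opensI (U V : opens) : opens := Opens (openI (openO U) (openO V)).
End Opens.

Definition opens_preimage (S T : topologicalType) (f : S -> T)
  (cf : continuous f) (V : opens T) : opens S :=
  Opens (open_comp (fun x _ => cf x) (openO V)).

Definition osub (T : topologicalType) (U V : opens T) := forall x, U x -> V x.

(* Only a presheaf; see [is_sheaf]. *)
Record mspace := MSpace {
  ms_top :> topologicalType;
  ms_O : opens ms_top -> cmon;
  ms_res : forall U V : opens ms_top, osub U V -> cmhom (ms_O V) (ms_O U);
  ms_res_id : forall U (h : osub U U) s, ms_res h s = s;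
  ms_res_comp : forall U V W (h : osub U V) (k : osub V W) (l : osub U W) s,
    ms_res h (ms_res k s) = ms_res l s }.

Arguments ms_O : clear implicits.

Lemma osubIl (T : topologicalType) (U V : opens T) : osub (opensI U V) U.
Proof. by move=> x []. Qed.
Lemma osubIr (T : topologicalType) (U V : opens T) : osub (opensI U V) V.
Proof. by move=> x []. Qed.

Definition is_sheaf (X : mspace) :=
  forall (I : Type) (V : I -> opens X) (U : opens X) (h : forall i, osub (V i) U),
  (forall x, U x -> exists i, V i x) ->
  forall t : forall i, ms_O X (V i),
  (forall i j, ms_res (@osubIl X (V i) (V j)) (t i) =
               ms_res (@osubIr X (V i) (V j)) (t j)) ->
  exists! s : ms_O X U, forall i, ms_res (h i) s = t i.

Section Stalk.
Variables (X : mspace) (x : X).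

Record germ := Germ {
  germ_open : opens X;
  germ_mem : germ_open x;
  germ_sec : ms_O X germ_open }.

Definition germ_eq (s t : germ) :=
  exists (W : opens X) (h : osub W (germ_open s)) (k : osub W (germ_open t)),
    W x /\ ms_res h (germ_sec s) = ms_res k (germ_sec t).

Definition germ_mul (s t : germ) : germ :=
  @Germ (opensI (germ_open s) (germ_open t)) (conj (germ_mem s) (germ_mem t))
    (ms_res (@osubIl _ _ _) (germ_sec s) ** ms_res (@osubIr _ _ _) (germ_sec t)).

Definition germ_one : germ := @Germ (opensT X) I cm1.
Definition germ_zero : germ := @Germ (opensT X) I cm0.

Lemma germ_refl s : germ_eq s s.
Proof.
exists (germ_open s), (fun _ => id), (fun _ => id).
by split=> //; exact: germ_mem.
Qed.

Lemma germ_sym s t : germ_eq s t -> germ_eq t s.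
Proof. by move=> [W [h [k [Wx e]]]]; exists W, k, h. Qed.

Lemma germ_trans s t u : germ_eq s t -> germ_eq t u -> germ_eq s u.
Proof.
move=> [W [h [k [Wx e]]]] [W' [h' [k' [Wx' e']]]].
have l : osub (opensI W W') (germ_open s) by move=> y [/h].
have m : osub (opensI W W') (germ_open t) by move=> y [/k].
have n : osub (opensI W W') (germ_open u) by move=> y [_ /k'].
exists (opensI W W'), l, n; split=> //.
rewrite -(ms_res_comp (@osubIl _ _ _) h l) e (ms_res_comp _ _ m).
by rewrite -(ms_res_comp (@osubIr _ _ _) h' m) e' (ms_res_comp _ _ n).
Qed.

Lemma germ_mulE s s' t t' :
  germ_eq s s' -> germ_eq t t' -> germ_eq (germ_mul s t) (germ_mul s' t').
Proof.
move=> [W [h [k [Wx e]]]] [W' [h' [k' [Wx' e']]]].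
have l : osub (opensI W W') (germ_open (germ_mul s t)).
  by move=> y [/h ? /h' ?].
have l' : osub (opensI W W') (germ_open (germ_mul s' t')).
  by move=> y [/k ? /k' ?].
have hl : osub (opensI W W') (germ_open s) by move=> y [/h].
have hr : osub (opensI W W') (germ_open t) by move=> y [_ /h'].
have kl : osub (opensI W W') (germ_open s') by move=> y [/k].
have kr : osub (opensI W W') (germ_open t') by move=> y [_ /k'].
exists (opensI W W'), l, l'; split=> //=; rewrite !cmhomM.
rewrite !(ms_res_comp _ _ hl) !(ms_res_comp _ _ hr).
rewrite !(ms_res_comp _ _ kl) !(ms_res_comp _ _ kr).
rewrite -(ms_res_comp (@osubIl _ _ _) h hl) -(ms_res_comp (@osubIr _ _ _) h' hr).
by rewrite e e' (ms_res_comp _ _ kl) (ms_res_comp _ _ kr).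
Qed.

Lemma germ_mulA s t u :
  germ_eq (germ_mul s (germ_mul t u)) (germ_mul (germ_mul s t) u).
Proof.
set W := germ_open (germ_mul s (germ_mul t u)).
have k : osub W (germ_open (germ_mul (germ_mul s t) u)) by move=> y [? []].
have hs : osub W (germ_open s) by move=> y [].
have ht : osub W (germ_open t) by move=> y [_ []].
have hu : osub W (germ_open u) by move=> y [_ []].
exists W, (fun _ => id), k; split.
  by split; [|split]; exact: germ_mem.
have htu : osub W (opensI (germ_open t) (germ_open u)) by move=> y [].
have hst : osub W (opensI (germ_open s) (germ_open t)) by move=> y [? []].
rewrite /= !cmhomM !(ms_res_comp _ _ htu) !(ms_res_comp _ _ hst).
by rewrite !(ms_res_comp _ _ hs) !(ms_res_comp _ _ ht) !(ms_res_comp _ _ hu)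
  cm_mulA.
Qed.

Lemma germ_mulC s t : germ_eq (germ_mul s t) (germ_mul t s).
Proof.
set W := germ_open (germ_mul s t).
have k : osub W (germ_open (germ_mul t s)) by move=> y [].
have hs : osub W (germ_open s) by move=> y [].
have ht : osub W (germ_open t) by move=> y [].
exists W, (fun _ => id), k; split; first by split; exact: germ_mem.
by rewrite /= !cmhomM !(ms_res_comp _ _ hs) !(ms_res_comp _ _ ht) cm_mulC.
Qed.

Lemma germ_mul1 s : germ_eq (germ_mul germ_one s) s.
Proof.
set W := germ_open (germ_mul germ_one s).
have hs : osub W (germ_open s) by move=> y [].
exists W, (fun _ => id), hs; split; first by split; [|exact: germ_mem].
by rewrite /= !cmhomM !(ms_res_comp _ _ hs) !cmhom1 cm_mul1.
Qed.

Lemma germ_mul0 s : germ_eq (germ_mul germ_zero s) germ_zero.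
Proof.
set W := germ_open (germ_mul germ_zero s).
have h0 : osub W (germ_open germ_zero) by [].
exists W, (fun _ => id), h0; split; first by split; [|exact: germ_mem].
by rewrite /= !cmhomM !cmhom0 cm_mul0.
Qed.

Definition germ_precmon : precmon :=
  PreCMon germ_refl germ_sym germ_trans germ_mulE germ_mulA germ_mulC
    germ_mul1 germ_mul0.

Definition stalk : cmon := quotient germ_precmon.

Definition germ_at (U : opens X) (Ux : U x) (s : ms_O X U) : stalk :=
  quot_pi (Germ Ux s : germ_precmon).
End Stalk.

Record mspace_premor (X Y : mspace) := MSpacePremor {
  pm_fun :> X -> Y;
  pm_cont : continuous pm_fun;
  pm_sec : forall V : opens Y,
    cmhom (ms_O Y V) (ms_O X (opens_preimage pm_cont V));
  pm_res : forall (U V : opens Y) (h : osub U V)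
    (k : osub (opens_preimage pm_cont U) (opens_preimage pm_cont V)) s,
    pm_sec U (ms_res h s) = ms_res k (pm_sec V s) }.

Arguments pm_cont {X Y} m : rename.

Section StalkMap.
Variables (X Y : mspace) (f : mspace_premor X Y) (x : X).

Definition stalk_map (t : stalk (f x)) : stalk x :=
  let g := quot_repr t in
  @germ_at X x (opens_preimage (pm_cont f) (germ_open g)) (germ_mem g)
    (pm_sec f (germ_open g) (germ_sec g)).

Lemma stalk_map_germ (V : opens Y) (Vfx : V (f x)) s :
  stalk_map (germ_at Vfx s) =
  @germ_at X x (opens_preimage (pm_cont f) V) Vfx (pm_sec f V s).
Proof.
rewrite /stalk_map; set g := quot_repr _.
case: (@quot_repr_pi (germ_precmon (f x)) (Germ Vfx s)) => W [h [k [Wfx e]]].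
have h' : osub (opens_preimage (pm_cont f) W)
  (opens_preimage (pm_cont f) (germ_open g)) by move=> y /h.
have k' : osub (opens_preimage (pm_cont f) W) (opens_preimage (pm_cont f) V).
  by move=> y /k.
apply/quot_piE; exists (opens_preimage (pm_cont f) W), h', k'; split=> //=.
by rewrite -(pm_res h h') -(pm_res k k'); congr (pm_sec f W _).
Qed.
End StalkMap.

(* rho^-1 (units) = units for every stalk map rho *)
Definition local_mor (X Y : mspace) (f : mspace_premor X Y) :=
  forall (x : X) (t : stalk (f x)), is_unit (stalk_map t) <-> is_unit t.

Record mspace_mor (X Y : mspace) := MSpaceMor {
  mor_premor :> mspace_premor X Y;
  mor_local : local_mor mor_premor }.

Section Comp.
Variables (X Y Z : mspace).

Section Pre.
Variables (g : mspace_premor Y Z) (f : mspace_premor X Y).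

Let fc : continuous (g \o f) :=
  fun x => continuous_comp (pm_cont f x) (pm_cont g (f x)).

Lemma comp_sub (V : opens Z) :
  osub (opens_preimage fc V)
       (opens_preimage (pm_cont f) (opens_preimage (pm_cont g) V)).
Proof. by []. Qed.

Definition comp_sec (V : opens Z) :
  cmhom (ms_O Z V) (ms_O X (opens_preimage fc V)) :=
  cmhom_comp (ms_res (@comp_sub V)) (cmhom_comp (pm_sec f _) (pm_sec g V)).

Lemma comp_res (U V : opens Z) (h : osub U V)
    (k : osub (opens_preimage fc U) (opens_preimage fc V)) s :
  comp_sec U (ms_res h s) = ms_res k (comp_sec V s).
Proof.
have k1 : osub (opens_preimage (pm_cont g) U) (opens_preimage (pm_cont g) V).
  by move=> y /h.
have k2 : osub (opens_preimage (pm_cont f) (opens_preimage (pm_cont g) U))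
  (opens_preimage (pm_cont f) (opens_preimage (pm_cont g) V)).
  by move=> y /h.
have k3 : osub (opens_preimage fc U)
  (opens_preimage (pm_cont f) (opens_preimage (pm_cont g) V)) by move=> y /h.
rewrite /= (pm_res h k1) (pm_res k1 k2) (ms_res_comp _ _ k3).
by rewrite (ms_res_comp _ _ k3).
Qed.

Definition premor_comp : mspace_premor X Z := MSpacePremor comp_res.

Lemma stalk_map_comp (x : X) (t : stalk (g (f x))) :
  @stalk_map _ _ premor_comp x t = @stalk_map _ _ f x (stalk_map t).
Proof.
rewrite -(quot_pi_repr t); case: (quot_repr t) => V Vx s.
rewrite -[quot_pi _]/(germ_at Vx s) (@stalk_map_germ _ _ g).
rewrite (@stalk_map_germ _ _ premor_comp) (@stalk_map_germ _ _ f).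
apply/quot_piE; exists (opens_preimage fc V), (fun _ => id), (@comp_sub V).
by split=> //=; rewrite ms_res_id.
Qed.
End Pre.

Lemma comp_local (g : mspace_mor Y Z) (f : mspace_mor X Y) :
  local_mor (premor_comp g f).
Proof.
move=> x t; rewrite stalk_map_comp.
by split=> [/mor_local/mor_local|h]; last exact/mor_local/mor_local.
Qed.

Definition mspace_comp (g : mspace_mor Y Z) (f : mspace_mor X Y) :
  mspace_mor X Z := MSpaceMor (@comp_local g f).
End Comp.

Section Spec.
Variable M : cmon.

Definition locally_fraction (U : opens (spec M))
    (s : forall p : spec M, U p -> loc p) :=
  forall p, U p -> exists V : opens (spec M), V p /\
    exists a f, forall q (Uq : U q), V q ->
      exists qf : ~ q f, s q Uq = frac a qf.

Definition spec_sec (U : opens (spec M)) :=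
  {s : forall p : spec M, U p -> loc p | locally_fraction s}.

Lemma spec_sec_eq (U : opens (spec M)) (s t : spec_sec U) :
  (forall p Up, sval s p Up = sval t p Up) -> s = t.
Proof.
move: s t => [s hs] [t ht] /= st.
have e : s = t.
  apply: functional_extensionality_dep => p.
  by apply: functional_extensionality_dep => Up; exact: st.
by subst t; congr exist; exact: Prop_irrelevance.
Qed.

Section Ops.
Variable U : opens (spec M).

Lemma spec_const_subproof (a : M) :
  @locally_fraction U (fun p _ => frac a (@compl1 M p)).
Proof.
move=> p _; exists (opensT _); split=> //; exists a, cm1 => q _ _.
by exists (@compl1 M q).
Qed.

Definition spec_const (a : M) : spec_sec U := exist _ _ (spec_const_subproof a).

Lemma spec_mul_subproof (s t : spec_sec U) :
  locally_fraction (fun p Up => sval s p Up ** sval t p Up).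
Proof.
move=> p Up; case: (svalP s p Up) => V [Vp [a [f sE]]].
case: (svalP t p Up) => W [Wp [b [g tE]]].
exists (opensI V W); split=> //; exists (a ** b), (f ** g) => q Uq [Vq Wq].
case: (sE q Uq Vq) => qf ->; case: (tE q Uq Wq) => qg ->.
by exists (complM qf qg); rewrite mul_frac.
Qed.

Definition spec_mul (s t : spec_sec U) : spec_sec U :=
  exist _ _ (spec_mul_subproof s t).

Lemma spec_mulA : associative spec_mul.
Proof. by move=> s t u; apply: spec_sec_eq => p Up; exact: cm_mulA. Qed.
Lemma spec_mulC : commutative spec_mul.
Proof. by move=> s t; apply: spec_sec_eq => p Up; exact: cm_mulC. Qed.
Lemma spec_mul1 : left_id (spec_const cm1) spec_mul.
Proof.
move=> s; apply: spec_sec_eq => p Up; exact: cm_mul1.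
Qed.
Lemma spec_mul0 : left_zero (spec_const cm0) spec_mul.
Proof. by move=> s; apply: spec_sec_eq => p Up; exact: cm_mul0. Qed.

Definition spec_O : cmon := CMon spec_mulA spec_mulC spec_mul1 spec_mul0.
End Ops.

Lemma spec_res_subproof (U V : opens (spec M)) (h : osub U V) (s : spec_sec V) :
  @locally_fraction U (fun p Up => sval s p (h p Up)).
Proof.
move=> p Up; case: (svalP s p (h p Up)) => W [Wp [a [f sE]]].
by exists W; split=> //; exists a, f => q Uq Wq; exact: sE.
Qed.

Definition spec_res_fun (U V : opens (spec M)) (h : osub U V)
  (s : spec_O V) : spec_O U := exist _ _ (spec_res_subproof h s).

Definition spec_res (U V : opens (spec M)) (h : osub U V) :
  cmhom (spec_O V) (spec_O U).
Proof. by exists (spec_res_fun h) => [||s t]; apply: spec_sec_eq. Defined.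

Lemma spec_res_id U (h : osub U U) s : spec_res h s = s.
Proof.
apply: spec_sec_eq => p Up /=; congr (sval s p _); exact: Prop_irrelevance.
Qed.

Lemma spec_res_comp U V W (h : osub U V) (k : osub V W) (l : osub U W) s :
  spec_res h (spec_res k s) = spec_res l s.
Proof.
apply: spec_sec_eq => p Up /=; congr (sval s p _); exact: Prop_irrelevance.
Qed.

Definition Spec_space : mspace := MSpace spec_res_id spec_res_comp.

Lemma spec_germ_unit (p : Spec_space) (U : opens Spec_space) (Up : U p)
    (s : ms_O Spec_space U) :
  is_unit (germ_at Up s) <-> is_unit (sval s p Up).
Proof.
split=> [[t]|us].
  rewrite -(quot_pi_repr t); case: (quot_repr t) => V Vp u.
  rewrite [LHS](@quot_mulE (germ_precmon p)).
  move=> /(@quot_piE (germ_precmon p)) [W [h [k [Wp e]]]].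
  have /= := congr1 (fun v : spec_sec W => sval v p Wp) e.
  rewrite frac_one_unique => e'; exists (sval u p Vp); rewrite -e'.
  by congr (sval s p _ ** sval u p _); exact: Prop_irrelevance.
case: (svalP s p Up) => V [Vp [a [f sE]]].
have pa : ~ p a.
  by move: us; case: (sE p Up Vp) => pf -> /is_unit_frac.
have oa : open (spec_open [set a]) by exists [set a].
pose W := opensI (opensI U V) (Opens oa).
have Wp : W p by split=> //; exists a.
have WU : osub W U by move=> q [[]].
have Wf q : W q -> ~ q f.
  by move=> [[Uq Vq] _]; case: (sE q Uq Vq).
have Wa q : W q -> ~ q a by move=> [_ [b -> ]].
have tf : @locally_fraction W (fun q Wq => frac f (Wa q Wq)).
  move=> q Wq; exists W; split=> //; exists f, a => r Wr _.
  by exists (Wa r Wr).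
pose t : ms_O Spec_space W := exist _ _ tf.
exists (@germ_at Spec_space p W Wp t).
rewrite [LHS](@quot_mulE (germ_precmon p)); apply/(@quot_piE (germ_precmon p)).
have h : osub W (opensI U W) by move=> q Wq; split=> //; exact: WU.
have k : osub W (opensT _) by [].
exists W, h, k; split=> //; apply: spec_sec_eq => q Wq.
have sf Uq (qa : ~ q a) : sval s q Uq ** frac f qa = cm1.
  have [[_ Vq] _] := Wq; case: (sE q Uq Vq) => qf ->; rewrite mul_frac.
  apply/fracE; exists cm1; first exact: compl1.
  by rewrite (cm_mulC a) (cm_mulC (f ** a)).
exact: sf.
Qed.
End Spec.

Section SpecMor.
Variables (M N : cmon) (r : cmhom M N).
Let c := @comap_continuous _ _ r.

Lemma spec_mor_subproof (V : opens (spec M)) (s : spec_sec V) :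
  @locally_fraction N (opens_preimage c V)
    (fun q Vq => locmap r q (sval s (comap r q) Vq)).
Proof.
move=> q Vq; case: (svalP s (comap r q) Vq) => W [Wq [a [f sE]]].
exists (opens_preimage c W); split=> //; exists (r a), (r f) => q' Vq' Wq'.
by case: (sE _ Vq' Wq') => qf ->; exists qf; rewrite /= locmap_frac.
Qed.

Definition spec_mor_fun (V : opens (spec M)) (s : spec_O V) :
  spec_O (opens_preimage c V) := exist _ _ (spec_mor_subproof s).

Definition spec_mor_sec (V : opens (spec M)) :
  cmhom (spec_O V) (spec_O (opens_preimage c V)).
Proof.
exists (@spec_mor_fun V) => [||s t]; apply: spec_sec_eq => q Vq.
- exact: (cmhom0 (locmap r q)).
- exact: (cmhom1 (locmap r q)).
- exact: (cmhomM (locmap r q)).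
Defined.

Lemma spec_mor_res (U V : opens (spec M)) (h : osub U V)
    (k : osub (opens_preimage c U) (opens_preimage c V)) s :
  spec_mor_sec U (spec_res h s) = spec_res k (spec_mor_sec V s).
Proof.
apply: spec_sec_eq => q Uq /=; congr (locmap_fun (sval s _ _)).
exact: Prop_irrelevance.
Qed.

Definition Spec_premor : mspace_premor (Spec_space N) (Spec_space M) :=
  @MSpacePremor (Spec_space N) (Spec_space M) _ c spec_mor_sec spec_mor_res.

Lemma Spec_local : local_mor Spec_premor.
Proof.
move=> q t; rewrite -(quot_pi_repr t); case: (quot_repr t) => V Vq s.
rewrite -[quot_pi _]/(germ_at Vq s) stalk_map_germ !spec_germ_unit /=.
case: (fracP (sval s (comap r q) Vq)) => a [f [pf ->]].
by rewrite locmap_frac !is_unit_frac.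
Qed.

Definition Spec_mor : mspace_mor (Spec_space N) (Spec_space M) :=
  MSpaceMor Spec_local.
End SpecMor.

(* An isomorphism onto an open subspace. *)
Definition open_immersion (X Y : mspace) (f : mspace_mor X Y) :=
  [/\ injective f,
      forall U : set X, open U -> open (f @` U) &
      forall V : opens Y, V `<=` range f -> bijective (pm_sec f V)].

Record geom_Mo_scheme := GeomMoScheme {
  gms_space :> mspace;
  gms_sheaf : is_sheaf gms_space;
  gms_cover : forall x : gms_space,
    exists (M : Mo) (f : mspace_mor (Spec_space M) gms_space),
      open_immersion f /\ range f x }.

Definition fin_gen_cmon (M : cmon) :=
  exists E : set M, finite_set E /\
    forall P : set M, P cm1 -> (forall a b, P a -> P b -> P (a ** b)) ->
      E `<=` P -> P = setT.

Definition noetherian_geom_Mo_scheme (X : geom_Mo_scheme) :=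
  exists (n : nat) (M : 'I_n -> Mo)
    (f : forall i, mspace_mor (Spec_space (M i)) X),
    (forall i, fin_gen_cmon (M i) /\ open_immersion (f i)) /\
    (forall x : X, exists i, range (f i) x).

Record category := Category {
  cat_obj :> Type;
  cat_hom : cat_obj -> cat_obj -> Type;
  cat_id : forall a, cat_hom a a;
  cat_comp : forall a b c, cat_hom b c -> cat_hom a b -> cat_hom a c;
  cat_compA : forall a b c d (h : cat_hom c d) (g : cat_hom b c)
    (f : cat_hom a b), cat_comp h (cat_comp g f) = cat_comp (cat_comp h g) f;
  cat_comp1 : forall a b (f : cat_hom a b), cat_comp f (cat_id a) = f;
  cat_1comp : forall a b (f : cat_hom a b), cat_comp (cat_id b) f = f }.

Record set_functor (C : category) := SetFunctor {
  sf_obj :> C -> Type;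
  sf_map : forall a b : C, cat_hom a b -> sf_obj a -> sf_obj b;
  sf_id : forall a x, sf_map (cat_id a) x = x;
  sf_comp : forall a b c (g : cat_hom b c) (f : cat_hom a b) x,
    sf_map (cat_comp g f) x = sf_map g (sf_map f x) }.

Lemma rmorphism_eq (A B : comPzRingType) (f g : {rmorphism A -> B}) :
  f =1 g -> f = g.
Proof.
case: f g => [f cf] [g cg] /= /funext fg; subst g; congr GRing.RMorphism.Pack.
case: cf cg => [[a] [b]] [[a'] [b']].
by rewrite (Prop_irrelevance a a') (Prop_irrelevance b b').
Qed.

Lemma rmorphism_compA (A B C D : comPzRingType) (h : {rmorphism C -> D})
    (g : {rmorphism B -> C}) (f : {rmorphism A -> B}) :
  h \o (g \o f) = (h \o g) \o f :> {rmorphism A -> D}.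
Proof. exact: rmorphism_eq. Qed.

Lemma rmorphism_comp1 (A B : comPzRingType) (f : {rmorphism A -> B}) :
  f \o idfun = f :> {rmorphism A -> B}.
Proof. exact: rmorphism_eq. Qed.

Lemma rmorphism_1comp (A B : comPzRingType) (f : {rmorphism A -> B}) :
  idfun \o f = f :> {rmorphism A -> B}.
Proof. exact: rmorphism_eq. Qed.

Lemma cmhom_compA (A B C D : cmon) (h : cmhom C D) (g : cmhom B C)
    (f : cmhom A B) :
  cmhom_comp h (cmhom_comp g f) = cmhom_comp (cmhom_comp h g) f.
Proof. exact: cmhom_eq. Qed.

Lemma cmhom_comp1 (A B : cmon) (f : cmhom A B) : cmhom_comp f (cmhom_id A) = f.
Proof. exact: cmhom_eq. Qed.

Lemma cmhom_1comp (A B : cmon) (f : cmhom A B) : cmhom_comp (cmhom_id B) f = f.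
Proof. exact: cmhom_eq. Qed.

Definition Ring_cat : category :=
  @Category comPzRingType (fun A B => {rmorphism A -> B}) (fun A => idfun)
    (fun A B C g f => g \o f)
    rmorphism_compA rmorphism_comp1 rmorphism_1comp.

Definition Mo_cat : category :=
  @Category Mo cmhom cmhom_id (fun A B C => @cmhom_comp A B C)
    (fun A B C D => @cmhom_compA A B C D)
    (fun A B => @cmhom_comp1 A B) (fun A B => @cmhom_1comp A B).

(* The category glued along the adjunction beta -| beta^*. *)
Inductive MR := MRring of comPzRingType | MRmon of Mo.

Definition MR_hom (a b : MR) : Type :=
  match a, b with
  | MRring A, MRring B => {rmorphism A -> B}
  | MRmon M, MRmon N => cmhom M N
  | MRmon M, MRring A => cmhom M (beta_star A)
  | MRring _, MRmon _ => Empty_set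
  end.

Definition MR_id (a : MR) : MR_hom a a :=
  match a with MRring R => idfun | MRmon M => cmhom_id M end.

Definition MR_comp (a b c : MR) : MR_hom b c -> MR_hom a b -> MR_hom a c :=
  match a, b, c with
  | MRring _, MRring _, MRring _ => fun g f => g \o f
  | MRring _, MRring _, MRmon _ => fun g _ => g
  | MRring _, MRmon _, _ => fun _ f => match f with end
  | MRmon _, MRring _, MRring _ => fun g f => cmhom_comp (beta_starM g) f
  | MRmon _, MRring _, MRmon _ => fun g _ => match g with end
  | MRmon _, MRmon _, MRring _ => fun g f => cmhom_comp g f
  | MRmon _, MRmon _, MRmon _ => fun g f => cmhom_comp g f
  end.

Lemma MR_compA a b c d (h : MR_hom c d) (g : MR_hom b c) (f : MR_hom a b) :
  MR_comp h (MR_comp g f) = MR_comp (MR_comp h g) f.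
Proof.
case: a b c d h g f => [A|A] [B|B] [C|C] [D|D] //= h g f.
all: by [apply: rmorphism_eq|apply: cmhom_eq|case: f|case: g|case: h].
Qed.

Lemma MR_comp1 a b (f : MR_hom a b) : MR_comp f (MR_id a) = f.
Proof.
case: a b f => [A|A] [B|B] //= f.
all: by [apply: rmorphism_eq|apply: cmhom_eq|case: f].
Qed.

Lemma MR_1comp a b (f : MR_hom a b) : MR_comp (MR_id b) f = f.
Proof.
case: a b f => [A|A] [B|B] //= f.
all: by [apply: rmorphism_eq|apply: cmhom_eq|case: f].
Qed.

Definition MR_cat : category := Category MR_compA MR_comp1 MR_1comp.

Section Restrict.
Variable X : set_functor MR_cat.

Definition restrict_ring : set_functor Ring_cat :=
  @SetFunctor Ring_cat (fun R => X (MRring R))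
    (fun A B => @sf_map _ X (MRring A) (MRring B))
    (fun A => @sf_id _ X (MRring A))
    (fun A B C => @sf_comp _ X (MRring A) (MRring B) (MRring C)).

Definition restrict_mon : set_functor Mo_cat :=
  @SetFunctor Mo_cat (fun M => X (MRmon M))
    (fun A B => @sf_map _ X (MRmon A) (MRmon B))
    (fun A => @sf_id _ X (MRmon A))
    (fun A B C => @sf_comp _ X (MRmon A) (MRmon B) (MRmon C)).

(* e : X o beta^* -> X_Z, the image under X of the morphism beta^* R -> R of MR
   corresponding to the identity of beta^* R. *)
Definition eval_nat (R : comNzRingType) :
  X (MRmon (beta_starMo R)) -> X (MRring R) :=
  @sf_map _ X (MRmon (beta_starMo R)) (MRring R) (cmhom_id (beta_star R)).
End Restrict.

Section RingFunctors.
Local Open Scope ring_scope.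
Variable X : set_functor Ring_cat.
Local Notation mapX := (@sf_map _ X _ _).

(* By the Yoneda lemma an element u of X(A) is a natural transformation from
   Hom(A, -) to X. It identifies Hom(A, -) with an open subfunctor U of X if it
   is injective and if, for all B and xi in X(B), the subfunctor of Hom(B, -)
   where xi restricts to U is D(I) = {r | r(I) generates the unit ideal}, for
   some ideal I of B; I is given by a set E of generators. *)
Definition open_chart_ring (A : Ring_cat) (u : X A) :=
  (forall B : Ring_cat, injective (fun r : cat_hom A B => mapX r u)) /\
  (forall (B : comPzRingType) (xi : X B), exists E : set B,
    forall (C : comPzRingType) (r : {rmorphism B -> C}),
      (exists t : {rmorphism A -> C}, mapX t u = mapX r xi) <->
      (exists (n : nat) (c : 'I_n -> C) (b : 'I_n -> B),
         (forall i, E (b i)) /\ \sum_(i < n) c i * r (b i) = 1)).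

Definition open_affine_cover_ring (I : Type) (A : I -> Ring_cat)
    (u : forall i, X (A i)) :=
  (forall i, open_chart_ring (u i)) /\
  (forall (K : fieldType) (x : X K),
     exists (i : I) (t : {rmorphism A i -> K}), mapX t (u i) = x).

(* r : A -> B is a localization A -> A_f *)
Definition is_localization (A B : comPzRingType) (f : A)
    (r : {rmorphism A -> B}) :=
  [/\ exists v, r f * v = 1,
      forall b, exists (a : A) (n : nat), b * r f ^+ n = r a &
      forall a, r a = 0 -> exists n : nat, f ^+ n * a = 0].

Definition zariski_local :=
  forall (A : comPzRingType) (n : nat) (f c : 'I_n -> A),
  \sum_(i < n) c i * f i = 1 ->
  forall (B : 'I_n -> comPzRingType) (r : forall i, {rmorphism A -> B i})
    (D : 'I_n -> 'I_n -> comPzRingType)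
    (p : forall i j, {rmorphism B i -> D i j})
    (q : forall i j, {rmorphism B j -> D i j}),
  (forall i, is_localization (f i) (r i)) ->
  (forall i j, p i j \o r i =1 q i j \o r j) ->
  (forall i j, is_localization (f i * f j) (p i j \o r i)) ->
  forall t : forall i, X (B i),
  (forall i j, mapX (p i j) (t i) = mapX (q i j) (t j)) ->
  exists! x : X A, forall i, mapX (r i) x = t i.

Definition is_Z_scheme :=
  zariski_local /\
  exists (I : Type) (A : I -> Ring_cat) (u : forall i, X (A i)),
    open_affine_cover_ring u.

Definition noetherian_ring (A : comPzRingType) :=
  forall I : set A, I 0 -> (forall a b, I a -> I b -> I (a + b)) ->
  (forall a b, I b -> I (a * b)) ->
  exists (n : nat) (g : 'I_n -> A), (forall i, I (g i)) /\
    forall a, I a -> exists c : 'I_n -> A, a = \sum_(i < n) c i * g i.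

Definition noetherian_Z_scheme :=
  exists (n : nat) (A : 'I_n -> Ring_cat) (u : forall i, X (A i)),
    open_affine_cover_ring u /\ forall i, noetherian_ring (A i).

End RingFunctors.

Section MonFunctors.
Variable X : set_functor Mo_cat.
Local Notation mapX := (@sf_map _ X _ _).

(* As for rings; the ideal of C generated by a subset F is the union of the
   principal ideals generated by the elements of F. *)
Definition open_chart_mon (A : Mo_cat) (u : X A) :=
  (forall B : Mo_cat, injective (fun r : cat_hom A B => mapX r u)) /\
  (forall (B : Mo) (xi : X B), exists E : set B,
    forall (C : Mo) (r : cmhom B C),
      (exists t : cmhom A C, mapX t u = mapX r xi) <->
      (exists (c : C) (b : B), E b /\ c ** r b = cm1)).

(* The monoids F_1[H] play the part of the fields. *)
Definition is_Mo_scheme :=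
  exists (I : Type) (A : I -> Mo_cat) (u : forall i, X (A i)),
    (forall i, open_chart_mon (u i)) /\
    (forall (H : zmodType) (x : X (F1 H)),
       exists (i : I) (t : cmhom (A i) (F1 H)), mapX t (u i) = x).

(* G represents X: X(M) = Hom(Spec M, G), naturally in M. *)
Definition geometric_realization (G : geom_Mo_scheme) :=
  exists theta : forall M : Mo, mspace_mor (Spec_space M) G -> X M,
    (forall M, bijective (theta M)) /\
    (forall (M N : Mo) (r : cmhom M N) (f : mspace_mor (Spec_space M) G),
       theta N (mspace_comp f (Spec_mor r)) = mapX r (theta M f)).

End MonFunctors.

Record F1_scheme := F1Scheme {
  F1_functor :> set_functor MR_cat;
  F1_ring : is_Z_scheme (restrict_ring F1_functor);
  F1_mon : is_Mo_scheme (restrict_mon F1_functor);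
  F1_field : forall K : fieldType, bijective (@eval_nat F1_functor K) }.

(* G is the geometric Mo-scheme attached to X. *)
Definition noetherian_F1_scheme (X : F1_scheme) (G : geom_Mo_scheme) :=
  noetherian_Z_scheme (restrict_ring X) /\ noetherian_geom_Mo_scheme G.

Local Open Scope complex_scope.
Local Open Scope ring_scope.
Local Open Scope card_scope.

Section Analysis.
Variable R : realType.
Local Notation C := R[i].
Implicit Types (s z : C) (k u a : R).

Definition cexp z : C :=
  (expR (complex.Re z))%:C * (cos (complex.Im z) +i* sin (complex.Im z)).

Definition cabs z : R := Normc.normc z.

(* The principal determination, in ]-pi, pi]. *)
Definition carg z : R :=
  let t := acos (complex.Re z / cabs z) in
  if 0 <= complex.Im z then t else - t.

Definition clog z : C := ln (cabs z) +i* carg z.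

Definition cpow z w : C := cexp (w * clog z).

Definition ccos z : C := (cexp ('i%C * z) + cexp (- 'i%C * z)) / 2.

Definition is_cderive (f : C -> C) s (l : C) :=
  is_derive (s : C^o) 1 (f : C^o -> C^o) l.

Definition entire (f : C -> C) := forall s, exists l, is_cderive f s l.

Definition cint (g : R -> C) : C :=
  Rintegral lebesgue_measure `[1, +oo[ (fun u => complex.Re (g u)) +i*
  Rintegral lebesgue_measure `[1, +oo[ (fun u => complex.Im (g u)).

Definition mellin (N : C -> C) s : C :=
  cint (fun u => N u%:C * cpow u%:C (- s) / u%:C).

Definition growth (N : C -> C) k :=
  exists K : R, forall u, 1 <= u -> cabs (N u%:C) <= K * u `^ k.

Definition zeta_domain (N : C -> C) : set C :=
  [set s | exists2 k, growth N k & k < complex.Re s].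

Definition is_zeta (N zeta : C -> C) :=
  forall s, zeta_domain N s ->
    zeta s != 0 /\
    exists l, is_cderive zeta s l /\ l / zeta s = - mellin N s.

Definition eq_upto_cst (D : set C) (f g : C -> C) :=
  exists2 c : C, c != 0 & forall s, D s -> f s = c * g s.

Definition canonical_form (N : C -> C) :=
  exists (m : nat) (I : seq rat) (t : nat -> rat -> C) (q : nat -> C),
    [/\ uniq I, (forall al, al \in I -> - (1 / 2) < al < 1 / 2) &
      forall z, N z =
        \sum_(j < m) \sum_(al <- I)
          t j al * cexp ((2 * pi * ratr al)%:C * 'i%C * z) * z ^+ j +
        ccos (pi%:C * z) * \sum_(j < m) q j * z ^+ j].

(* N is the canonical extension of the function whose value at n + 1, for
   n = m.+1 >= 1, is the cardinality of T m. *)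
Definition counting_function (T : nat -> Type) (N : C -> C) :=
  canonical_form N /\
  forall m : nat, exists k : nat,
    [set: T m] #= `I_k /\ N (m.+2)%:R = k%:R.

Definition is_f a (f : C -> C) :=
  entire f /\
  forall s, 0 < complex.Re s -> f s = mellin (fun z => cexp ('i%C * a%:C * z)) s.

Definition xi_sum (d : nat) (f : R -> C -> C) s : C :=
  \sum_(k <- [seq j%:Z - d%:Z | j <- iota 0 (2 * d).+1]
       | (k != 0) && (2 * `|k| <= d)%N)
    (if (2 * `|k| == d)%N then 2^-1 else 1) *
    cexp (- 'i%C * (2 * pi * k%:~R / d%:R)%:C) * f (2 * pi * k%:~R / d%:R) s.

(* H is determined up to an additive constant, hence xi_d up to a
   multiplicative one. For d > 1 no primitive H tends to 0 when Re(s) tends to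
   +oo, as its derivative is equivalent to (d - 1)/s there. *)
Definition is_xi (d : nat) (xi : C -> C) :=
  exists (f : R -> C -> C) (H : C -> C),
    [/\ forall a, a != 0 -> is_f a (f a),
        forall s, is_cderive H s (xi_sum d f s) &
        forall s, xi s = cpow s (- ((totient d)%:R / d%:R)) *
                         cexp (- ((totient d)%:R / d%:R) * H s)].

Definition gamma (H : finZmodType) (d : nat) : nat :=
  #|[set K : {group H} | cyclic K & #|K| == d]%SET|.

Definition zeta_F1 (xi : nat -> C -> C) (H : finZmodType) s : C :=
  \prod_(d <- divisors #|H|) xi d s ^+ gamma H d.

Definition zeta_constituent (xi : nat -> C -> C) (H : finZmodType) (n : nat) s :
  C :=
  \prod_(k < n.+1)
    zeta_F1 xi H (s - n%:R + k%:R) ^ ((-1) ^+ k * ('C(n, k))%:Z).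

End Analysis.

(* #X(F_{1^n}) for n = m.+1 *)
Definition points_F1n (X : F1_scheme) (m : nat) : Type :=
  X (MRmon (F1 'I_m.+1)).

(* Hom(O_x^*, Z/nZ) for n = m.+1 *)
Definition units_characters (G : geom_Mo_scheme) (x : G) (m : nat) : Type :=
  {additive units (stalk x) -> 'I_m.+1}.

(* O_x^* = H x Z^n *)
Definition units_type (G : geom_Mo_scheme) (x : G) (H : finZmodType) (n : nat) :=
  exists f : {additive units (stalk x) -> (H * 'rV[int]_n)%type}, bijective f.

(* Main.v *)
Require Import Defs.
From HB Require Import structures.
From mathcomp Require Import all_boot all_order all_algebra all_fingroup.
From mathcomp Require Import all_solvable complex.
From mathcomp Require Import all_classical all_reals all_analysis.
From mathcomp Require Import measurable_realfun ring lra zify.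

(** The theorem says that everything about the zeta function of a Noetherian
    F_1-scheme can be read off the unit groups of its finitely many local
    monoids.

    Geometry. A prime ideal of a finitely generated monoid is determined by the
    generators that it contains, so that a Noetherian Mo-scheme has finitely
    many points ([noetherian_finite]). In an affine chart the stalk at a point
    is a localization ([germ_frac]), whose units are fractions of generators;
    hence the unit group is finitely generated ([units_fg]) and isomorphic to
    some H x Z^n, by the Smith normal form ([fg_zmod_structure]). The spectrum
    of F_1[V], V an abelian group, is a single point, and a local morphism from
    it to G consists of a point x of G and of a homomorphism O_x -> F_1[V] under
    which exactly the units have a nonzero image, that is, of a character
    O_x^* -> V ([pt_mor_of_bij]). So the number of points of X over F_{1^m} is
    the sum over x of the number of homomorphisms O_x^* -> Z/m.

    Counting. There are m^n times as many homomorphisms H x Z^n -> Z/m as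
    homomorphisms H -> Z/m. A finite abelian group is isomorphic to its dual, so
    that the latter are as numerous as the elements of H of order dividing m
    ([finite_self_dual]); grouping these by the cyclic subgroup that they
    generate gives the sum over d of gamma(H, d) phi(d) times the indicator of
    d | m ([card_torsion]). The indicator of dZ is the average of the characters
    k |-> exp(2 i pi k n / d), which yields the canonical extension in closed
    form ([count_fun]). A canonical extension is determined by its values at the
    integers ([canonical_unique]), because on a residue class it is a polynomial
    and because powers of distinct numbers are linearly independent. Therefore
    [count_fun] is the only possible counting function of a constituent, and the
    counting function of X is the sum of those of its constituents.

    Zeta functions. A zeta function is prescribed by its logarithmic derivative,
    minus the Mellin transform of the counting function, and two functions with
    the same logarithmic derivative on a right half-plane are proportional
    ([log_derive_unique]). The Mellin transform is additive, so the zeta function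
    of a sum is the product of the zeta functions. Each term of the defining sum
    of xi_d is the Mellin transform of one character in the average, and the
    Mellin transform of 1 is 1/s ([mellin1]); this gives the logarithmic
    derivative of xi_d ([log_derive_xi]). Multiplication by u shifts the Mellin
    transform by 1, and the binomial expansion of (u - 1)^n gives the alternating
    product of the shifts of zeta(F_1[H], s) ([mellin_count_fun]).

    One point needs care: these equalities have to hold on the half-plane where
    the growth of the counting function makes its zeta function meaningful. As
    counting functions are nonnegative at the integers, no cancellation can make
    the sum grow more slowly than one of its terms ([growth_lower_bound]). *)

Set Implicit Arguments.
Unset Strict Implicit.
Unset Printing Implicit Defensive.

Import Order.TTheory GRing.Theory Num.Theory.
Import numFieldNormedType.Exports.

Local Open Scope classical_set_scope.
Local Open Scope complex_scope.
Local Open Scope ring_scope.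
Local Open Scope card_scope.

(** * Finitely generated abelian groups and their characters *)

(** Cardinals are computed with an encoding in a finite type. *)
Lemma card_setT_pred (T : Type) (F : finType) (P : pred F) (f : T -> F) :
  injective f -> (forall x, P (f x)) ->
  (forall y, P y -> exists x, f x = y) -> [set: T] #= `I_#|P|.
Proof.
move=> fI fP fS; apply/card_set_bijP.
exists (fun x => index (f x) (enum P)); split.
- by move=> x _ /=; rewrite cardE index_mem mem_enum; exact: fP.
- move=> x y _ _ /= /(congr1 (nth (f x) (enum P))).
  by rewrite !nth_index ?mem_enum; [exact: fI|exact: fP|exact: fP].
move=> k /= kP; have [x fx] := fS _ (enum_valP (Ordinal kP)).
exists x => //=; rewrite fx (enum_val_nth (enum_val (Ordinal kP))) /=.
by rewrite index_uniq ?enum_uniq // -cardE.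
Qed.

Lemma additive_eq (U V : zmodType) (f g : {additive U -> V}) : f =1 g -> f = g.
Proof.
case: f g => [f cf] [g cg] /= /funext fg; subst g.
congr GRing.Additive.Pack.
by case: cf cg => [[a]] [[b]]; rewrite (Prop_irrelevance a b).
Qed.

Lemma mkadditive (U V : zmodType) (f : U -> V) :
  {morph f : x y / x + y} -> {g : {additive U -> V} | g =1 f}.
Proof.
move=> fD.
have fB : zmod_morphism f.
  move=> x y; have f0 : f 0 = 0 by apply: (addIr (f 0)); rewrite -fD !add0r.
  have fN z : f (- z) = - f z by apply: (addIr (f z)); rewrite -fD !addNr f0.
  by rewrite fD fN.
by exists (HB.pack f (GRing.isZmodMorphism.Build U V f fB) : {additive U -> V}).
Qed.

Lemma pairD (U V : zmodType) (a b : U) (c d : V) :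
  (a, c) + (b, d) = (a + b, c + d).
Proof. by []. Qed.

(** Additive maps, as finite functions: these form a finite type, in which they
    can be counted. *)
Definition hom_ffun (H V : finZmodType) : {pred {ffun H -> V}} :=
  [pred f : {ffun H -> V} | [forall x, forall y, f (x + y) == f x + f y]].
Arguments hom_ffun : clear implicits.

Lemma hom_ffunP (H V : finZmodType) (f : {ffun H -> V}) :
  reflect {morph f : x y / x + y} (f \in hom_ffun H V).
Proof.
apply: (iffP forallP) => [h x y|h x]; first exact/eqP/(forallP (h x)).
by apply/forallP => y; rewrite h.
Qed.

(** A homomorphism from [H * Z^n] is given by its restriction to [H] and by the
    images of the [n] basis vectors, which are arbitrary. *)
Lemma card_hom_split (U : zmodType) (H : finZmodType) n (V : finZmodType)
    (f : {additive U -> (H * 'rV[int]_n)%type}) : bijective f ->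
  [set: {additive U -> V}] #= `I_(#|hom_ffun H V| * #|V| ^ n).
Proof.
move=> [g gK fK].
have gD : {morph g : x y / x + y} by move=> x y; apply: (can_inj gK); rewrite raddfD !fK.
have {}[g' g'E] := mkadditive gD.
have {gD fK} fK : cancel g' f by move=> x; rewrite g'E.
have {g gK g'E} gK : cancel f g' by move=> x; rewrite g'E.
pose P : pred ({ffun H -> V} * {ffun 'I_n -> V}) := [pred p | p.1 \in hom_ffun H V].
have -> : (#|hom_ffun H V| * #|V| ^ n = #|P|)%N.
  rewrite -{1}[n]card_ord -card_ffun -cardX; apply: eq_card => -[a b].
  by rewrite !inE andbT.
pose F (phi : {additive U -> V}) : {ffun H -> V} * {ffun 'I_n -> V} :=
  ([ffun h => phi (g' (h, 0))], [ffun i => phi (g' (0, delta_mx 0 i))]).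
have phiE (phi : {additive U -> V}) h (v : 'rV[int]_n) :
    phi (g' (h, v)) = (F phi).1 h + \sum_i (F phi).2 i *~ v 0 i.
  have qD : {morph (fun w => phi (g' (0, w))) : x y / x + y}.
    by move=> x y; rewrite -!raddfD; congr (phi (g' _)); rewrite pairD addr0.
  have [q qE] := mkadditive qD.
  have -> : (h, v) = (h, 0) + (0, v) by rewrite pairD addr0 add0r.
  rewrite !raddfD /= ffunE; congr (_ + _).
  rewrite -[LHS]qE [v in LHS]row_sum_delta raddf_sum; apply: eq_bigr => i _.
  by rewrite -{1}[v 0 i]intz scaler_int raddfMz ffunE qE.
apply: (@card_setT_pred _ _ P F) => [phi psi e|phi|[a b] /hom_ffunP aD].
- apply: additive_eq => u; rewrite -(gK u); case: (f u) => h v.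
  by rewrite !phiE e.
- apply/hom_ffunP => x y; rewrite !ffunE -!raddfD; congr (phi (g' _)).
  by rewrite pairD addr0.
pose psi (u : U) := a (f u).1 + \sum_i b i *~ (f u).2 0 i.
have psiD : {morph psi : x y / x + y}.
  move=> x y; rewrite /psi raddfD /= aD addrACA -big_split; congr (_ + _).
  by apply: eq_bigr => i _; rewrite mxE mulrzDr.
have [phi phiP] := mkadditive psiD; exists phi; rewrite /F.
have a0 : a 0 = 0 by apply: (addIr (a 0)); rewrite -aD !add0r.
congr pair; apply/ffunP => i; rewrite ffunE phiP /psi fK /= ?a0 ?add0r.
  by rewrite big1 ?addr0 // => j _; rewrite mxE.
rewrite (bigD1 i) //= big1 ?addr0 => [|j ji]; rewrite mxE !eqxx ?mulr1z //.
by rewrite (negPf ji).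
Qed.

(** The finite group structure on a product, for torsion groups built as products
    of cyclic groups. *)
HB.instance Definition _ (H K : finZmodType) := GRing.Zmodule.on (H * K)%type.

(** The numerical trace of the isomorphism of a finite abelian group with its
    dual: the characters killed by [m] are as numerous as the elements killed
    by [m]. *)
Definition self_dual (H : finZmodType) :=
  forall m, #|hom_ffun H 'I_m.+1| = #|[pred h : H | h *+ m.+1 == 0]|.

(** The map [a |-> a D / M] identifies the [D]-torsion of Z/M with the [M]-torsion
    of Z/D; by symmetry its injectivity suffices. *)
Lemma card_torsion_Zp_le D M :
  (#|[pred a : 'I_M.+1 | a *+ D.+1 == 0%R]| <=
   #|[pred b : 'I_D.+1 | b *+ M.+1 == 0%R]|)%N.
Proof.
have E m k (a : 'I_m.+1) : (a *+ k == 0) = (m.+1 %| a * k)%N.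
  by rewrite Zp_mulrn -val_eqE /= /dvdn.
pose f (a : 'I_M.+1) : 'I_D.+1 := inord (a * D.+1 %/ M.+1).
have fE a : a \in [pred a : 'I_M.+1 | a *+ D.+1 == 0] -> (f a * M.+1 = a * D.+1)%N.
  rewrite inE E => h; rewrite inordK ?divnK //.
  by rewrite ltn_divLR // mulnC ltn_mul2l /= ltn_ord.
rewrite -(card_in_image (f := f)) => [|a b aP bP ab]; last first.
  apply/val_inj/eqP; rewrite /= -(eqn_pmul2r (ltn0Sn D)) -!fE //.
  by rewrite ab.
apply: subset_leq_card; apply/fintype.subsetP => _ /fintype.imageP[a aP ->].
by rewrite inE E fE // dvdn_mull.
Qed.

Lemma self_dual_Zp d : self_dual 'I_d.+1.
Proof.
move=> m; transitivity #|[pred a : 'I_m.+1 | a *+ d.+1 == 0]|; last first.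
  by apply/eqP; rewrite eqn_leq !card_torsion_Zp_le.
pose g : 'I_d.+1 := inZp 1.
have gE (x : 'I_d.+1) : x = g *+ x.
  by apply: val_inj; rewrite Zp_mulrn /= modnMml mul1n modn_small.
have aE (f : {ffun 'I_d.+1 -> 'I_m.+1}) : f \in hom_ffun _ _ -> forall x, f x = f g *+ x.
  move=> /hom_ffunP fD x.
  have f0 : f 0 = 0 by apply: (addIr (f 0)); rewrite -fD !add0r.
  rewrite {1}[x]gE; elim: (nat_of_ord x) => [|k IH] //.
  by rewrite !mulrS fD IH.
rewrite -(card_in_image (f := fun f : {ffun 'I_d.+1 -> 'I_m.+1} => f g)); last first.
  by move=> f h fP hP e; apply/ffunP => x; rewrite aE // e -aE.
apply: eq_card => a; rewrite inE; apply/fintype.imageP/idP => [[f fP ->]|/eqP a0].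
  have /hom_ffunP fD := fP.
  rewrite mulrSr.
  have := aE f fP (inZp d); rewrite /= modn_small // => <-.
  rewrite -fD; have -> : (inZp d : 'I_d.+1) + g = 0.
    by apply: val_inj; rewrite /= modnDm addn1 modnn.
  by apply/eqP/(addIr (f 0)); rewrite -fD !add0r.
have aM k : a *+ (k %% d.+1) = a *+ k.
  by rewrite {2}(divn_eq k d.+1) mulrnDr mulnC mulrnA a0 mul0rn add0r.
exists [ffun x : 'I_d.+1 => a *+ x]; last by rewrite ffunE /= aM mulr1n.
by apply/hom_ffunP => x y; rewrite !ffunE /= aM mulrnDr.
Qed.

Lemma self_dual_prod (H K : finZmodType) :
  self_dual H -> self_dual K -> self_dual (H * K)%type.
Proof.
move=> dH dK m.
have -> : #|[pred h : (H * K)%type | h *+ m.+1 == 0]| =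
    #|[predX [pred h : H | h *+ m.+1 == 0] & [pred h : K | h *+ m.+1 == 0]]|.
  apply: eq_card => -[a b]; rewrite !inE /=.
  have -> n : (a, b) *+ n = (a *+ n, b *+ n).
    by elim: n => [|n IH] //; rewrite !mulrS IH.
  by [].
rewrite cardX -dH -dK -cardX.
pose F (f : {ffun (H * K)%type -> 'I_m.+1}) :=
  ([ffun a => f (a, 0)] : {ffun H -> 'I_m.+1}, [ffun b => f (0, b)] : {ffun K -> 'I_m.+1}).
have FE f : f \in hom_ffun _ _ -> forall a b, f (a, b) = (F f).1 a + (F f).2 b.
  by move=> /hom_ffunP fD a b; rewrite !ffunE -fD pairD addr0 add0r.
rewrite -(card_in_image (f := F)) => [|f g fP gP e]; last first.
  by apply/ffunP => -[a b]; rewrite !FE // e.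
apply: eq_card => -[u v]; apply/fintype.imageP/andP => [[f /hom_ffunP fD [-> ->]]|[]].
  by split; apply/hom_ffunP => x y; rewrite !ffunE -fD pairD add0r.
move=> /= /hom_ffunP uD /hom_ffunP vD.
have u0 : u 0 = 0 by apply: (addIr (u 0)); rewrite -uD !add0r.
have v0 : v 0 = 0 by apply: (addIr (v 0)); rewrite -vD !add0r.
exists [ffun x => u x.1 + v x.2].
  by apply/hom_ffunP => x y; rewrite !ffunE /= uD vD addrACA.
by congr pair; apply/ffunP => x; rewrite !ffunE /= ?u0 ?v0 ?addr0 ?add0r.
Qed.

Lemma self_dual_iso (H K : finZmodType) (f : {additive H -> K}) :
  bijective f -> self_dual K -> self_dual H.
Proof.
move=> [g gK fK] dK m.
have gD : {morph g : x y / x + y} by move=> x y; apply: (can_inj gK); rewrite raddfD !fK.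
transitivity #|hom_ffun K 'I_m.+1|; last first.
  rewrite dK -(fintype.card_image (can_inj gK)); apply: eq_card => y.
  rewrite inE; apply/idP/fintype.imageP => [/eqP y0|[x]].
    exists (g y); last by rewrite fK.
    by rewrite inE; apply/eqP/(can_inj gK); rewrite raddfMn fK y0 raddf0.
  by rewrite inE => /eqP x0 ->; rewrite -raddfMn x0 raddf0.
pose F (h : {ffun H -> 'I_m.+1}) : {ffun K -> 'I_m.+1} := [ffun x => h (g x)].
rewrite -(card_in_image (f := F)) => [|h k _ _ /ffunP e]; last first.
  by apply/ffunP => x; have := e (f x); rewrite !ffunE gK.
apply: eq_card => u; apply/fintype.imageP/hom_ffunP => [[h /hom_ffunP hD ->] x y|uD].
  by rewrite !ffunE gD hD.
exists [ffun x => u (f x)].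
  by apply/hom_ffunP => x y; rewrite !ffunE raddfD uD.
by apply/ffunP => x; rewrite !ffunE fK.
Qed.

Lemma row_mx1D n (a b : int) (u v : 'rV[int]_n) :
  row_mx (a + b)%:M (u + v) = row_mx a%:M u + row_mx b%:M v :> 'rV[int]_n.+1.
Proof. by apply/rowP => i; rewrite !mxE; case: (fintype.split _) => j; rewrite !mxE ?mulrnDl. Qed.

Lemma row_mx10 n (a : int) (u : 'rV[int]_n) :
  (row_mx a%:M u : 'rV_(1 + n)) ord0 ord0 = a.
Proof.
have -> : ord0 = lshift n (0 : 'I_1) by apply: val_inj.
by rewrite row_mxEl mxE eqxx.
Qed.

(** The group [Z^m / (d_1 Z x ... x d_m Z)], presented by the projection [F] onto
    it: a zero [d_i] contributes a factor Z, the other ones a factor [Z / d_i].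
    Self-duality is carried along since it passes to products. *)
Lemma diag_quotient m (d : 'I_m -> nat) :
  exists (H : finZmodType) n (F : 'rV[int]_m -> (H * 'rV[int]_n)%type),
    [/\ {morph F : x y / x + y}, forall y, exists x, F x = y,
        forall v, F v = 0 <-> forall i, (d i %| v ord0 i)%Z & self_dual H].
Proof.
elim: m d => [|m IH] d.
  exists 'I_1, 0%N, (fun=> 0); split=> [x y|y|v|]; rewrite ?addr0 //.
  - by exists 0; case: y => a b; congr pair; [rewrite [a]ord1|rewrite [b]thinmx0].
  - by split=> // _ [].
  exact: self_dual_Zp.
have [H [n [F [FD FS FK dH]]]] := IH (fun i => d (lift ord0 i)).
pose tl (v : 'rV[int]_(1 + m)) := rsubmx v.
have tlD : {morph tl : x y / x + y} by move=> x y; rewrite /tl linearD.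
have tlE v i : tl v ord0 i = v ord0 (lift ord0 i).
  by rewrite mxE; congr (v _ _); apply: val_inj.
have splitP (v : 'rV[int]_(1 + m)) :
    (forall i : 'I_m.+1, (d i %| v ord0 i)%Z) <-> (d ord0 %| v ord0 ord0)%Z /\ F (tl v) = 0.
  rewrite FK; split=> [h|[h0 h] i]; first by split=> // i; rewrite tlE.
  by case: (unliftP ord0 i) => [j ->|->] //; rewrite -tlE.
case d0E : (d ord0) => [|d0].
  exists H, n.+1, (fun v : 'rV[int]_(1 + m) =>
    ((F (tl v)).1, row_mx (v ord0 ord0)%:M (F (tl v)).2 : 'rV_(1 + n))).
  split=> [x y|[a b]|v|//].
  - rewrite tlD FD mxE pairD; congr pair.
    exact: row_mx1D.
  - have [x xE] := FS (a, rsubmx (b : 'rV_(1 + n))).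
    exists (row_mx (b ord0 ord0)%:M x); rewrite /tl row_mxKr xE row_mx10 /=; congr pair.
    rewrite -[RHS](@hsubmxK _ 1 1 n).
    apply: (congr1 (fun z : 'M[int]_(1, 1) => row_mx z (rsubmx (b : 'rV_(1 + n))) : 'rV_n.+1)).
    apply/rowP => i.
    by rewrite !mxE (ord1 i) mulr1n; congr (b _ _); apply: val_inj.
  - rewrite splitP d0E dvd0z; split=> [|[/eqP -> ->]] /=; last first.
      by congr pair; rewrite -[RHS](@row_mx0 _ 1 1 n) raddf0.
    case=> a0; rewrite -[RHS](@row_mx0 _ 1 1 n) => e.
    have [v0 w0] := @eq_row_mx _ 1 1 n _ _ _ _ e.
    split; last by case: (F _) a0 w0 => ? ? /= -> ->.
    by have := congr1 (fun M : 'M[int]_(1, 1) => M 0 0) v0; rewrite !mxE mulr1n => ->.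
exists (H * 'I_d0.+1)%type, n, (fun v : 'rV[int]_(1 + m) =>
    (((F (tl v)).1, inZp 1 *~ v ord0 ord0), (F (tl v)).2)).
have zE (z : int) : ((inZp 1 : 'I_d0.+1) *~ z == 0) = (d0.+1 %| z)%Z.
  have nE k : ((inZp 1 : 'I_d0.+1) *+ k == 0) = (d0.+1 %| k)%N.
    by rewrite Zp_mulrn -val_eqE /= modnMml mul1n.
  by case: z => k; rewrite ?NegzE ?mulrNz ?oppr_eq0 ?dvdzN -pmulrn nE.
split=> [x y|[[a c] b]|v|].
- by rewrite tlD FD mxE !pairD mulrzDr.
- have [x xE] := FS (a, b); exists (row_mx (c%:Z)%:M x); rewrite /tl row_mxKr xE row_mx10 /=.
  congr ((_, _), _).
  by rewrite -pmulrn; apply: val_inj; rewrite Zp_mulrn /= modnMml mul1n modn_small.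
- rewrite splitP d0E -zE; split=> [[a0 /eqP -> b0]|[/eqP -> -> //]].
  by split=> //; case: (F _) a0 b0 => ? ? /= -> ->.
exact: self_dual_prod (@self_dual_Zp _).
Qed.

(** The first coordinates of the elements of [K] form an ideal of Z, which is
    principal, and the elements with zero first coordinate are a subgroup of
    [Z^(m - 1)]. *)
Lemma subgroup_row_span m (K : 'rV[int]_m -> Prop) :
  K 0 -> (forall u v, K u -> K v -> K (u - v)) ->
  exists M : 'M[int]_m, forall v, K v <-> exists w, v = w *m M.
Proof.
elim: m K => [|m IH] K K0 KB.
  exists 0 => v; split=> [_|[w ->]]; first by exists 0; rewrite mulmx0 [v]thinmx0.
  by rewrite mulmx0.
have KN u : K u -> K (- u) by move=> Ku; rewrite -sub0r; exact: KB.
have KD u v : K u -> K v -> K (u + v).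
  by move=> Ku Kv; rewrite -[v]opprK; apply: KB => //; exact: KN.
have Kn u n : K u -> K (u *+ n).
  by move=> Ku; elim: n => [|n IHn]; rewrite ?mulr0n // mulrS; exact: KD.
have KZ u (z : int) : K u -> K (z *: u).
  move=> Ku; rewrite -[z]intz scaler_int; case: z => n; first exact: Kn.
  by rewrite NegzE mulrNz; apply/KN/Kn.
pose K' (v : 'rV[int]_m) := K (row_mx 0 v : 'rV_(1 + m)).
have K'0 : K' 0 by rewrite /K' (@row_mx0 _ 1 1 m).
have K'B u v : K' u -> K' v -> K' (u - v).
  move=> Ku Kv; rewrite /K'; have := KB _ _ Ku Kv.
  by rewrite (@opp_row_mx _ 1 1 m) (@add_row_mx _ 1 1 m) subr0.
have [M' M'P] := IH K' K'0 K'B.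
(* k0 has the least positive first coordinate, or is 0 if there is none. *)
have [k0 Kk0 k0P] : exists2 k0, K k0 &
    forall v, K v -> exists q, v ord0 ord0 = q * k0 ord0 ord0.
  case: (pselect (exists n : nat, `[< exists2 v, K v & v ord0 ord0 = n.+1%:Z >])); last first.
    move=> noK; exists 0 => // v Kv; exists 0; rewrite mul0r.
    apply: contrapT => v0; apply: noK.
    case vE : (v ord0 ord0) v0 => [[|n]|n] // _; exists n; apply/asboolP.
      by exists v.
    by exists (- v); rewrite ?mxE ?vE //; exact: KN.
  move=> exK; case: (ex_minnP exK) => n /asboolP[k0 Kk0 k0E] nmin.
  exists k0 => // v Kv; exists (v ord0 ord0 %/ k0 ord0 ord0)%Z.
  rewrite {1}(divz_eq (v ord0 ord0) (k0 ord0 ord0)) -[RHS]addr0; congr (_ + _).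
  have k0_gt0 : 0 < k0 ord0 ord0 by rewrite k0E.
  have r_ge0 := modz_ge0 (v ord0 ord0) (lt0r_neq0 k0_gt0).
  have r_lt := ltz_pmod (v ord0 ord0) k0_gt0.
  case rE : (v ord0 ord0 %% k0 ord0 ord0)%Z r_ge0 r_lt => [[|r]|r] // _.
  rewrite k0E ltz_nat => rn; have := nmin r; rewrite leqNgt -ltnS rn.
  suff -> : `[< exists2 v, K v & v ord0 ord0 = r.+1%:Z >] by move=> /(_ isT).
  apply/asboolP; exists (v - (v ord0 ord0 %/ k0 ord0 ord0)%Z *: k0).
    by apply: KB => //; exact: KZ.
  by rewrite -rE /modz !mxE.
exists (col_mx (k0 : 'rV_(1 + m)) (row_mx 0 M') : 'M[int]_(1 + m)) => v; split.
  move=> Kv; have [q qE] := k0P v Kv.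
  have Kv' : K (v - q *: k0) by apply: KB => //; exact: KZ.
  have vE : v - q *: k0 = row_mx 0 (rsubmx (v - q *: k0 : 'rV_(1 + m))) :> 'rV_(1 + m).
    rewrite -[LHS](@hsubmxK _ 1 1 m); congr row_mx; apply/rowP => i; rewrite !mxE (ord1 i).
    have -> : lshift m (0 : 'I_1) = ord0 by apply: val_inj.
    by rewrite qE subrr.
  have /M'P[w wE] : K (row_mx 0 (rsubmx (v - q *: k0 : 'rV_(1 + m))) : 'rV_(1 + m)).
    by rewrite -vE.
  exists (row_mx q%:M w : 'rV_(1 + m)); rewrite (@mul_row_col _ 1 1 m).
  rewrite mul_scalar_mx (@mul_mx_row _ 1 m 1 m) mulmx0 -wE -vE.
  by rewrite addrC subrK.
move=> [w ->]; rewrite -[w](@hsubmxK _ 1 1 m) (@mul_row_col _ 1 1 m).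
apply: KD; last by rewrite (@mul_mx_row _ 1 m 1 m) mulmx0; apply/M'P; exists (rsubmx (w : 'rV_(1 + m))).
by rewrite [lsubmx _]mx11_scalar mul_scalar_mx; exact: KZ.
Qed.

(** The relations between the generators are the row space of an integer matrix;
    its Smith normal form makes the group a quotient as in [diag_quotient]. *)
Lemma fg_zmod_structure (A : zmodType) m (g : 'I_m -> A) :
  (forall a, exists c : 'rV[int]_m, a = \sum_i g i *~ c ord0 i) ->
  exists (H : finZmodType) n (f : {additive A -> (H * 'rV[int]_n)%type}),
    bijective f /\ self_dual H.
Proof.
move=> gen; pose ev (c : 'rV[int]_m) := \sum_i g i *~ c ord0 i.
have evD : {morph ev : x y / x + y}.
  by move=> x y; rewrite -big_split; apply: eq_bigr => i _; rewrite mxE mulrzDr.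
have [e eE] := mkadditive evD.
have eB u v : e u = 0 -> e v = 0 -> e (u - v) = 0.
  by move=> u0 v0; rewrite raddfB u0 v0 subr0.
have [M MP] := @subgroup_row_span m (fun c => e c = 0) (raddf0 e) eB.
have [L uL [R uR [d _ ME]]] := int_Smith_normal_form M.
have [H [n [F [FD FS FK dH]]]] := diag_quotient (fun i : 'I_m => absz (d`_i)%R).
have KP c : e c = 0 <-> F (c *m invmx R) = 0.
  rewrite MP FK; split=> [[w ->] i|h].
    rewrite ME -!mulmxA mulmxV // mulmx1 mulmxA !mxE.
    rewrite (bigD1 i) //= big1 => [|j ji]; rewrite !mxE; last by rewrite val_eqE (negPf ji) mulr0.
    by rewrite eqxx mulr1n addr0 dvdzE abszM dvdn_mull.
  have {}h i : exists q, (c *m invmx R) ord0 i = q * d`_i.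
    have := h i; rewrite dvdzE /= -[X in (X %| _)%N]/(absz d`_i) => /dvdzP[q qE].
    by exists q.
  have /choice[w wE] := h.
  exists ((\row_i w i) *m invmx L); rewrite ME !mulmxA mulmxKV //.
  apply: (canRL (mulmxKV uR)); apply/rowP => i; rewrite [LHS]wE !mxE.
  rewrite (bigD1 i) //= big1 => [|j ji]; rewrite !mxE; last by rewrite val_eqE (negPf ji) mulr0.
  by rewrite eqxx mulr1n addr0.
have [c cE] := choice gen.
have ecK a : e (c a) = a by rewrite eE /ev -cE.
have FB u v : F (u - v) = F u - F v.
  by apply: (addIr (F v)); rewrite -FD !subrK.
have Feq u v : e u = e v <-> F (u *m invmx R) = F (v *m invmx R).
  split=> [/eqP|/eqP]; rewrite -subr_eq0 -?raddfB -?FB -?mulmxBl => /eqP /KP uv.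
    by apply/eqP; rewrite -subr_eq0 -FB -mulmxBl uv.
  by apply/eqP; rewrite -subr_eq0 -raddfB uv.
have fD : {morph (fun a => F (c a *m invmx R)) : x y / x + y}.
  by move=> x y; rewrite -FD -mulmxDl; apply/Feq; rewrite raddfD !ecK.
have [f fE] := mkadditive fD; exists H, n, f; split=> //.
rewrite -setTT_bijective; split=> // [a b _ _|y _].
  by rewrite !fE => /Feq; rewrite !ecK.
have [x xE] := FS y; exists (e (x *m R)) => //; rewrite fE -xE -[x in RHS](mulmxK uR).
by apply/Feq; rewrite ecK.
Qed.

(** In the decomposition [H = K x Z^n] the rank [n] vanishes, since Z is
    infinite. *)
Lemma finite_self_dual (H : finZmodType) : self_dual H.
Proof.
have gen (a : H) : exists c : 'rV[int]_#|H|, a = \sum_i enum_val i *~ c ord0 i.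
  exists (\row_i (i == enum_rank a)%:R); rewrite (bigD1 (enum_rank a)) //= big1 => [|j ja].
    by rewrite mxE eqxx enum_rankK addr0.
  by rewrite mxE (negPf ja).
have [K [n [f [fbij dK]]]] := fg_zmod_structure gen.
case: n f fbij => [|n] f fbij.
  have pD : {morph (fun h => (f h).1) : x y / x + y} by move=> x y; rewrite raddfD.
  have [p pE] := mkadditive pD; apply: (self_dual_iso (f := p)) dK.
  have [g gK fK] := fbij; exists (fun k => g (k, 0)) => x; rewrite pE ?fK //.
  by rewrite -[RHS]gK; case: (f x) => a b; rewrite [b]thinmx0.
have [g gK fK] := fbij.
pose h (k : 'I_#|H|.+1) := g (0, const_mx k%:Z).
have /leq_card : injective h.
  move=> i j /(can_inj fK)[/rowP/(_ ord0)]; rewrite !mxE => -[ij].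
  exact: val_inj.
by rewrite card_ord ltnn.
Qed.

(** A cyclic group of order [d] has [totient d] generators. *)
Lemma gammaE (H : finZmodType) d :
  (gamma H d * totient d)%N = #|[set h : H | #[h]%g == d]%SET|.
Proof.
rewrite -[RHS]sum1_card.
rewrite (partition_big (fun h : H => <[h]>%G) (fun K => cyclic K && (#|K| == d))) /=; last first.
  by move=> h; rewrite inE cycle_cyclic => ->.
rewrite /gamma -sum_nat_const; apply: eq_big => [K|K]; rewrite inE //.
move=> /andP[/cyclicP[x Kx] /eqP Kd]; rewrite -Kd Kx -/(order x) totient_gen -sum1_card.
apply: eq_bigl => h; rewrite !inE /generator.
have -> : (<[h]>%G == K) = (<[x]>%g == <[h]>%g) by rewrite eq_sym -val_eqE /= Kx.
by case: eqP => // e; rewrite ?andbT ?andbF // /order -e -Kx Kd eqxx.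
Qed.

Lemma card_torsion (H : finZmodType) m :
  #|[pred h : H | h *+ m == 0]| =
  (\sum_(d <- divisors #|H|) (d %| m) * (gamma H d * totient d))%N.
Proof.
have oH (h : H) : (#[h]%g \in divisors #|H|)%N.
  rewrite -dvdn_divisors; first by rewrite -cardsT order_dvdG ?inE.
  by apply/card_gt0P; exists h.
transitivity (\sum_(h : H) \sum_(d <- divisors #|H|) (d %| m) * (#[h]%g == d))%N.
  rewrite -sum1_card big_mkcond /=; apply: eq_bigr => h _.
  rewrite (bigD1_seq #[h]%g) ?divisors_uniq //= eqxx muln1 big1 => [|d dh].
    by rewrite inE -FinRing.zmodXgE -FinRing.zmod1gE -order_dvdn addn0; case: ifP.
  by rewrite eq_sym (negPf dh) muln0.
rewrite exchange_big; apply: eq_bigr => d _; rewrite gammaE -sum1_card big_distrr /=.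
rewrite [RHS]big_mkcond /=; apply: eq_bigr => h _.
by rewrite inE; case: ifP => _; rewrite ?muln1 ?muln0.
Qed.

(** * Points of Noetherian Mo-schemes *)

Lemma finite_spec (M : cmon) : fin_gen_cmon M -> finite_set [set: spec M].
Proof.
move=> [E [[n /card_set_bijP[f [fE fI _]]] gen]].
pose g (p : spec M) := [ffun k : 'I_n => `[< exists2 a, E a & f a = k /\ p a >]].
have gP p q : g p = g q -> forall a, E a -> p a -> q a.
  move=> /ffunP pq a Ea pa; have := pq (Ordinal (fE a Ea)); rewrite !ffunE => e.
  have : `[< exists2 b, E b & f b = Ordinal (fE a Ea) /\ p b >].
    by apply/asboolP; exists a.
  rewrite e => /asboolP[b Eb [/= fab qb]]; suff <- : b = a by [].
  by apply: fI => //; rewrite inE.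
apply: (@card_le_finite _ _ _ [set: {ffun 'I_n -> bool}]); last exact: finite_finset.
suff /injfunPex[h] : exists2 h : spec M -> {ffun 'I_n -> bool},
  set_fun [set: spec M] setT h & set_inj setT h by exact: inj_card_le h.
exists g => // p q _ _ pq; apply: spec_eq; apply/funext => a.
suff : [set a | p a = q a] = setT by move=> /seteqP[_ /(_ a)]; exact.
apply: gen => /=.
- by apply/propext; split=> /prime1.
- move=> b c bE cE; apply/propext; split=> /primeM[].
  + by rewrite bE cm_mulC; exact: primeMl.
  + by rewrite cE; exact: primeMl.
  + by rewrite -bE cm_mulC; exact: primeMl.
  + by rewrite -cE; exact: primeMl.
- by move=> b Eb; apply/propext; split; apply: gP.
Qed.

Lemma noetherian_finite (G : geom_Mo_scheme) :
  noetherian_geom_Mo_scheme G -> finite_set [set: G].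
Proof.
move=> [n [M [f [fP fcov]]]].
apply: (@sub_finite_set _ _ (\bigcup_(i in [set: 'I_n]) range (f i))).
  by move=> x _; case: (fcov x) => i; exists i.
apply: bigcup_finite => [|i _]; first exact: finite_finset.
by apply: finite_image; apply: finite_spec; case: (fP i).
Qed.

(** * Stalks in affine charts *)

(** Two fractions that agree at [p] are equalized by some [u] not in [p], hence
    agree wherever [u] does not vanish. *)
Lemma spec_germ_inj (M : cmon) (p : spec M) (U U' : opens (spec M))
    (s : spec_sec U) (s' : spec_sec U') (Up : U p) (U'p : U' p) :
  sval s p Up = sval s' p U'p ->
  exists W : opens (spec M), W p /\ exists (WU : osub W U) (WU' : osub W U'),
    forall q (Wq : W q), sval s q (WU q Wq) = sval s' q (WU' q Wq).
Proof.
have [V [Vp [a [b sE]]]] := svalP s p Up.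
have [V' [V'p [a' [b' s'E]]]] := svalP s' p U'p.
have [pb ->] := sE p Up Vp; have [pb' ->] := s'E p U'p V'p.
move=> /Defs.fracE[u pu ue].
have oD : open (spec_open [set u]) by exists [set u].
pose W := opensI (opensI (opensI U V) (opensI U' V')) (Opens oD).
have Wp : W p by do !split=> //; exists u.
have WU : osub W U by move=> q [[[]]].
have WU' : osub W U' by move=> q [[_ []]].
exists W; split=> //; exists WU, WU' => q Wq.
have [[[Uq Vq] [U'q V'q]] [_ -> qu]] := Wq.
have [qb ->] := sE q (WU q Wq) Vq; have [qb' ->] := s'E q (WU' q Wq) V'q.
by apply/Defs.fracE; exists u.
Qed.

Section StalkIso.
Variables (M : cmon) (Y : mspace) (f : mspace_mor (Spec_space M) Y).
Hypothesis fo : open_immersion f.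
Variable p : Spec_space M.

(** The isomorphism from the stalk at a point of an affine chart to the
    localization: the value of a germ at the point. *)
Definition germ_frac (t : stalk (f p)) : loc p :=
  let g := quot_repr t in sval (pm_sec f (germ_open g) (germ_sec g)) p (germ_mem g).

Lemma germ_fracE (V : opens Y) (Vp : V (f p)) (s : ms_O Y V) :
  germ_frac (germ_at Vp s) = sval (pm_sec f V s) p Vp.
Proof.
rewrite /germ_frac; set g := quot_repr _.
case: (@quot_repr_pi (germ_precmon (f p)) (Germ Vp s)) => W [h [k [Wp e]]].
have h' : osub (opens_preimage (pm_cont f) W)
  (opens_preimage (pm_cont f) (germ_open g)) by move=> y /h.
have k' : osub (opens_preimage (pm_cont f) W) (opens_preimage (pm_cont f) V).
  by move=> y /k.
have := congr1 (fun s => sval (pm_sec f W s) p Wp) e.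
rewrite (pm_res h h') (pm_res k k') /= => e'.
rewrite (_ : germ_mem g = h' p Wp); last exact: Prop_irrelevance.
by rewrite (_ : Vp = k' p Wp) //; exact: Prop_irrelevance.
Qed.

Lemma germ_atP (t : stalk (f p)) : exists (V : opens Y) (Vp : V (f p)) s, t = germ_at Vp s.
Proof.
rewrite -(quot_pi_repr t); case: (quot_repr t) => V Vp s.
by exists V, Vp, s.
Qed.

Lemma germ_frac1 : germ_frac cm1 = cm1.
Proof. by rewrite (germ_fracE (V := opensT Y) I) cmhom1. Qed.

Lemma germ_frac0 : germ_frac cm0 = cm0.
Proof. by rewrite (germ_fracE (V := opensT Y) I) cmhom0. Qed.

Lemma germ_fracM t u : germ_frac (t ** u) = germ_frac t ** germ_frac u.
Proof.
have [V [Vp [s ->]]] := germ_atP t; have [W [Wp [r ->]]] := germ_atP u.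
rewrite [X in germ_frac X](@quot_mulE (germ_precmon (f p))) !germ_fracE.
rewrite cmhomM /=.
have hl : osub (opens_preimage (pm_cont f) (opensI V W)) (opens_preimage (pm_cont f) V).
  by move=> q [].
have hr : osub (opens_preimage (pm_cont f) (opensI V W)) (opens_preimage (pm_cont f) W).
  by move=> q [].
rewrite (pm_res _ hl) (pm_res _ hr) /=.
by congr (sval (pm_sec f V s) p _ ** sval (pm_sec f W r) p _); exact: Prop_irrelevance.
Qed.

Lemma image_preimage (U : opens (Spec_space M)) (oU : open (f @` U)) q :
  opens_preimage (pm_cont f) (Opens oU) q -> U q.
Proof. by case: fo => fI _ _ [r Ur /fI <-]. Qed.

Lemma germ_frac_inj : injective germ_frac.
Proof.
move=> t u; have [V [Vp [s ->]]] := germ_atP t; have [V' [V'p [s' ->]]] := germ_atP u.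
rewrite !germ_fracE => e.
have [W [Wp [WV [WV' We]]]] := spec_germ_inj e.
have [fI fO fB] := fo.
pose W' := Opens (fO W (openO W)).
have W'f : W' (f p) by exists p.
have h : osub W' V by move=> _ [q Wq <-]; exact: (WV q Wq).
have k : osub W' V' by move=> _ [q Wq <-]; exact: (WV' q Wq).
apply/quot_piE; exists W', h, k; split=> //=.
have /bij_inj := fB W' ltac:(by move=> _ [q _ <-]; exists q); apply.
have h' : osub (opens_preimage (pm_cont f) W') (opens_preimage (pm_cont f) V) by move=> q /h.
have k' : osub (opens_preimage (pm_cont f) W') (opens_preimage (pm_cont f) V') by move=> q /k.
rewrite (pm_res h h') (pm_res k k'); apply: spec_sec_eq => q /= W'q.
have Wq := @image_preimage W (fO W (openO W)) q W'q.
rewrite (_ : h' q W'q = WV q Wq); last exact: Prop_irrelevance.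
by rewrite We; congr (sval _ q _); exact: Prop_irrelevance.
Qed.

Lemma germ_frac_surj v : exists t, germ_frac t = v.
Proof.
have [a [b [pb ->]]] := Defs.fracP v.
have oU : open (spec_open [set b]) by exists [set b].
pose U := Opens oU.
have Ub q : U q -> ~ q b by move=> [_ ->].
have sF : @locally_fraction M U (fun q Uq => Defs.frac a (Ub q Uq)).
  move=> q Uq; exists U; split=> //; exists a, b => r Ur _.
  by exists (Ub r Ur).
pose s : ms_O (Spec_space M) U := exist _ _ sF.
have [fI fO fB] := fo.
pose W := Opens (fO U (openO U)).
have Wp : W (f p) by exists p => //; exists b.
have WU : osub (opens_preimage (pm_cont f) W) U by move=> q; exact: image_preimage.
have [g gK fK] := fB W ltac:(by move=> _ [q _ <-]; exists q).
exists (germ_at Wp (g (ms_res WU s))); rewrite germ_fracE fK /=.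
by congr (Defs.frac a _); exact: Prop_irrelevance.
Qed.

Lemma germ_frac_unit t : is_unit (germ_frac t) <-> is_unit t.
Proof.
split=> [[v tv]|[u tu]]; last by exists (germ_frac u); rewrite -germ_fracM tu germ_frac1.
have [u uv] := germ_frac_surj v; exists u; apply: germ_frac_inj.
by rewrite germ_fracM uv tv germ_frac1.
Qed.

Lemma stalk_nontrivial : ~ is_unit (cm0 : stalk (f p)).
Proof.
move=> /germ_frac_unit; rewrite germ_frac0 => /is_unit_frac.
by apply; exact: prime0.
Qed.

(** The denominators and numerators of a unit are products of generators that do
    not belong to the prime ideal [p], because the complement of [p] contains the
    factors of its elements. *)
Lemma units_fg : fin_gen_cmon M ->
  exists m (g : 'I_m -> units (stalk (f p))),
    forall u, exists c : 'rV[int]_m, u = \sum_i g i *~ c ord0 i.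
Proof.
move=> [E [[m /card_set_bijP[j [jE jI jS]]] gen]].
have unit_of a : ~ p a -> exists u : units (stalk (f p)), germ_frac (sval u) = Defs.frac a (@compl1 M p).
  move=> pa; have [t tE] := germ_frac_surj (Defs.frac a (@compl1 M p)).
  have ut : is_unit t by apply/germ_frac_unit; rewrite tE; exact/is_unit_frac.
  by exists (exist _ t ut).
have unitE (u v : units (stalk (f p))) : germ_frac (sval u) = germ_frac (sval v) -> u = v.
  by move=> /germ_frac_inj /units_eq.
have gex (k : 'I_m) : exists u : units (stalk (f p)), forall a, E a -> j a = k -> ~ p a ->
    germ_frac (sval u) = Defs.frac a (@compl1 M p).
  have [b Eb jb] := jS k (ltn_ord k).
  have [pb|pb] := pselect (p b).
    exists 0 => a Ea jak; suff -> : a = b by [].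
    by apply: jI; rewrite ?inE // jak jb.
  have [u uE] := unit_of b pb; exists u => a Ea jak _; rewrite uE.
  suff -> : a = b by [].
  by apply: jI; rewrite ?inE // jak jb.
have [g gP] := choice gex; exists m, g.
have geq : [set a | ~ p a -> exists c : 'rV[int]_m,
    germ_frac (sval (\sum_i g i *~ c ord0 i)) = Defs.frac a (@compl1 M p)] = setT.
  apply: gen => /=.
  - move=> _; exists 0; rewrite big1 => [|i _]; last by rewrite mxE.
    by rewrite germ_frac1.
  - move=> a b aP bP pab.
    have [|c cE] := aP _; first by move=> pa; apply: pab; rewrite cm_mulC; exact: primeMl.
    have [|d dE] := bP _; first by move=> pb; apply: pab; exact: primeMl.
    exists (c + d).
    have -> : \sum_i g i *~ (c + d) ord0 i =
        \sum_i g i *~ c ord0 i + \sum_i g i *~ d ord0 i.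
      by rewrite -big_split; apply: eq_bigr => i _; rewrite mxE mulrzDr.
    rewrite germ_fracM cE dE Defs.mul_frac; apply/Defs.fracE; exists cm1; first exact: compl1.
    by rewrite !cm_mul1.
  - move=> a Ea pa; exists (delta_mx ord0 (Ordinal (jE a Ea))).
    have -> : \sum_i g i *~ (delta_mx ord0 (Ordinal (jE a Ea)) : 'rV_m) ord0 i = g (Ordinal (jE a Ea)).
      rewrite (bigD1 (Ordinal (jE a Ea))) //= big1 => [|i ia].
        by rewrite addr0 mxE !eqxx.
      by rewrite mxE (negPf ia) andbF.
    by rewrite (gP _ a).
move=> u; have [a [b [pb uE]]] := Defs.fracP (germ_frac (sval u)).
have pa : ~ p a.
  by apply/(is_unit_frac _ pb); rewrite -uE; apply/germ_frac_unit; exact: (svalP u).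
have /seteqP[_ /(_ a I)/(_ pa)[c cE]] := geq.
have /seteqP[_ /(_ b I)/(_ pb)[d dE]] := geq.
exists (c - d).
have -> : \sum_i g i *~ (c - d) ord0 i =
    \sum_i g i *~ c ord0 i - \sum_i g i *~ d ord0 i.
  by rewrite -sumrB; apply: eq_bigr => i _; rewrite !mxE mulrzBr.
apply/eqP; rewrite eq_sym subr_eq; apply/eqP/unitE.
rewrite cE germ_fracM uE dE Defs.mul_frac; apply/Defs.fracE; exists cm1; first exact: compl1.
by rewrite !cm_mul1 cm_mulr1 cm_mulr1 cm_mulC.
Qed.

End StalkIso.

(** * Points with values in F_1[V] *)

Section PointsF1.
Variables (V : zmodType) (Y : mspace).
Hypothesis nontrivial : forall y : Y, ~ is_unit (cm0 : stalk y).

(** All nonzero elements of [F_1[V]] are units, so that its spectrum is a point. *)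
Lemma F1_prime (q : spec (Defs.F1 V)) (a : Defs.F1 V) : q a <-> a = None.
Proof.
split=> [qa|->]; last exact: (prime0 q).
case: a qa => // v qv; case: (@prime1 _ q).
by rewrite -[cm1]/(Some 0) -(addNr v); exact: (@primeMl _ q (Some (- v)) (Some v)).
Qed.

Lemma F1_spec_uniq (p q : spec (Defs.F1 V)) : p = q.
Proof.
by apply/spec_eq/funext => a; apply/propext; rewrite !F1_prime.
Qed.

Definition F1_point : spec (Defs.F1 V).
Proof.
exists (fun a => a = None) => //; first by move=> [a|] [b|].
by move=> [a|] [b|] //=; [right|left|left].
Defined.

Definition F1_frac (q : spec (Defs.F1 V)) (a : Defs.F1 V) : loc q := Defs.frac a (@compl1 _ q).

Lemma F1_frac_inj q : injective (F1_frac q).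
Proof.
move=> a b /Defs.fracE[u qu]; rewrite !cm_mulr1.
case: u qu => [u _|]; last by case; apply/F1_prime.
case: a b => [a|] [b|] //= [].
by move=> /addrI ->.
Qed.

Lemma F1_frac_surj q (t : loc q) : exists a, F1_frac q a = t.
Proof.
have [a [b [qb ->]]] := Defs.fracP t.
case: b qb => [b|] qb; last by case: qb; apply/F1_prime.
exists (a ** (Some (- b) : Defs.F1 V)); apply/Defs.fracE; exists cm1; first exact: compl1.
have bb : (Some (- b) : Defs.F1 V) ** Some b = cm1 by rewrite -[cm1]/(Some 0) -(addNr b).
by rewrite !cm_mul1 -cm_mulA bb.
Qed.

Lemma F1_fracM q a b : F1_frac q (a ** b) = F1_frac q a ** F1_frac q b.
Proof.
rewrite /F1_frac Defs.mul_frac; apply/Defs.fracE; exists cm1; first exact: compl1.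
by rewrite !cm_mul1.
Qed.

Lemma F1_frac_unit q a : is_unit (F1_frac q a) <-> a <> None.
Proof. by rewrite is_unit_frac F1_prime. Qed.

Section Extend.
Variables (y : Y) (chi : {additive units (stalk y) -> V}).

(** Extension of a character by zero. It is multiplicative since a product of
    elements of a commutative monoid is a unit only if its factors are. *)
Definition ext_char (t : stalk y) : Defs.F1 V :=
  if pselect (is_unit t) is left ut then Some (chi (exist _ t ut)) else None.

Lemma ext_charE (u : units (stalk y)) : ext_char (sval u) = Some (chi u).
Proof.
rewrite /ext_char; case: pselect => [ut|]; last by case: u.
by congr (Some (chi _)); exact: units_eq.
Qed.

Lemma ext_char_None t : ~ is_unit t -> ext_char t = None.
Proof. by rewrite /ext_char; case: pselect. Qed.

Lemma ext_char_unit t : ext_char t <> None <-> is_unit t.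
Proof. by rewrite /ext_char; case: pselect. Qed.

Lemma ext_char1 : ext_char cm1 = cm1.
Proof. by rewrite -[cm1]/(sval (0 : units (stalk y))) ext_charE raddf0. Qed.

Lemma ext_char0 : ext_char cm0 = cm0.
Proof. by rewrite ext_char_None //; exact: nontrivial. Qed.

Lemma is_unitMl (M : cmon) (a b : M) : is_unit (a ** b) -> is_unit a.
Proof. by move=> [c abc]; exists (b ** c); rewrite cm_mulA. Qed.

Lemma ext_charM t u : ext_char (t ** u) = ext_char t ** ext_char u.
Proof.
have [ut|nt] := pselect (is_unit t); last first.
  by rewrite !(ext_char_None nt) ext_char_None // => /is_unitMl.
have [uu|nu] := pselect (is_unit u); last first.
  rewrite (ext_char_None nu) ext_char_None; first by case: (ext_char t).
  by rewrite cm_mulC => /is_unitMl.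
rewrite -[t]/(sval (exist _ t ut : units (stalk y))) -[u]/(sval (exist _ u uu : units (stalk y))).
rewrite -[X in ext_char X]/(sval ((exist _ t ut : units (stalk y)) + exist _ u uu)).
by rewrite !ext_charE raddfD.
Qed.

Definition pt_fun : Spec_space (Defs.F1 V) -> Y := fun _ => y.

Lemma pt_cont : continuous pt_fun.
Proof. exact: cst_continuous. Qed.

(** Stated for all [q], though the spectrum has a single point, so that the
    preimage of [U] may be the spectrum or empty without case distinction. *)
Lemma pt_sec_subproof (U : opens Y) (s : ms_O Y U) :
  @locally_fraction _ (opens_preimage pt_cont U)
    (fun q Uy => F1_frac q (ext_char (@germ_at Y y U Uy s))).
Proof.
move=> q Uy; exists (opensT _); split=> //; exists (ext_char (@germ_at Y y U Uy s)), cm1.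
move=> r Ur _; exists (@compl1 _ r).
by rewrite (_ : Ur = Uy) //; exact: Prop_irrelevance.
Qed.

Definition pt_sec_fun (U : opens Y) (s : ms_O Y U) :
  ms_O (Spec_space (Defs.F1 V)) (opens_preimage pt_cont U) :=
  exist _ _ (pt_sec_subproof s).

Lemma germ_at1 (U : opens Y) (Uy : U y) : germ_at Uy cm1 = cm1 :> stalk y.
Proof.
apply/(@quot_piE (germ_precmon y)); exists U, (fun _ => id), (fun _ _ => I).
by split=> //=; rewrite !cmhom1.
Qed.

Lemma germ_at0 (U : opens Y) (Uy : U y) : germ_at Uy cm0 = cm0 :> stalk y.
Proof.
apply/(@quot_piE (germ_precmon y)); exists U, (fun _ => id), (fun _ _ => I).
by split=> //=; rewrite !cmhom0.
Qed.

Lemma germ_atM (U : opens Y) (Uy : U y) s t :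
  germ_at Uy (s ** t) = germ_at Uy s ** germ_at Uy t :> stalk y.
Proof.
rewrite [RHS](@quot_mulE (germ_precmon y)).
apply/(@quot_piE (germ_precmon y)).
have k : osub U (opensI U U) by [].
exists U, (fun _ => id), k.
by split=> //=; rewrite !cmhomM !(ms_res_comp _ _ (fun _ => id)).
Qed.

Lemma germ_at_res (U W : opens Y) (h : osub U W) (Uy : U y) s :
  germ_at Uy (ms_res h s) = germ_at (h y Uy) s :> stalk y.
Proof.
apply/(@quot_piE (germ_precmon y)); exists U, (fun _ => id), h.
by split=> //=; rewrite ms_res_id.
Qed.

Definition pt_sec (U : opens Y) :
  cmhom (ms_O Y U) (ms_O (Spec_space (Defs.F1 V)) (opens_preimage pt_cont U)).
Proof.
exists (@pt_sec_fun U) => [||s t]; apply: spec_sec_eq => q Uq /=.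
- by rewrite germ_at0 ext_char0.
- by rewrite germ_at1 ext_char1.
- by rewrite germ_atM ext_charM F1_fracM.
Defined.

Lemma pt_res (U W : opens Y) (h : osub U W)
    (k : osub (opens_preimage pt_cont U) (opens_preimage pt_cont W)) s :
  pt_sec U (ms_res h s) = ms_res k (pt_sec W s).
Proof.
apply: spec_sec_eq => q Uq /=; rewrite germ_at_res.
by congr (F1_frac _ (ext_char (germ_at _ s))); exact: Prop_irrelevance.
Qed.

Definition pt_premor : mspace_premor (Spec_space (Defs.F1 V)) Y :=
  @MSpacePremor (Spec_space (Defs.F1 V)) Y _ pt_cont pt_sec pt_res.

Lemma pt_local : local_mor pt_premor.
Proof.
move=> q t; rewrite -(quot_pi_repr t); case: (quot_repr t) => U Uy s.
rewrite -[quot_pi _]/(germ_at Uy s) stalk_map_germ spec_germ_unit.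
by rewrite [X in is_unit X]/= F1_frac_unit ext_char_unit.
Qed.

Definition pt_mor : mspace_mor (Spec_space (Defs.F1 V)) Y := MSpaceMor pt_local.
End Extend.

Lemma pm_sec_eq (f g : mspace_mor (Spec_space (Defs.F1 V)) Y) : f = g ->
  forall U (s : ms_O Y U) q (Uf : U (f q)) (Ug : U (g q)),
    sval (pm_sec f U s) q Uf = sval (pm_sec g U s) q Ug.
Proof. by move=> <- U s q Uf Ug; congr (sval _ q _); exact: Prop_irrelevance. Qed.

(** The sections of [f] and [g] have types that depend on the underlying maps;
    comparing their values avoids transport. *)
Lemma mspace_mor_eq (f g : mspace_mor (Spec_space (Defs.F1 V)) Y) :
  f =1 g ->
  (forall U (s : ms_O Y U) q (Uf : U (f q)) (Ug : U (g q)),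
    sval (pm_sec f U s) q Uf = sval (pm_sec g U s) q Ug) ->
  f = g.
Proof.
case: f g => [[f fc fs fr] fl] [[g gc gs gr] gl] /= /funext fg; subst g.
rewrite (Prop_irrelevance gc fc) in gs gr gl *.
move=> h; have e : fs = gs.
  apply: functional_extensionality_dep => U; apply: cmhom_eq => s.
  by apply: spec_sec_eq => q Uq; exact: h.
subst gs; rewrite (Prop_irrelevance gr fr) in gl *.
by rewrite (Prop_irrelevance gl fl).
Qed.

Definition pt_mor_of (t : {y : Y & {additive units (stalk y) -> V}}) :=
  pt_mor (projT2 t).

Lemma pt_mor_of_inj : injective pt_mor_of.
Proof.
move=> [y chi] [y' chi'] e.
have yy' : y = y' :=
  congr1 (fun f : mspace_mor (Spec_space (Defs.F1 V)) Y => f F1_point) e.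
subst y'; congr existT; apply: additive_eq => u.
have [U [Uy [s uE]]] : exists (U : opens Y) (Uy : U y) s, sval u = germ_at Uy s.
  by rewrite -(quot_pi_repr (sval u)); case: (quot_repr _) => U Uy s; exists U, Uy, s.
have /F1_frac_inj := pm_sec_eq e s (q := F1_point) Uy Uy.
by rewrite -uE !ext_charE => -[].
Qed.

(** Locality of [f] replaces the hypothesis that it is an open immersion. *)
Lemma germ_frac_local (f : mspace_mor (Spec_space (Defs.F1 V)) Y) q (t : stalk (f q)) :
  is_unit (germ_frac t) <-> is_unit t.
Proof.
have [U [Uq [s ->]]] := germ_atP t.
by rewrite germ_fracE -(@mor_local _ _ f) stalk_map_germ spec_germ_unit.
Qed.

Lemma pt_mor_of_surj f : exists t, pt_mor_of t = f.
Proof.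
have chi_ex (u : units (stalk (f F1_point))) :
    exists v, F1_frac F1_point (Some v) = germ_frac (sval u).
  have [[v|] vE] := F1_frac_surj (germ_frac (sval u)); first by exists v.
  have /germ_frac_local := svalP u; rewrite -vE.
  by move=> /F1_frac_unit.
have [chi chiE] := choice chi_ex.
have chiD : {morph chi : x y / x + y}.
  move=> x y; have := chiE (x + y); rewrite /= germ_fracM -!chiE -F1_fracM.
  by move=> /F1_frac_inj [].
have [c cE] := mkadditive chiD.
exists (existT _ (f F1_point) c); apply: mspace_mor_eq => [q|U s q Uf Ug] /=.
  by rewrite (F1_spec_uniq q F1_point).
rewrite (F1_spec_uniq q F1_point) in Uf Ug *.
rewrite -[RHS]germ_fracE -[Uf]/(Uf : U (f F1_point)) (Prop_irrelevance Uf Ug).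
set t := germ_at _ s.
have [ut|nt] := pselect (is_unit t).
  by rewrite -[t]/(sval (exist _ t ut : units (stalk (f F1_point)))) ext_charE cE chiE.
rewrite ext_char_None //; have [[v|] //] := F1_frac_surj (germ_frac t).
by move=> vE; case: nt; apply/germ_frac_local; rewrite -vE; apply/F1_frac_unit.
Qed.

(** Points with values in [F_1[V]] are pairs of a point of [Y] and a [V]-valued
    character of the units of its stalk. *)
Lemma pt_mor_of_bij : bijective pt_mor_of.
Proof.
rewrite -setTT_bijective; split=> // [s t _ _|f _]; first exact: pt_mor_of_inj.
by have [t <-] := pt_mor_of_surj f; exists t.
Qed.
End PointsF1.

(** * Cardinals *)

Lemma card_bijective (A B : Type) (f : A -> B) n : bijective f ->
  [set: A] #= `I_n -> [set: B] #= `I_n.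
Proof.
move=> [g gK fK] /card_set_bijP[h [hS hI hJ]]; apply/card_set_bijP; exists (h \o g); split.
- by move=> b _; exact: hS.
- by move=> b c _ _ /= e; apply: (can_inj fK); apply: hI; rewrite ?inE.
by move=> k kn; have [a _ <-] := hJ k kn; exists (f a) => //=; rewrite gK.
Qed.

Lemma card_sigT (Y : Type) (P : Y -> Type) (k : Y -> nat) N (e : 'I_N -> Y) :
  bijective e -> (forall y, [set: P y] #= `I_(k y)) ->
  [set: {y : Y & P y}] #= `I_(\sum_i k (e i))%N.
Proof.
move=> [e' e'K eK] Pk.
have c_ex y : exists c : 'I_(k y) -> P y, bijective c.
  have /card_set_bijP[h [hS hI hJ]] := Pk y.
  have c_ex (j : 'I_(k y)) : exists x : P y, h x = j :> nat
    by have [x _ <-] := hJ j (ltn_ord j); exists x.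
  have [c cE] := choice c_ex; exists c, (fun x => Ordinal (hS x I)) => [j|x].
    by apply: val_inj; rewrite /= cE.
  by apply: hI; rewrite ?inE // cE.
have c_all : exists c : forall y, 'I_(k y) -> P y, forall y, bijective (c y).
  exists (fun y => sval (cid (c_ex y))) => y; exact: svalP (cid (c_ex y)).
have [c cB] := c_all.
pose g (t : {i : 'I_N & 'I_(k (e i))}) : {y : Y & P y} :=
  existT _ (e (tag t)) (c _ (tagged t)).
have gB : bijective g.
  rewrite -setTT_bijective; split=> // [[i x] [j y] _ _ E|[y x] _].
    have ij : i = j := can_inj e'K (congr1 (@projT1 _ _) E).
    subst j; congr existT; apply: (bij_inj (cB (e i))).
    have := projT2_eq E; rewrite /=.
    by rewrite (Prop_irrelevance (projT1_eq E) erefl) /=.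
  move: x; rewrite -(eK y) => x.
  have [d dK cK] := cB (e (e' y)).
  by exists (existT _ (e' y) (d x)) => //; rewrite /g /= cK.
have kE : #|{: {i : 'I_N & 'I_(k (e i))}}| = (\sum_i k (e i))%N.
  by rewrite card_tagged sumnE big_map big_enum; apply: eq_bigr => i _; rewrite card_ord.
rewrite -kE; apply: (card_bijective gB).
exact: (@card_setT_pred _ _ predT id (@inj_id _) (fun _ => isT) (fun y _ => ex_intro _ y erefl)).
Qed.

(** * The complex exponential and roots of unity *)

Section ComplexExp.
Variable R : realType.
Local Notation C := R[i].
Implicit Types (z w : C) (a b : R).

Lemma rcM (a b : R) : (a * b)%:C = a%:C * b%:C. Proof. exact: rmorphM. Qed.
Lemma rcD (a b : R) : (a + b)%:C = a%:C + b%:C. Proof. exact: rmorphD. Qed.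
Lemma rcN (a : R) : (- a)%:C = - a%:C. Proof. exact: rmorphN. Qed.
Lemma rc_nat (n : nat) : (n%:R : R)%:C = n%:R. Proof. exact: rmorph_nat. Qed.

Lemma cexpD z w : cexp (z + w) = cexp z * cexp w.
Proof.
case: z w => [a b] [c d]; rewrite /cexp /= expRD cosD sinD.
by apply/eqP; rewrite eq_complex /=; apply/andP; split; apply/eqP; ring.
Qed.

Lemma cexp0 : cexp 0 = 1 :> C.
Proof. by rewrite /cexp /= expR0 cos0 sin0 mul1r. Qed.

Lemma cexp_neq0 z : cexp z != 0.
Proof.
apply/eqP => e; have := cexpD z (- z); rewrite subrr cexp0 e mul0r => /eqP.
by rewrite oner_eq0.
Qed.

Lemma cexpN z : cexp (- z) = (cexp z)^-1.
Proof.
by apply: (mulfI (cexp_neq0 z)); rewrite -cexpD subrr cexp0 divff ?cexp_neq0.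
Qed.

Lemma cexp_nat n z : cexp (n%:R * z) = cexp z ^+ n.
Proof.
elim: n => [|n IH]; first by rewrite mul0r cexp0 expr0.
by rewrite exprS -IH -cexpD -natr1 mulrDl mul1r addrC.
Qed.

Lemma cexp_real a : cexp a%:C = (expR a)%:C.
Proof. by rewrite /cexp /= cos0 sin0 mulr1. Qed.

Lemma cexp_imag a : cexp ('i%C * a%:C) = cos a +i* sin a.
Proof.
have -> : 'i%C * a%:C = 0 +i* a.
  by apply/eqP; rewrite eq_complex /=; apply/andP; split; apply/eqP; ring.
by rewrite /cexp /= expR0 mul1r.
Qed.

Lemma cexp_2pi : cexp ('i%C * (pi *+ 2)%:C) = 1 :> C.
Proof. by rewrite cexp_imag cos2pi mulr2n sinDpi sinpi oppr0. Qed.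

Lemma cexp_pi : cexp ('i%C * (pi)%:C) = -1 :> C.
Proof. by rewrite cexp_imag cospi sinpi; apply/eqP; rewrite eq_complex /= oppr0 !eqxx. Qed.

Lemma cexp_2pi_int (n : int) : cexp ('i%C * (2 * pi * n%:~R)%:C) = 1 :> C.
Proof.
have E (m : nat) : cexp ('i%C * (2 * pi * m%:R)%:C) = 1 :> C.
  have -> : 'i%C * (2 * pi * m%:R)%:C = m%:R * ('i%C * (pi *+ 2)%:C) :> C by ring.
  by rewrite cexp_nat cexp_2pi expr1n.
case: n => n; first by rewrite -pmulrn E.
rewrite NegzE mulrNz.
have -> : 'i%C * (2 * pi * (- n.+1%:~R))%:C = - ('i%C * (2 * pi * n.+1%:~R)%:C) :> C by ring.
by rewrite cexpN -pmulrn E invr1.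
Qed.

Lemma cos_eq1 a : `|a| < pi *+ 2 -> cos a = 1 -> a = 0.
Proof.
have pos b : 0 < b < pi *+ 2 -> cos b = 1 -> b = 0 :> R.
  move=> /andP[b0 b2] cb; have s0 : 0 < sin (b / 2).
    by apply: sin_gt0_pi; rewrite divr_gt0 //= ltr_pdivrMr // mulr_natr.
  have : cos (b / 2 + b / 2) = 1 by rewrite -splitr.
  rewrite cosD -!expr2 => e; have c2s2 := cos2Dsin2 (b / 2).
  have : 0 < sin (b / 2) ^+ 2 by rewrite exprn_gt0.
  lra.
rewrite ltr_norml => /andP[a1 a2] ca; have [a0|a0|//] := ltgtP a 0.
  by apply/eqP; rewrite -oppr_eq0; apply/eqP/pos; rewrite ?cosN // oppr_gt0 a0 ltrNl.
by apply: pos => //; rewrite a0.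
Qed.

Lemma cexp_imag_inj a b : `|a - b| < pi *+ 2 ->
  cexp ('i%C * a%:C) = cexp ('i%C * b%:C) :> C -> a = b.
Proof.
move=> ab e; have : cexp ('i%C * (a - b)%:C) = 1 :> C.
  by rewrite rmorphB mulrBr cexpD cexpN e divff ?cexp_neq0.
rewrite cexp_imag => /(congr1 (@complex.Re _)) /= c1.
by apply/eqP; rewrite -subr_eq0; apply/eqP/cos_eq1.
Qed.

(** The root of unity [exp (2 i pi al)]. *)
Definition omega (al : rat) : C := cexp ('i%C * (2 * pi * ratr al)%:C).

(** The interval is half-open because -1/2 and 1/2 give the same root -1. *)
Lemma omega_inj al be : -(1/2) < al <= 1/2 -> -(1/2) < be <= 1/2 ->
  omega al = omega be -> al = be.
Proof.
move=> /andP[a1 a2] /andP[b1 b2] /cexp_imag_inj e.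
suff /e : `|2 * pi * ratr al - 2 * pi * ratr be| < pi *+ 2 :> R.
  move=> /mulfI /fmorph_inj; apply.
  by rewrite mulf_neq0 ?pnatr_eq0 // gt_eqF // pi_gt0.
rewrite -mulrBr -raddfB /= normrM gtr0_norm ?mulr_gt0 ?pi_gt0 //.
have -> : pi *+ 2 = 2 * pi * 1 :> R by ring.
rewrite ltr_pM2l ?mulr_gt0 ?pi_gt0 //.
rewrite ltr_norml; have -> : (1 : R) = ratr (1 : rat) by rewrite rmorph1.
rewrite -rmorphN /= !ltr_rat; apply/andP; split; lra.
Qed.

Lemma omega_half : omega (1 / 2) = -1.
Proof.
by rewrite /omega -cexp_pi; congr (cexp (_ * _%:C)); rewrite fmorph_div rmorph1 rmorph_nat; field.
Qed.

Lemma omega_denq al : omega al ^+ `|denq al| = 1.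
Proof.
rewrite -cexp_nat -[RHS](cexp_2pi_int (numq al)); congr cexp.
have -> : (`|denq al|%N)%:R = (`|denq al|%N)%:R%:C :> C by rewrite rmorph_nat.
rewrite mulrCA; congr (_ * _); rewrite -rmorphM.
congr (_%:C); rewrite mulrCA; congr (_ * _).
have -> : (`|denq al|%N)%:R = (denq al)%:~R :> R by rewrite -{2}(gtz0_abs (denq_gt0 al)).
rewrite /ratr mulrCA divff ?mulr1 //.
by rewrite intr_eq0 denq_neq0.
Qed.

Lemma ccos_nat n : ccos (pi%:C * n%:R) = (-1) ^+ n :> C.
Proof.
rewrite /ccos; have -> : 'i%C * (pi%:C * n%:R) = n%:R * ('i%C * pi%:C) :> C by ring.
have -> : - 'i%C * (pi%:C * n%:R) = - (n%:R * ('i%C * pi%:C)) :> C by ring.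
rewrite cexpN cexp_nat cexp_pi -exprVn invrN invr1.
by field.
Qed.

End ComplexExp.

(** * Canonical extensions *)

(** Linear independence of the sequences [n |-> n ^ j * w ^ n], [w] a root of
    unity. *)
Lemma exp_poly_eq0 (F : numFieldType) (T : eqType) (I : seq T) (om : T -> F)
    (m D : nat) (t : nat -> T -> F) :
  uniq I -> {in I &, injective om} -> (0 < D)%N -> {in I, forall i, om i ^+ D = 1} ->
  (forall n, (1 < n)%N -> \sum_(j < m) \sum_(i <- I) t j i * om i ^+ n * n%:R ^+ j = 0) ->
  forall j i, (j < m)%N -> i \in I -> t j i = 0.
Proof.
move=> uI omI D0 omD van j i jm iI.

(* On the residue class of r modulo D the sum is a polynomial in n, with
   infinitely many roots. *)
have coef0 r k : (k < m)%N -> \sum_(i <- I) t k i * om i ^+ r = 0.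
  move=> km; pose p := \poly_(k < m) (\sum_(i <- I) t k i * om i ^+ r).
  have root_p l : root p (r + D * l.+2)%:R.
    rewrite /root horner_poly; apply/eqP.
    rewrite -[RHS](van (r + D * l.+2)%N); last first.
      by rewrite (leq_trans _ (leq_addl _ _)) // -[2%N]mul1n leq_mul.
    apply: eq_bigr => k' _; rewrite mulr_suml; apply: eq_big_seq => a aI.
    by rewrite exprD exprM omD // expr1n mulr1.
  have p0 : p = 0.
    apply: (@roots_geq_poly_eq0 _ p [seq (r + D * l.+2)%:R | l <- iota 0 (size p)]).
    - by apply/allP => _ /mapP[l _ ->]; exact: root_p.
    - rewrite map_inj_uniq ?iota_uniq // => a b /eqP.
      by rewrite eqr_nat eqn_add2l eqn_pmul2l // !eqSS => /eqP.
    - by rewrite size_map size_iota.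
  by have := congr1 (fun q : {poly F} => q`_k) p0; rewrite coef_poly km coef0.
have poly0 (g : {poly F}) : \sum_(a <- I) t j a * g.[om a] = 0.
  under eq_bigr do rewrite horner_coef mulr_sumr.
  rewrite exchange_big big1 //= => k _.
  transitivity (g`_k * \sum_(a <- I) t j a * om a ^+ k); last by rewrite coef0 // mulr0.
  rewrite mulr_sumr.
  by apply: eq_bigr => a _; rewrite mulrCA.
(* The interpolation polynomial that vanishes at all bases but the one of i. *)
pose g := \prod_(b <- rem i I) ('X - (om b)%:P).
have g0 a : a \in rem i I -> t j a * g.[om a] = 0.
  by move=> aI; rewrite horner_prod (big_rem a) //= hornerXsubC subrr mul0r mulr0.
have := poly0 g; rewrite (big_rem i) //= big1_seq => [|a /andP[_ /g0 //]]; rewrite addr0.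
move=> /eqP; rewrite mulf_eq0 => /orP[/eqP //|/eqP].
rewrite horner_prod => /eqP; rewrite prodf_seq_eq0 => /hasP[b bI].
rewrite hornerXsubC subr_eq0 => /eqP /omI ib.
move: bI; rewrite mem_rem_uniq // inE => /andP[/eqP bi bI].
by case: bi; rewrite ib.
Qed.

Section CanonicalForm.
Variable R : realType.
Local Notation C := R[i].
Implicit Types (N M : C -> C) (al : rat).

Definition principal_turn al := -(1/2) < al <= 1/2.

(** The entire function that interpolates [n |-> omega al ^ n] in a canonical
    extension. For [al = 1/2] it is [cos (pi z)], not [exp (i pi z)]. *)
Definition twist al (z : C) : C :=
  if al == 1/2 then ccos (pi%:C * z) else cexp ((2 * pi * ratr al)%:C * 'i%C * z).

Lemma twist_nat al n : twist al n%:R = omega R al ^+ n.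
Proof.
rewrite /twist; case: eqP => [->|_]; first by rewrite ccos_nat omega_half.
by rewrite -cexp_nat; congr cexp; ring.
Qed.

(** Canonical extensions as lists of terms; this makes closure properties
    immediate. *)
Definition span_form N := exists L : seq (rat * nat * C),
  all (fun p => principal_turn p.1.1) L /\
  forall z, N z = \sum_(p <- L) p.2 * (twist p.1.1 z * z ^+ p.1.2).

Lemma span_form0 : span_form (fun=> 0).
Proof. by exists [::]; split=> // z; rewrite big_nil. Qed.

Lemma span_formD N M : span_form N -> span_form M -> span_form (fun z => N z + M z).
Proof.
move=> [L [aL NE]] [K [aK ME]]; exists (L ++ K); rewrite all_cat aL aK; split=> // z.
by rewrite big_cat NE ME.
Qed.

Lemma span_formZ c N : span_form N -> span_form (fun z => c * N z).
Proof.
move=> [L [aL NE]]; exists [seq (p.1, c * p.2) | p <- L]; split.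
  by rewrite all_map; apply: sub_all aL => p.
move=> z; rewrite big_map NE mulr_sumr; apply: eq_bigr => p _ /=.
by rewrite mulrA.
Qed.

Lemma span_formX N : span_form N -> span_form (fun z => z * N z).
Proof.
move=> [L [aL NE]]; exists [seq (p.1.1, p.1.2.+1, p.2) | p <- L]; split.
  by rewrite all_map; apply: sub_all aL => p.
move=> z; rewrite big_map NE mulr_sumr; apply: eq_bigr => p _ /=.
by rewrite exprS; ring.
Qed.

Lemma span_form_twist al : principal_turn al -> span_form (twist al).
Proof.
move=> tal; exists [:: (al, 0%N, 1)]; rewrite /= tal; split=> // z.
by rewrite big_seq1 expr0 mulr1 mul1r.
Qed.

Lemma span_form_sum (I : Type) (r : seq I) (P : pred I) (F : I -> C -> C) :
  (forall i, P i -> span_form (F i)) ->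
  span_form (fun z => \sum_(i <- r | P i) F i z).
Proof.
move=> FP; elim: r => [|i r IH].
  by under eq_fun do rewrite big_nil; exact: span_form0.
under eq_fun do rewrite big_cons; case Pi: (P i) => //.
by apply: span_formD => //; exact: FP.
Qed.

Lemma span_form_ext N M : N =1 M -> span_form N -> span_form M.
Proof. by move=> /funext ->. Qed.

Lemma span_form_expn j N : span_form N -> span_form (fun z => z ^+ j * N z).
Proof.
move=> NS; elim: j => [|j IH].
  by apply: span_form_ext NS => z; rewrite expr0 mul1r.
by apply: span_form_ext (span_formX IH) => z; rewrite exprS mulrA.
Qed.

Lemma span_form_subX j N : span_form N -> span_form (fun z => (z - 1) ^+ j * N z).
Proof.
move=> NS; elim: j => [|j IH].
  by apply: span_form_ext NS => z; rewrite expr0 mul1r.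
apply: span_form_ext (span_formD (span_formX IH) (span_formZ (-1) IH)) => z.
by rewrite exprS; ring.
Qed.

Lemma canonical_span N : Defs.canonical_form N -> span_form N.
Proof.
move=> [m [I [t [q [uI Ial NE]]]]].
have half : principal_turn (1/2) by rewrite /principal_turn lexx andbT; lra.
apply: (@span_form_ext (fun z => \sum_(j < m) \sum_(al <- I)
    (if al \in I then t j al * (z ^+ j * twist al z) else 0) +
    \sum_(j < m) q j * (z ^+ j * twist (1/2) z))).
  move=> z; rewrite NE mulr_sumr; congr (_ + _); apply: eq_bigr => j _.
    apply: eq_big_seq => al alI; rewrite alI /twist; case: eqP => [e|_]; last by ring.
    by have := Ial _ alI; rewrite e ltxx andbF.
  by rewrite /twist eqxx; ring.
apply: span_formD; apply: span_form_sum => j _; last first.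
  exact/span_formZ/span_form_expn/span_form_twist.
apply: span_form_sum => al _; case alI: (al \in I); last exact: span_form0.
apply/span_formZ/span_form_expn/span_form_twist.
by have /andP[a1 a2] := Ial _ alI; rewrite /principal_turn a1 ltW.
Qed.

Lemma span_canonical N : span_form N -> Defs.canonical_form N.
Proof.
move=> [L [aL NE]].
pose m := (\max_(p <- L) p.1.2).+1.
pose I := [seq al <- undup [seq p.1.1 | p <- L] | al != 1/2].
pose t j al := \sum_(p <- L | p.1 == (al, j)) p.2.
exists m, I, t, (fun j => t j (1/2)); split.
- by rewrite filter_uniq ?undup_uniq.
- move=> al; rewrite mem_filter mem_undup => /andP[al2 /mapP[p pL pal]].
  have := allP aL _ pL; rewrite -pal /principal_turn => /andP[-> /=].
  by rewrite le_eqVlt (negPf al2).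
move=> z; rewrite NE mulr_sumr -big_split /=.
have half : 1/2 \notin I by rewrite mem_filter eqxx.
pose F al j := twist al z * z ^+ j.
transitivity (\sum_(j < m) \sum_(al <- 1/2 :: I) t j al * F al j); last first.
  apply: eq_bigr => j _; rewrite big_cons [RHS]addrC; congr (_ + _).
    by rewrite /F /twist eqxx; ring.
  apply: eq_big_seq => al; rewrite mem_filter => /andP[al2 _].
  by rewrite /F /twist (negPf al2); ring.
under [RHS]eq_bigr do under eq_bigr do rewrite /t mulr_suml.
under [RHS]eq_bigr do rewrite (exchange_big_dep predT) //=.
rewrite exchange_big /=; apply: eq_big_seq => p pL.
have pm : (p.1.2 < m)%N by rewrite ltnS; exact: leq_bigmax_seq.
have pI : p.1.1 \in 1/2 :: I.
  rewrite inE; case: eqP => //= p2; rewrite mem_filter mem_undup; apply/andP; split; first exact/eqP.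
  exact: (map_f (fun p : rat * nat * C => p.1.1) pL).
rewrite (bigD1 (Ordinal pm)) //= [X in _ + X]big1 ?addr0 => [|j jp]; last first.
  rewrite big1 // => al /eqP pE; move: jp; rewrite -val_eqE /= pE /=.
  by rewrite eqxx.
have uI : uniq (1/2 :: I) by rewrite /= half filter_uniq // undup_uniq.
rewrite big_mkcond (bigD1_seq p.1.1 pI uI) /= -surjective_pairing eqxx.
rewrite big1 ?addr0 // => al alp; case: eqP => // pE.
by rewrite pE eqxx in alp.
Qed.

(** With [cos (pi z)] as the term of [al = 1/2] the integer values are those of
    an exponential polynomial whose bases [omega al] are distinct. *)
Lemma canonical_eq0 N : Defs.canonical_form N -> (forall m, N (m.+2)%:R = 0) -> N =1 (fun=> 0).
Proof.
move=> [m [I [t [q [uI Ial NE]]]]] van z.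
have half : 1/2 \notin I by apply/negP => /Ial; rewrite ltxx andbF.
pose t' j al := if al == 1/2 then q j else t j al.
have tE j al : al \in I -> t' j al = t j al.
  by move=> alI; rewrite /t'; case: eqP => // e; rewrite -e alI in half.
have NE' x : N x = \sum_(j < m) \sum_(al <- 1/2 :: I) t' j al * twist al x * x ^+ j.
  rewrite NE mulr_sumr -big_split; apply: eq_bigr => j _; rewrite big_cons [RHS]addrC /=.
  congr (_ + _); last by rewrite /t' /twist eqxx; ring.
  apply: eq_big_seq => al alI; rewrite tE // /twist; case: eqP => // e.
  by rewrite -e alI in half.
have turnI al : al \in 1/2 :: I -> principal_turn al.
  rewrite inE => /orP[/eqP ->|/Ial /andP[a1 a2]]; rewrite /principal_turn ?lexx ?a1 ?ltW //; lra.
(* A common period of the roots of unity. *)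
pose D := \prod_(al <- 1/2 :: I) `|denq al|%N.
rewrite NE' big1 // => j _; rewrite big1_seq // => al /andP[_ alI].
rewrite (@exp_poly_eq0 _ _ (1/2 :: I) (omega R) m D t') ?mul0r //.
- by rewrite /= half.
- by move=> a b aI bI; apply: omega_inj; exact: turnI.
- by rewrite prodn_gt0 // => a; rewrite absz_gt0 denq_neq0.
- move=> a aI; rewrite /D (big_rem a) //= exprM omega_denq expr1n //.
- move=> [|[|n]] // _; rewrite -[RHS](van n) NE'; apply: eq_bigr => k _.
  by apply: eq_bigr => a _; rewrite twist_nat.
Qed.

Lemma canonical_unique N M : Defs.canonical_form N -> Defs.canonical_form M ->
  (forall m, N (m.+2)%:R = M (m.+2)%:R) -> N =1 M.
Proof.
move=> /canonical_span NS /canonical_span MS NM z.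
have /canonical_eq0 h := span_canonical (span_formD NS (span_formZ (-1) MS)).
apply/eqP; rewrite -subr_eq0 -mulN1r h // => m; rewrite NM.
by rewrite mulN1r subrr.
Qed.

End CanonicalForm.

(** * The counting function of an abelian group *)

Section CountingFunctions.
Variable R : realType.
Local Notation C := R[i].
Implicit Types (d n : nat) (k : int) (z : C).

Definition freq d k : R := 2 * pi * k%:~R / d%:R.

(** Enumerated as in the definition of xi_d. *)
Definition freqs d : seq int :=
  [seq k <- [seq j%:Z - d%:Z | j <- iota 0 (2 * d).+1] | (k != 0) && (2 * `|k| <= d)%N].

Definition fweight d k : C := if (2 * `|k| == d)%N then 2^-1 else 1.

(** The interpolation of [d] times the indicator function of the multiples of [d],
    at [z - 1]; 1 is the term of frequency 0. *)
Definition dcomb d z : C :=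
  1 + \sum_(k <- freqs d) fweight d k * cexp (- 'i%C * (freq d k)%:C) *
        cexp ('i%C * (freq d k)%:C * z).

(** The [k]-th power of [exp (2 i pi n / d)]. *)
Definition root_pow d n k : C := cexp ('i%C * (freq d (k * n%:Z))%:C).

Lemma root_pow_add d n k l : root_pow d n (k + l) = root_pow d n k * root_pow d n l.
Proof.
have fD : freq d ((k + l) * n) = freq d (k * n) + freq d (l * n).
  by rewrite /freq (mulrDl k l) intrD; ring.
by rewrite /root_pow fD rmorphD mulrDr cexpD.
Qed.

Lemma root_pow0 d n : root_pow d n 0 = 1.
Proof. by rewrite /root_pow /freq mul0r mulr0 mul0r mulr0 cexp0. Qed.

Lemma root_powd d n k : (0 < d)%N -> root_pow d n (d%:Z * k) = 1.
Proof.
move=> d0; rewrite -[RHS](cexp_2pi_int R (k * n%:Z)); congr (cexp (_ * _%:C)).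
rewrite /freq !intrM -!pmulrn; field.
by rewrite pnatr_eq0 -lt0n.
Qed.

Lemma root_pow_nat d n (r : nat) : root_pow d n r = root_pow d n 1 ^+ r.
Proof.
elim: r => [|r IH]; first by rewrite root_pow0 expr0.
by rewrite exprSr -IH -root_pow_add -PoszD addn1.
Qed.

Lemma root_pow1_eq1 d n : (0 < d)%N -> root_pow d n 1 = 1 -> (d %| n)%N.
Proof.
move=> d0; rewrite /root_pow mul1r (divn_eq n d) => e.
have : cexp ('i%C * (freq d (n %% d)%N)%:C) = 1 :> C.
  rewrite -e PoszD PoszM.
  have -> : freq d ((n %/ d)%N%:Z * d + (n %% d)%N) = 2 * pi * (n %/ d)%N%:~R + freq d (n %% d)%N.
    rewrite /freq intrD intrM -!pmulrn.
    by field; rewrite pnatr_eq0 -lt0n.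
  by rewrite rmorphD mulrDr cexpD cexp_2pi_int mul1r.
rewrite cexp_imag => /(congr1 (@complex.Re _)) /= /cos_eq1 c1.
have dR : 0 < d%:R :> R by rewrite ltr0n.
have : freq d (n %% d)%N = 0.
  apply: c1; rewrite /freq ger0_norm; last first.
    by rewrite divr_ge0 ?ler0n // -pmulrn !mulr_ge0 ?pi_ge0 ?ler0n.
  rewrite -[ltRHS]mulr_natl -[ltLHS]mulrA -[ltRHS]mulr1 ltr_pM2l ?mulr_gt0 ?pi_gt0 //.
  by rewrite ltr_pdivrMr // mul1r -pmulrn ltr_nat ltn_mod.
rewrite /freq => /eqP; rewrite -pmulrn !mulf_eq0 invr_eq0 !pnatr_eq0 (gt_eqF (pi_gt0 R)) /=.
by rewrite (gtn_eqF d0) orbF -/(dvdn d n) -divn_eq.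
Qed.

(** Frequency 0 included, the frequencies may be summed over all [|k| <= d] with
    this weight. *)
Definition dcomb_weight d k : C :=
  if (2 * `|k| < d)%N then 1 else if (2 * `|k| == d)%N then 2^-1 else 0.

Lemma dcomb_sum d n : (0 < d)%N ->
  dcomb d (n.+1)%:R = \sum_(j < (2 * d).+1) dcomb_weight d (j%:Z - d%:Z) * root_pow d n (j%:Z - d%:Z).
Proof.
move=> d0; rewrite -(big_mkord predT (fun j => dcomb_weight d (j%:Z - d%:Z) * root_pow d n (j%:Z - d%:Z))).
rewrite -(big_map (fun j => j%:Z - d%:Z) predT (fun k => dcomb_weight d k * root_pow d n k)).
rewrite /index_iota subn0 /dcomb big_filter; set r := map _ _.
have ur : uniq r.
  by rewrite map_inj_uniq ?iota_uniq // => a b /addIr [].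
have r0 : 0 \in r.
  by apply/mapP; exists d; rewrite ?subrr // mem_iota /=; lia.
rewrite (bigD1_seq 0 r0 ur) /= root_pow0 mulr1 {1}/dcomb_weight muln0 d0; congr (_ + _).
have termE k : cexp (- 'i%C * (freq d k)%:C) * cexp ('i%C * (freq d k)%:C * n.+1%:R) =
    root_pow d n k.
  rewrite -cexpD /root_pow; congr cexp.
  have -> : freq d (k * n) = freq d k * n%:R by rewrite /freq intrM -[n%:~R]pmulrn; ring.
  by rewrite rcM rc_nat -natr1; ring.
rewrite big_mkcondr /=; apply: eq_bigr => k _.
rewrite -mulrA termE /fweight /dcomb_weight; case: ltngtP => //; rewrite ?mul0r //.
Qed.

(** The frequencies [r] and [r - d], for [0 <= r < d], contribute the same power
    and their weights add up to 1. What remains is the sum of the [d]-th roots of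
    unity [exp (2 i pi n / d) ^ r], a geometric sum. *)
Lemma dcomb_nat d n : (0 < d)%N ->
  dcomb d (n.+1)%:R = if (d %| n)%N then d%:R else 0.
Proof.
move=> d0; rewrite dcomb_sum // big_ord_recr /=.
have -> : dcomb_weight d ((2 * d)%N%:Z - d%:Z) = 0.
  rewrite /dcomb_weight (_ : `|(2 * d)%N%:Z - d%:Z|%N = d); last by lia.
  by case: ltngtP => //; lia.
have rpN : root_pow d n (- d%:Z) = 1 by rewrite -[- d%:Z]mulrN1 root_powd.
rewrite mul0r addr0 mul2n -addnn big_split_ord /= -big_split /=.
have -> : \sum_(i < d) (dcomb_weight d (i%:Z - d%:Z) * root_pow d n (i%:Z - d%:Z) +
      dcomb_weight d ((d + i)%N%:Z - d%:Z) * root_pow d n ((d + i)%N%:Z - d%:Z)) =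
    \sum_(i < d) root_pow d n 1 ^+ i.
  apply: eq_bigr => i _; have id := ltn_ord i.
  have -> : (d + i)%N%:Z - d%:Z = i by lia.
  rewrite root_pow_add rpN mulr1 -mulrDl root_pow_nat.
  rewrite -[RHS]mul1r; congr (_ * _); rewrite /dcomb_weight.
  have -> : `|i%:Z - d%:Z|%N = (d - i)%N by lia.
  rewrite mulnBr /=; have [i1|i1|i1] := ltngtP (2 * i)%N d.
  - rewrite ifF; last by lia.
    by rewrite ifF ?add0r //; lia.
  - by rewrite ifT ?addr0 //; lia.
  rewrite ifF; last by lia.
  rewrite ifT; last by lia.
  by field.
case: ifP => dn.
  have -> : root_pow d n 1 = 1.
    have [m ->] := dvdnP dn; rewrite -[RHS](@root_powd d 1 m d0) /root_pow.
    by congr (cexp (_ * (freq d _)%:C)); rewrite PoszM; ring.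
  by under eq_bigr do rewrite expr1n; rewrite sumr_const card_ord.
have w1 : root_pow d n 1 - 1 != 0.
  by rewrite subr_eq0; apply/eqP => /(root_pow1_eq1 d0); rewrite dn.
apply: (mulfI w1); rewrite mulr0 -subrX1 -root_pow_nat.
by rewrite -[d%:Z]mulr1 root_powd // subrr.
Qed.

(** The frequencies [d / 2] and [- d / 2], present for even [d], are not allowed
    in a canonical extension, but their half-sum is [- cos (pi z)]. *)
Lemma dcomb_span d : (0 < d)%N -> span_form (dcomb d).
Proof.
move=> d0.
pose inner := [seq k <- freqs d | (2 * `|k| < d)%N].
pose outer := [seq k <- freqs d | (2 * `|k| == d)%N].
pose T k z : C := cexp (- 'i%C * (freq d k)%:C) * cexp ('i%C * (freq d k)%:C * z).
have dE z : dcomb d z = 1 + \sum_(k <- inner) T k z + 2^-1 * \sum_(k <- outer) T k z.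
  rewrite /dcomb -addrA; congr (_ + _).
  rewrite (bigID (fun k => (2 * `|k| < d)%N)) /= /inner /outer !big_filter mulr_sumr.
  congr (_ + _).
    by apply: eq_bigr => k k1; rewrite /fweight ltn_eqF // mul1r.
  rewrite [LHS]big_mkcond [RHS]big_mkcond /=; apply: eq_big_seq => k.
  rewrite mem_filter => /andP[/andP[_ k1] _].
  rewrite /fweight /T. case: (ltngtP (2 * `|k|) d) k1 => //.
  by move=> _ _ /=; rewrite -mulrA.
have ratE k : ratr (k%:~R / d%:R) * (2 * pi) = freq d k.
  by rewrite /freq fmorph_div /= ratr_int ratr_nat; ring.
rewrite (funext dE).
have turn0 : principal_turn 0 by rewrite /principal_turn; lra.
have span1 : span_form (fun=> 1 : C).
  apply: span_form_ext (span_form_twist R turn0) => z.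
  rewrite /twist; case: eqP => [e|_]; first by exfalso; lra.
  by rewrite rmorph0 mulr0 mul0r mul0r cexp0.
apply: span_formD.
  apply: span_formD => //.
  apply: (@span_form_ext _ (fun z => \sum_(k <- inner) (if (2 * `|k| < d)%N then T k z else 0))).
    move=> z; apply: eq_big_seq => k; rewrite mem_filter => /andP[-> //].
  apply: span_form_sum => k _; case kd: (2 * `|k| < d)%N; last exact: span_form0.
  apply: span_formZ.
  have dR : 0 < d%:R :> rat by rewrite ltr0n.
  have kd' : (2 * `|k| < d)%R by lia.
  have kr : `|k%:~R / d%:R : rat| < 1/2.
    have -> : `|k%:~R / d%:R : rat| = (`|k| : int)%:~R / d%:R.
      by rewrite normrM normfV (gtr0_norm dR) intr_norm.
    rewrite ltr_pdivrMr //.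
    have : ((2 * `|k|)%R : int)%:~R < (d%:Z)%:~R :> rat by rewrite ltr_int.
    rewrite intrM -pmulrn; lra.
  have tk : principal_turn (k%:~R / d%:R) by move: kr; rewrite ltr_norml /principal_turn => /andP[-> /ltW].
  apply: span_form_ext (span_form_twist R tk) => z; rewrite /twist; case: eqP => [k2|_].
    by move: kr; rewrite k2 ltr_norml ltxx andbF.
  by rewrite -ratE; congr cexp; rewrite !rcM; ring.
apply: span_formZ.
have outerE z : \sum_(k <- outer) T k z = if odd d then 0 else -2 * ccos (pi%:C * z).
  case: ifP => od.
    rewrite big1_seq // => k; rewrite mem_filter => /andP[_ /andP[/eqP kd _]].
    by rewrite -kd mul2n odd_double in od.
  pose h := (d./2); have dh : d = (2 * h)%N by rewrite mul2n halfK od subn0.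
  have h0 : (0 < h)%N by lia.
  have po : perm_eq outer [:: h%:Z; - h%:Z].
    apply: uniq_perm; first 2 last.
    - move=> k; rewrite !inE mem_filter mem_filter; apply/idP/idP.
        by move=> /andP[/eqP kd _]; lia.
      move=> kh; have kh' : `|k|%N = h by lia.
      apply/andP; split; first by rewrite kh' dh.
      apply/andP; split; first by apply/andP; split; lia.
      apply/mapP; exists (absz (k + d%:Z)%R); last by lia.
      by rewrite mem_iota; lia.
    - rewrite !filter_uniq // map_inj_uniq ?iota_uniq // => a b /addIr [] //.
    - by rewrite cons_uniq mem_seq1 /=; lia.
  rewrite (perm_big _ po) /= !big_cons big_nil addr0 /T.
  have fh : freq d h = pi.
    by rewrite /freq dh natrM -pmulrn; field; rewrite pnatr_eq0 -lt0n.
  have fN : freq d (- h%:Z) = - pi by rewrite -fh /freq mulrNz; ring.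
  have e1 : cexp (- 'i%C * pi%:C) = -1 :> C by rewrite mulNr cexpN cexp_pi invrN invr1.
  have e2 : cexp (- 'i%C * - pi%:C) = -1 :> C by rewrite mulrNN cexp_pi.
  have e3 : 'i%C * - pi%:C * z = - 'i%C * (pi%:C * z) by ring.
  rewrite fN fh rcN e1 e2 e3 -mulrA /ccos; by field.
case od : (odd d).
  by apply: span_form_ext (span_form0 R) => z; rewrite outerE od.
have half : principal_turn (1/2) by rewrite /principal_turn lexx andbT; lra.
apply: span_form_ext (span_formZ (-2) (span_form_twist R half)) => z.
by rewrite outerE od /twist eqxx.
Qed.

(** The counting function of [H x Z^n]: the variable [z] stands for [m + 1] if the
    group is mapped to [Z/m]. *)
Definition count_fun (H : finZmodType) n z : C :=
  (z - 1) ^+ n * \sum_(d <- divisors #|H|)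
    (gamma H d)%:R * ((totient d)%:R / d%:R) * dcomb d z.

Lemma count_fun_nat (H : finZmodType) n m :
  count_fun H n (m.+2)%:R = (#|hom_ffun H 'I_m.+1| * m.+1 ^ n)%:R.
Proof.
rewrite /count_fun finite_self_dual card_torsion mulnC natrM natrX -natr1 addrK.
congr (_ * _); rewrite natr_sum; apply: eq_big_seq => d.
rewrite -dvdn_divisors => [dH|]; last by apply/card_gt0P; exists 0.
have d0 : (0 < d)%N by apply: dvdn_gt0 dH; apply/card_gt0P; exists 0.
rewrite natr1 dcomb_nat //; case: ifP => _; rewrite ?mulr0 // mul1n natrM.
by rewrite mulrA -mulrA mulVf ?mulr1 // pnatr_eq0 -lt0n.
Qed.

Lemma count_fun_canonical (H : finZmodType) n : Defs.canonical_form (count_fun H n).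
Proof.
apply: span_canonical; apply: span_form_subX.
apply: (@span_form_ext _ (fun z => \sum_(d <- divisors #|H|)
    if (0 < d)%N then (gamma H d)%:R * ((totient d)%:R / d%:R) * dcomb d z else 0)).
  move=> z; apply: eq_big_seq => d; rewrite -dvdn_divisors => [dH|].
    by rewrite ifT //; apply: dvdn_gt0 dH; apply/card_gt0P; exists 0.
  by apply/card_gt0P; exists 0.
apply: span_form_sum => d _; case d0: (0 < d)%N; last exact: span_form0.
exact/span_formZ/dcomb_span.
Qed.

End CountingFunctions.

(** * Complex differentiation *)

(** The derivative of [f : K -> K] in the direction 1 is its derivative in the
    sense of [K]; for complex [K] this form splits into real estimates. *)
Lemma is_derive_epsP (K : numFieldType) (f : K^o -> K^o) (s l : K) :
  is_derive (s : K^o) 1 f l <->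
  forall e, 0 < e -> exists2 d, 0 < d &
    forall h, `|h| < d -> `|f (s + h) - f s - l * h| <= e * `|h|.
Proof.
pose q (h : K^o) : K^o := h^-1 *: ((f \o shift (s : K^o)) (h *: (1 : K^o)) - f s).
have qE h : h != 0 -> `|f (s + h) - f s - l * h| = `|l - q h| * `|h|.
  move=> h0; rewrite -normrM -[LHS]normrN; congr (`| _ |).
  rewrite /q /= /shift [h *: 1]mulr1 [h + s]addrC.
  rewrite -[h^-1 *: _]/(h^-1 * (f (s + h) - f s)) mulrBl mulrAC mulVf // mul1r.
  by rewrite opprB.
have step : (q @ 0^' --> (l : K^o)) <-> forall e, 0 < e -> exists2 d, 0 < d &
    forall h, `|h| < d -> `|f (s + h) - f s - l * h| <= e * `|h|.
  split=> [/cvgrPdist_le cv e e0|H].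
    have /nbhs_ballP[d /= d0 dP] := cv e e0; exists d => // h hd.
    have [->|h0] := eqVneq h 0; first by rewrite addr0 subrr mulr0 subr0 normr0 mulr0.
    rewrite qE // ler_pM2r ?normr_gt0 //; apply: dP => //.
    by rewrite /ball /= sub0r normrN.
  apply/cvgrPdist_le => e e0; have [d d0 dP] := H e e0.
  apply/nbhs_ballP; exists d => // h /=; rewrite /ball /= sub0r normrN => hd h0.
  by have := dP h hd; rewrite qE // ler_pM2r ?normr_gt0.
rewrite -step; split=> [fD|cv].
  have <- : 'D_1 f s = l by exact: derive_val.
  exact: (@ex_derive _ _ _ _ _ _ _ fD).
apply: DeriveDef; first exact: (cvgP _ cv).
exact: (cvg_lim (@norm_hausdorff _ _) cv).
Qed.

Section ComplexDerivative.
Variable R : realType.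
Local Notation C := R[i].
Implicit Types (s z w h l : C) (f g : C -> C).

Lemma normE z : `|z| = (cabs z)%:C.
Proof. by case: z => a b; rewrite normc_def. Qed.

Lemma cabsM z w : cabs (z * w) = cabs z * cabs w.
Proof. exact: Normc.normcM. Qed.

Lemma cabsV z : cabs z^-1 = (cabs z)^-1.
Proof. exact: Normc.normcV. Qed.

Lemma cabsN z : cabs (- z) = cabs z.
Proof. by case: z => a b; rewrite /cabs /= !sqrrN. Qed.

Lemma cabsD z w : cabs (z + w) <= cabs z + cabs w.
Proof. exact: le_normcD. Qed.

Lemma cabs_ge0 z : 0 <= cabs z.
Proof. by case: z => a b; exact: sqrtr_ge0. Qed.

Lemma cabs0 : cabs (0 : C) = 0. Proof. exact: Normc.normc0. Qed.

Lemma cabs_gt0 z : (0 < cabs z) = (z != 0).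
Proof.
rewrite lt_neqAle cabs_ge0 andbT eq_sym; congr (~~ _).
by apply/eqP/eqP => [/Normc.eq0_normc|->] //; exact: cabs0.
Qed.

Lemma cabs_sub z w : cabs z - cabs w <= cabs (z - w).
Proof. by rewrite lerBlDr -{1}(subrK w z); exact: cabsD. Qed.

Lemma cabs_real (a : R) : cabs a%:C = `|a|.
Proof. by rewrite /cabs /= expr0n addr0 sqrtr_sqr. Qed.

Lemma cabs_Re z : `|complex.Re z| <= cabs z.
Proof. by case: z => a b; rewrite /cabs /= -sqrtr_sqr ler_wsqrtr // lerDl sqr_ge0. Qed.

Lemma cabs_Im z : `|complex.Im z| <= cabs z.
Proof. by case: z => a b; rewrite /cabs /= -sqrtr_sqr ler_wsqrtr // lerDr sqr_ge0. Qed.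

Lemma cabs_le z : cabs z <= `|complex.Re z| + `|complex.Im z|.
Proof.
case: z => a b; rewrite /cabs /= -(@ler_pXn2r _ 2) ?nnegrE ?sqrtr_ge0 ?addr_ge0 //.
rewrite sqr_sqrtr ?addr_ge0 ?sqr_ge0 // sqrrD !real_normK ?num_real //.
by rewrite lerD2r lerDl mulrn_wge0 // mulr_ge0.
Qed.

Lemma cabs_cexp z : cabs (cexp z) = expR (complex.Re z).
Proof.
rewrite /cexp cabsM cabs_real ger0_norm ?expR_ge0 // /cabs /= cos2Dsin2 sqrtr1.
by rewrite mulr1.
Qed.

Lemma cderP f s l : is_cderive f s l <->
  forall e : R, 0 < e -> exists2 d : R, 0 < d &
    forall h, cabs h < d -> cabs (f (s + h) - f s - l * h) <= e * cabs h.
Proof.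
rewrite /is_cderive is_derive_epsP; split=> H e e0.
  have [|d d0 dP] := H e%:C; first by rewrite ltcR.
  have dE : d = (complex.Re d)%:C.
    by apply/esym/RRe_real; rewrite realE (ltW d0).
  exists (complex.Re d); first by rewrite -ltcR -dE.
  move=> h hd; rewrite -lecR rcM -!normE; apply: dP.
  by rewrite normE dE ltcR.
have eE : e = (complex.Re e)%:C.
  by apply/esym/RRe_real; rewrite realE (ltW e0).
have [|d d0 dP] := H (complex.Re e); first by rewrite -ltcR -eE.
exists d%:C; first by rewrite ltcR.
move=> h; rewrite !normE ltcR => /dP; rewrite -lecR rcM -eE.
by [].
Qed.

Lemma is_cderive_comp f g s l m : is_cderive g s l -> is_cderive f (g s) m ->
  is_cderive (fun z => f (g z)) s (m * l).
Proof.
move=> /cderP gD /cderP fD; apply/cderP => e e0.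
have L0 : 0 < cabs l + 1 by rewrite ltr_pwDr ?cabs_ge0.
have M0 : 0 < cabs m + 1 by rewrite ltr_pwDr ?cabs_ge0.
have [|d1 d10 fD1] := fD (e / 2 / (cabs l + 1)); first by rewrite !divr_gt0.
have [|d2 d20 gD2] := gD (Num.min 1 (e / 2 / (cabs m + 1))).
  by rewrite lt_min ltr01 !divr_gt0.
exists (Num.min d2 (d1 / (cabs l + 1))); first by rewrite lt_min d20 divr_gt0.
move=> h; rewrite lt_min => /andP[hd2 hd1].
have gh := gD2 h hd2; set k := g (s + h) - g s.
have kh : cabs k <= (cabs l + 1) * cabs h.
  rewrite -[k](subrK (l * h)) (le_trans (cabsD _ _)) // cabsM mulrDl addrC lerD2l.
  by rewrite (le_trans gh) // ler_wpM2r ?cabs_ge0 // ge_min lexx.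
have kd : cabs k < d1.
  by rewrite (le_lt_trans kh) // mulrC -ltr_pdivlMr.
have gk : g s + k = g (s + h) by rewrite /k addrC subrK.
have := fD1 k kd; rewrite gk => fk.
have -> : f (g (s + h)) - f (g s) - m * l * h =
  (f (g (s + h)) - f (g s) - m * k) + m * (k - l * h) by ring.
have -> : e * cabs h = e / 2 * cabs h + e / 2 * cabs h by field.
rewrite (le_trans (cabsD _ _)) //.
apply: lerD.
  rewrite (le_trans fk) // -[leRHS](_ : e / 2 / (cabs l + 1) * ((cabs l + 1) * cabs h) = _).
    by rewrite ler_wpM2l // ltW // !divr_gt0.
  by field; rewrite gt_eqF.
rewrite cabsM (le_trans (y := (cabs m + 1) * (e / 2 / (cabs m + 1) * cabs h))) //.
  apply: ler_pM; rewrite ?cabs_ge0 //; first by rewrite lerDl.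
  by rewrite (le_trans gh) // ler_wpM2r ?cabs_ge0 // ge_min lexx orbT.
by rewrite le_eqVlt; apply/orP; left; apply/eqP; field; rewrite gt_eqF.
Qed.

Lemma is_cderive_inv z : z != 0 -> is_cderive (fun w => w^-1) z (- z^-2).
Proof.
move=> z0; have Z0 : 0 < cabs z by rewrite cabs_gt0.
apply/cderP => e e0.
exists (Num.min (cabs z / 2) (e * cabs z ^+ 3 / 2)).
  by rewrite lt_min !divr_gt0 // mulr_gt0 // exprn_gt0.
move=> h; rewrite lt_min => /andP[h1 h2].
have zh : cabs z / 2 <= cabs (z + h).
  by have := cabs_sub z (- h); rewrite opprK cabsN; lra.
have zh0 : z + h != 0 by rewrite -cabs_gt0; lra.
have -> : (z + h)^-1 - z^-1 - - z^-2 * h = h * (h / (z ^+ 2 * (z + h))).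
  by field; rewrite zh0 z0.
rewrite cabsM mulrC ler_wpM2r ?cabs_ge0 // cabsM cabsV cabsM.
have -> : cabs (z ^+ 2) = cabs z ^+ 2 by rewrite !expr2 cabsM.
rewrite ler_pdivrMr ?mulr_gt0 ?exprn_gt0 //; last lra.
have : e * cabs z ^+ 3 / 2 <= e * (cabs z ^+ 2 * cabs (z + h)).
  rewrite -mulrA ler_pM2l // exprSr -mulrA ler_pM2l ?exprn_gt0 //.
by lra.
Qed.

Lemma is_cderive_id z : is_cderive id z 1.
Proof. exact: is_derive_id. Qed.

Lemma is_cderive_cst c z : is_cderive (fun=> c) z 0.
Proof. exact: is_derive_cst. Qed.

Lemma is_cderiveD f g z l m : is_cderive f z l -> is_cderive g z m ->
  is_cderive (fun z => f z + g z) z (l + m).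
Proof. exact: is_deriveD. Qed.

Lemma is_cderiveM f g z l m : is_cderive f z l -> is_cderive g z m ->
  is_cderive (fun z => f z * g z) z (l * g z + f z * m).
Proof.
move=> fD gD; apply: (is_derive_eq (is_deriveM fD gD)).
by rewrite addrC -[_ *: l]/(g z * l) mulrC.
Qed.

Lemma is_cderiveZ c f z l : is_cderive f z l -> is_cderive (fun z => c * f z) z (c * l).
Proof. by move=> /(is_cderiveM (is_cderive_cst c z)); rewrite mul0r add0r. Qed.

Lemma expR_eps (e : R) : 0 < e -> exists2 d : R, 0 < d &
  forall x, `|x| < d -> `|expR x - 1 - x| <= e * `|x|.
Proof.
move=> e0; have /is_derive_epsP/(_ e e0)[d d0 dP] := is_derive_expR (0 : R).
by exists d => // x /dP; rewrite add0r expR0 mul1r.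
Qed.

Lemma cos_eps (e : R) : 0 < e -> exists2 d : R, 0 < d &
  forall x, `|x| < d -> `|cos x - 1| <= e * `|x|.
Proof.
move=> e0; have /is_derive_epsP/(_ e e0)[d d0 dP] := is_derive_cos (0 : R).
by exists d => // x /dP; rewrite add0r cos0 sin0 oppr0 mul0r subr0.
Qed.

Lemma sin_eps (e : R) : 0 < e -> exists2 d : R, 0 < d &
  forall x, `|x| < d -> `|sin x - x| <= e * `|x|.
Proof.
move=> e0; have /is_derive_epsP/(_ e e0)[d d0 dP] := is_derive_sin (0 : R).
by exists d => // x /dP; rewrite add0r cos0 sin0 subr0 mul1r.
Qed.

(** For [h = x + i y] the remainder has the components
    [(exp x - 1 - x) + exp x (cos y - 1)] and
    [exp x (sin y - y) + (exp x - 1) y]. *)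
Lemma cexp_eps (e : R) : 0 < e -> exists2 d : R, 0 < d &
  forall h, cabs h < d -> cabs (cexp h - 1 - h) <= e * cabs h.
Proof.
move=> e0; have e10 : 0 < Num.min 1 (e / 12) :> R by rewrite lt_min ltr01 divr_gt0.
have [d1 d10 h1] := expR_eps e10.
have [d2 d20 h2] := cos_eps e10.
have [d3 d30 h3] := sin_eps e10.
(* The four terms below are at most (1 + 3 + 3 + 2) e / 12 times the norm of h. *)
exists (Num.min (Num.min 1 (e / 12)) (Num.min d1 (Num.min d2 d3))).
  by rewrite lt_min e10 !lt_min d10 d20 d30.
case=> x y; rewrite !lt_min => /andP[/andP[k1 ke] /andP[k2 /andP[k3 k4]]].
have xr : `|x| <= cabs (x +i* y) := cabs_Re (x +i* y).
have yr : `|y| <= cabs (x +i* y) := cabs_Im (x +i* y).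
have expand : cexp (x +i* y) - 1 - (x +i* y) =
    ((expR x - 1 - x) + expR x * (cos y - 1)) +i*
    (expR x * (sin y - y) + (expR x - 1) * y).
  by apply/eqP; rewrite eq_complex /=; apply/andP; split; apply/eqP; ring.
have r0 := cabs_ge0 (x +i* y).
move: r0 k1 k2 k3 k4 ke xr yr; rewrite expand => {expand}.
set r := cabs (x +i* y) => r0 k1 k2 k3 k4 ke xr yr.
have {h1 k2} := h1 x (le_lt_trans xr k2).
have {h2 k3} := h2 y (le_lt_trans yr k3).
have {h3 k4} := h3 y (le_lt_trans yr k4).
set m := Num.min 1 (e / 12) => s1 c1 x1.
have m1 : m <= 1 by rewrite ge_min lexx.
have me : m <= e / 12 by rewrite ge_min lexx orbT.
have m0 : 0 < m by [].
have r1 : r < 1 by rewrite (lt_le_trans k1).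
have mxr : m * `|x| <= r by rewrite (le_trans _ xr) // ler_piMl.
have ex3 : expR x <= 3.
  have : `|expR x - 1 - x| <= r by exact: le_trans x1 mxr.
  move: xr; rewrite !ler_norml => /andP[_ x2] /andP[_ x3].
  by lra.
have ex1 : `|expR x - 1| <= 2 * r.
  by rewrite -[expR x - 1](subrK x) (le_trans (ler_normD _ _)) //; lra.
have ex0 := expR_ge0 x.
have mx : m * `|x| <= e / 12 * r by apply: ler_pM => //; rewrite ltW.
have my : m * `|y| <= e / 12 * r by apply: ler_pM => //; rewrite ltW.
have b1 : `|expR x * (cos y - 1)| <= 3 * (e / 12 * r).
  by rewrite normrM (ger0_norm ex0); apply: ler_pM => //; exact: le_trans my.
have b2 : `|expR x * (sin y - y)| <= 3 * (e / 12 * r).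
  by rewrite normrM (ger0_norm ex0); apply: ler_pM => //; exact: le_trans my.
have b3 : `|(expR x - 1) * y| <= 2 * r * r by rewrite normrM; apply: ler_pM.
have b4 : 2 * r * r <= 2 * (e / 12) * r by rewrite ler_wpM2r // ler_pM2l // ltW.
rewrite (le_trans (cabs_le _)) // [complex.Re _]/= [complex.Im _]/=.
have t1 := ler_normD (expR x - 1 - x) (expR x * (cos y - 1)).
have t2 := ler_normD (expR x * (sin y - y)) ((expR x - 1) * y).
by have er : 0 <= e * r by [rewrite mulr_ge0 // ltW]; lra.
Qed.

Lemma is_cderive_cexp z : is_cderive (@cexp R) z (cexp z).
Proof.
apply/cderP => e e0; have E0 : 0 < cabs (cexp z) by rewrite cabs_gt0 cexp_neq0.
have [|d d0 dP] := @cexp_eps (e / cabs (cexp z)); first by rewrite divr_gt0.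
exists d => // h /dP hP; rewrite cexpD.
have -> : cexp z * cexp h - cexp z - cexp z * h = cexp z * (cexp h - 1 - h) by ring.
rewrite cabsM (le_trans (y := cabs (cexp z) * (e / cabs (cexp z) * cabs h))) ?ler_pM2l //.
by rewrite mulrA mulrCA divff ?mulr1 // gt_eqF.
Qed.

(** Unlike its definition from [acos], this expression of the argument is
    continuous across the real axis at sight. *)
Lemma carg_asin z : 0 < complex.Re z -> carg z = asin (complex.Im z / cabs z).
Proof.
case: z => a b /= a0; rewrite /carg.
have r0 : 0 < cabs (a +i* b) by rewrite cabs_gt0 eq_complex /= gt_eqF.
have r2 : cabs (a +i* b) ^+ 2 = a ^+ 2 + b ^+ 2.
  by rewrite /cabs /= sqr_sqrtr // addr_ge0 ?sqr_ge0.
have := cabs_Re (a +i* b); have := cabs_Im (a +i* b).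
rewrite [complex.Re _]/= [complex.Im _]/=.
move: r0 r2; set r := cabs _ => r0 r2 br ar.
have xr : -1 <= a / r <= 1.
  by rewrite -ler_norml normrM normfV (gtr0_norm r0) ler_pdivrMr // mul1r.
have x0 : 0 < a / r by rewrite divr_gt0.
have sa : sin (acos (a / r)) = `|b / r|.
  rewrite sin_acos // -sqrtr_sqr; congr Num.sqrt; rewrite !expr_div_n.
  have -> : b ^+ 2 = r ^+ 2 - a ^+ 2 by rewrite r2; ring.
  by field; rewrite gt_eqF.
have [/andP[ac0 acpi] ca] := acos_def xr.
have p0 := pi_gt0 R.
have ac : acos (a / r) <= pi / 2.
  rewrite leNgt; apply/negP => ac.
  have h1 : acos (a / r) \in `[0, pi] by rewrite in_itv /= ac0.
  have h2 : pi / 2 \in `[0, pi : R] by rewrite in_itv /=; apply/andP; split; lra.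
  by move: ac; rewrite -(ltr_cos h2 h1) ca cos_pihalf ltNge ltW.
have p2 : 0 <= b / r -> `|b / r| = b / r by exact: ger0_norm.
case: ifPn => b0.
  rewrite -[b / r]ger0_norm ?divr_ge0 // ?ltW // -sa sinK // in_itv /= ac andbT; lra.
rewrite -ltNge in b0.
have -> : b / r = sin (- acos (a / r)).
  by rewrite sinN sa ltr0_norm ?opprK // pmulr_llt0 // invr_gt0.
by rewrite sinK // in_itv /=; apply/andP; split; lra.
Qed.

Lemma cos_carg z : 0 < complex.Re z -> cos (carg z) = complex.Re z / cabs z.
Proof.
case: z => a b /= a0; rewrite /carg.
have r0 : 0 < cabs (a +i* b) by rewrite cabs_gt0 eq_complex /= gt_eqF.
have := cabs_Re (a +i* b); rewrite [complex.Re _]/= => ar.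
have xr : -1 <= a / cabs (a +i* b) <= 1.
  by rewrite -ler_norml normrM normfV (gtr0_norm r0) ler_pdivrMr // mul1r.
have [_ ca] := acos_def xr.
by case: ifP => _; rewrite ?cosN.
Qed.

Lemma sin_carg z : 0 < complex.Re z -> sin (carg z) = complex.Im z / cabs z.
Proof.
move=> z0; rewrite carg_asin // asinK // in_itv /= -ler_norml.
have r0 : 0 < cabs z by rewrite cabs_gt0; apply/eqP => e; rewrite e ltxx in z0.
by rewrite normrM normfV (gtr0_norm r0) ler_pdivrMr // mul1r cabs_Im.
Qed.

Lemma clogK z : 0 < complex.Re z -> cexp (clog z) = z.
Proof.
move=> z0; have r0 : 0 < cabs z by rewrite cabs_gt0; apply/eqP => e; rewrite e ltxx in z0.
rewrite /cexp /clog [complex.Re _]/= [complex.Im _]/= lnK // cos_carg // sin_carg //.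
by case: z z0 r0 => a b z0 r0; apply/eqP; rewrite eq_complex /=; apply/andP; split;
  apply/eqP; field; rewrite gt_eqF.
Qed.

Lemma continuous_eps (g : R -> R) x : {for x, continuous g} ->
  forall e, 0 < e -> exists2 d, 0 < d & forall y, `|y - x| < d -> `|g y - g x| < e.
Proof.
move=> /cvgrPdist_lt gc e e0; have /nbhs_ballP[d /= d0 dP] := gc e e0.
exists d => // y yx; rewrite distrC; apply: dP.
by rewrite /ball /= distrC.
Qed.

Lemma clog_continuous z : 0 < complex.Re z -> forall e : R, 0 < e ->
  exists2 d : R, 0 < d & forall h, cabs h < d -> cabs (clog (z + h) - clog z) < e.
Proof.
move=> z0 e e0; have r0 : 0 < cabs z by rewrite cabs_gt0; apply/eqP => E; rewrite E ltxx in z0.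
have e20 : 0 < e / 2 by rewrite divr_gt0.
have [d1 d10 ln1] := continuous_eps (continuous_ln r0) e20.
have x1 : -1 < complex.Im z / cabs z < 1.
  rewrite -ltr_norml normrM normfV (gtr0_norm r0) ltr_pdivrMr // mul1r.
  case: z z0 {r0 ln1} => a b /= a0; rewrite /cabs /= -sqrtr_sqr ltr_sqrt ?ltrDr ?exprn_gt0 //.
  by rewrite ltr_wpDr ?sqr_ge0 // exprn_gt0.
have [d2 d20 as2] := continuous_eps (continuous_asin x1) e20.
exists (Num.min (Num.min d1 (complex.Re z)) (Num.min (cabs z / 2) (d2 * cabs z / 4))).
  by rewrite !lt_min d10 z0 !divr_gt0 // mulr_gt0.
move=> h; rewrite !lt_min => /andP[/andP[h1 h2] /andP[h3 h4]].
have Rezh : 0 < complex.Re (z + h).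
  have := cabs_Re h; rewrite ler_norml => /andP[+ _].
  by case: z z0 h {r0 ln1 x1 as2 h1 h3 h4} h2 => a b /= a0 [c d] /=; lra.
have zhr : cabs z / 2 <= cabs (z + h).
  by have := cabs_sub z (- h); rewrite opprK cabsN; lra.
have zh0 : 0 < cabs (z + h) by lra.
have dist : `|cabs (z + h) - cabs z| <= cabs h.
  have := cabs_sub z (- h); have := cabsD z h; rewrite opprK cabsN ler_norml => ? ?.
  by apply/andP; split; lra.
rewrite (le_lt_trans (cabs_le _)) //.
have -> : complex.Re (clog (z + h) - clog z) = ln (cabs (z + h)) - ln (cabs z) by [].
have -> : complex.Im (clog (z + h) - clog z) = carg (z + h) - carg z by [].
have := ln1 (cabs (z + h)) (le_lt_trans dist h1).
have : `|carg (z + h) - carg z| < e / 2.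
  rewrite !carg_asin //; apply: as2.
  have -> : complex.Im (z + h) = complex.Im z + complex.Im h by case: (z) (h) => ? ? [].
  have -> : (complex.Im z + complex.Im h) / cabs (z + h) - complex.Im z / cabs z =
    (complex.Im h * cabs z - complex.Im z * (cabs (z + h) - cabs z)) /
    (cabs (z + h) * cabs z) by field; rewrite !gt_eqF.
  have num : `|complex.Im h * cabs z - complex.Im z * (cabs (z + h) - cabs z)| <=
      2 * cabs h * cabs z.
    rewrite (le_trans (ler_normB _ _)) // !normrM (gtr0_norm r0).
    have i1 : `|complex.Im h| * cabs z <= cabs h * cabs z by rewrite ler_wpM2r ?cabs_Im // ltW.
    have i2 : `|complex.Im z| * `|cabs (z + h) - cabs z| <= cabs z * cabs h.
      by apply: ler_pM => //; exact: cabs_Im.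
    by lra.
  rewrite normrM normfV (gtr0_norm (mulr_gt0 zh0 r0)) ltr_pdivrMr ?mulr_gt0 //.
  apply: (le_lt_trans num); rewrite mulrA ltr_pM2r //.
  have : d2 * (cabs z / 2) <= d2 * cabs (z + h) by rewrite ler_pM2l.
  by lra.
by lra.
Qed.

(** The derivative of an inverse function: with [w = log (z + h) - log z] one has
    [h = z (exp w - 1)], which is [z w] up to a small multiple of [w]. *)
Lemma is_cderive_clog z : 0 < complex.Re z -> is_cderive (@clog R) z z^-1.
Proof.
move=> z0; have r0 : 0 < cabs z by rewrite cabs_gt0; apply/eqP => E; rewrite E ltxx in z0.
have zn0 : z != 0 by rewrite -cabs_gt0.
apply/cderP => e e0.
have [|d1 d10 h1] := @cexp_eps (Num.min (1 / 2) (e * cabs z / 2)).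
  by rewrite lt_min !divr_gt0 // mulr_gt0.
have [d2 d20 h2] := clog_continuous z0 d10.
exists (Num.min d2 (complex.Re z)); first by rewrite lt_min d20.
move=> h; rewrite lt_min => /andP[hd2 hz].
have Rezh : 0 < complex.Re (z + h).
  have := cabs_Re h; rewrite ler_norml => /andP[+ _].
  by case: z z0 h {r0 h2 e0 zn0 h1 hd2} hz => a b /= a0 [c d] /=; lra.
set w := clog (z + h) - clog z.
have hE : h = z * (cexp w - 1).
  have e1 : clog z + w = clog (z + h) by rewrite /w; ring.
  by rewrite mulrBr mulr1 -{1}(clogK z0) -cexpD e1 clogK // addrC addKr.
have := h1 w (h2 h hd2); set m := Num.min _ _ => wm.
have m1 : m <= 1 / 2 by rewrite ge_min lexx.
have me : m <= e * cabs z / 2 by rewrite ge_min lexx orbT.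
have W0 := cabs_ge0 w.
have mw1 : m * cabs w <= 1 / 2 * cabs w by rewrite ler_wpM2r.
have wh : cabs w <= 2 * (cabs h / cabs z).
  have : cabs w - cabs (cexp w - 1 - w) <= cabs (cexp w - 1).
    have e1 : w - - (cexp w - 1 - w) = cexp w - 1 by ring.
    by have := cabs_sub w (- (cexp w - 1 - w)); rewrite e1 cabsN.
  have -> : cabs (cexp w - 1) = cabs h / cabs z.
    by rewrite hE cabsM mulrAC divff ?mul1r // gt_eqF.
  by lra.
have -> : w - z^-1 * h = - (cexp w - 1 - w) by rewrite {1}hE mulKf //; ring.
rewrite cabsN (le_trans wm) // (le_trans (y := e * cabs z / 2 * (2 * (cabs h / cabs z)))) //.
  by apply: ler_pM => //; rewrite le_min !divr_ge0 // mulr_ge0 // ltW.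
by rewrite le_eqVlt; apply/orP; left; apply/eqP; field; rewrite gt_eqF.
Qed.

End ComplexDerivative.

(** * Logarithmic derivatives *)

Section LogDerivative.
Variable R : realType.
Local Notation C := R[i].
Implicit Types (s z w h l : C) (f g : C -> C).

(** The derivative is given as a product, which spares the simplification of
    quotients. *)
Definition log_derive f s w := f s != 0 /\ is_cderive f s (w * f s).

Lemma is_cderive_eq f s l m : is_cderive f s l -> l = m -> is_cderive f s m.
Proof. by move=> ? <-. Qed.

Lemma log_derive1 s : log_derive (fun=> 1) s 0.
Proof. by split; rewrite ?oner_eq0 // mul0r; exact: is_cderive_cst. Qed.

Lemma log_deriveM f g s w v : log_derive f s w -> log_derive g s v ->
  log_derive (fun z => f z * g z) s (w + v).
Proof.
move=> [f0 fD] [g0 gD]; split; first by rewrite mulf_neq0.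
by apply: (is_cderive_eq (is_cderiveM fD gD)); ring.
Qed.

Lemma log_deriveV f s w : log_derive f s w -> log_derive (fun z => (f z)^-1) s (- w).
Proof.
move=> [f0 fD]; split; first by rewrite invr_eq0.
by apply: (is_cderive_eq (is_cderive_comp fD (is_cderive_inv f0))); field.
Qed.

Lemma log_deriveX f s w n : log_derive f s w -> log_derive (fun z => f z ^+ n) s (n%:R * w).
Proof.
move=> fD; elim: n => [|n IH].
  under eq_fun do rewrite expr0; rewrite mul0r; exact: log_derive1.
under eq_fun do rewrite exprS; rewrite -natr1 mulrDl mul1r addrC.
exact: log_deriveM.
Qed.

Lemma log_derive_exprz f s w (k : int) : log_derive f s w ->
  log_derive (fun z => f z ^ k) s (k%:~R * w).
Proof.
move=> fD; case: k => n; first exact: log_deriveX.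
rewrite NegzE mulrNz mulNr; apply: log_deriveV; exact: log_deriveX.
Qed.

Lemma log_derive_prod (I : eqType) (r : seq I) (f : I -> C -> C) s (w : I -> C) :
  {in r, forall i, log_derive (f i) s (w i)} ->
  log_derive (fun z => \prod_(i <- r) f i z) s (\sum_(i <- r) w i).
Proof.
elim: r => [_|i r IH fD].
  by rewrite big_nil; under eq_fun do rewrite big_nil; exact: log_derive1.
rewrite big_cons; under eq_fun do rewrite big_cons; apply: log_deriveM.
  by apply: fD; rewrite mem_head.
by apply: IH => j jr; apply: fD; rewrite inE jr orbT.
Qed.

Lemma log_derive_shift f s a w : log_derive f (s + a) w -> log_derive (fun z => f (z + a)) s w.
Proof.
move=> [f0 fD]; split=> //.
have sD := is_cderiveD (is_cderive_id s) (is_cderive_cst a s).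
by apply: (is_cderive_eq (is_cderive_comp sD fD)); ring.
Qed.

Lemma log_derive_cexp f s l : is_cderive f s l -> log_derive (fun z => cexp (f z)) s l.
Proof.
move=> fD; split; first exact: cexp_neq0.
by apply: (is_cderive_eq (is_cderive_comp fD (is_cderive_cexp _))); rewrite mulrC.
Qed.

Lemma log_derive_cpow s c : 0 < complex.Re s -> log_derive (fun z => cpow z c) s (c / s).
Proof. by move=> s0; exact/log_derive_cexp/is_cderiveZ/is_cderive_clog. Qed.

Lemma MVT0 (u : R -> R) : (forall t : R, 0 <= t <= 1 -> is_derive t 1 u 0) -> u 1 = u 0.
Proof.
move=> uD.
have [|||c _] := @MVT_segment R u (fun=> 0) 0 1; rewrite ?ler01 //.
- by move=> t; rewrite in_itv /= => /andP[t0 t1]; apply: uD; rewrite !ltW.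
- apply: derivable_within_continuous => t; rewrite in_itv /= => tD.
  exact: (@ex_derive _ _ _ _ _ _ _ (uD t tD)).
by rewrite mul0r => /eqP; rewrite subr_eq0 => /eqP.
Qed.

Lemma zero_derivative_segment f s t :
  (forall x : R, 0 <= x <= 1 -> is_cderive f (s + x%:C * (t - s)) 0) -> f t = f s.
Proof.
move=> fD; pose p x := s + x%:C * (t - s).
have D0 := cabs_ge0 (t - s).
have part (P : C -> R) : (forall z w, P (z - w) = P z - P w) ->
    (forall z, `|P z| <= cabs z) -> P (f t) = P (f s).
  move=> PB Ple; have <- : f (p 1) = f t by rewrite /p mul1r addrC subrK.
  have <- : f (p 0) = f s by rewrite /p mul0r addr0.
  apply: (@MVT0 (fun x => P (f (p x)))) => x x01; apply/is_derive_epsP => e e0.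
  have /cderP/(_ (e / (cabs (t - s) + 1)))[|d d0 dP] := fD x x01.
    by rewrite divr_gt0 // ltr_wpDl.
  exists (d / (cabs (t - s) + 1)); first by rewrite divr_gt0 // ltr_wpDl.
  move=> h hd; rewrite mul0r subr0 -PB (le_trans (Ple _)) //.
  have -> : p (x + h) = p x + h%:C * (t - s) by rewrite /p rcD; ring.
  have hE : cabs (h%:C * (t - s)) = `|h| * cabs (t - s) by rewrite cabsM cabs_real.
  have hle : `|h| * cabs (t - s) <= `|h| * (cabs (t - s) + 1).
    by rewrite ler_wpM2l // lerDl.
  have := dP (h%:C * (t - s)); rewrite hE mul0r subr0 => /(_ _)/le_trans; apply.
    by rewrite (le_lt_trans hle) // -ltr_pdivlMr // ltr_wpDl.
  rewrite (le_trans (y := e / (cabs (t - s) + 1) * (`|h| * (cabs (t - s) + 1)))) //.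
    by rewrite ler_wpM2l // divr_ge0 ?ltW // ltr_wpDl.
  by rewrite le_eqVlt; apply/orP; left; apply/eqP; field; rewrite gt_eqF // ltr_wpDl.
apply/eqP; rewrite eq_complex; apply/andP; split; apply/eqP; apply: part.
- by move=> [? ?] [? ?].
- exact: cabs_Re.
- by move=> [? ?] [? ?].
- exact: cabs_Im.
Qed.

(** The quotient of [f] and [g] has derivative zero, and [D] is convex, so that
    the mean value theorem applies on segments. *)
Lemma log_derive_unique (D : set C) f g (w : C -> C) :
  (forall s t, D s -> complex.Re s <= complex.Re t -> D t) ->
  (forall s, D s -> log_derive f s (w s)) -> (forall s, D s -> log_derive g s (w s)) ->
  eq_upto_cst D f g.
Proof.
move=> Dup fD gD; have [[s0 Ds0]|noD] := pselect (exists s, D s); last first.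
  by exists 1; rewrite ?oner_eq0 // => s Ds; case: noD; exists s.
have qD s : D s -> log_derive (fun z => f z * (g z)^-1) s 0.
  by move=> Ds; rewrite -(subrr (w s)); apply: log_deriveM (fD s Ds) (log_deriveV (gD s Ds)).
exists (f s0 / g s0); first by case: (qD s0 Ds0).
move=> s Ds; have [gs0 _] := gD s Ds.
suff : f s / g s = f s0 / g s0 by move=> <-; rewrite divfK.
apply: (@zero_derivative_segment (fun z => f z / g z)) => x /andP[x0 x1].
have ReE : complex.Re (s0 + x%:C * (s - s0)) = complex.Re s0 + x * (complex.Re s - complex.Re s0).
  by case: (s0) (s) => a b [c d] /=; ring.
have Dx : D (s0 + x%:C * (s - s0)).
  have [le|le] := leP (complex.Re s0) (complex.Re s).
    by apply: (Dup _ _ Ds0); rewrite ReE lerDl mulr_ge0 // subr_ge0.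
  apply: (Dup _ _ Ds); rewrite ReE.
  have : 0 <= (1 - x) * (complex.Re s0 - complex.Re s) by rewrite mulr_ge0 ?subr_ge0 // ltW.
  by lra.
by have [_] := qD _ Dx; rewrite mul0r.
Qed.
End LogDerivative.

(** * Mellin transforms *)

Section Mellin.
Variable R : realType.
Local Notation C := R[i].
Implicit Types (N M : C -> C) (s c : C) (a k u : R).
Local Notation mu := (@lebesgue_measure R).
Local Notation ray := (`[1, +oo[%classic : set R).

Let mray : measurable ray. Proof. exact: measurable_itv. Qed.

Let rayP u : ray u -> 1 <= u.
Proof. by rewrite /= in_itv /= andbT. Qed.

(** For [P] the real or the imaginary part. *)
Lemma real_derive (P : C -> R) (F : C -> C) u l :
  (forall z w, P (z - w) = P z - P w) -> (forall z, `|P z| <= cabs z) ->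
  (forall (h : R) z, P (z * h%:C) = P z * h) ->
  is_cderive F u%:C l -> is_derive u 1 (fun x : R => P (F x%:C)) (P l).
Proof.
move=> PB Ple PM /cderP FD; apply/is_derive_epsP => e e0; have [d d0 dP] := FD e e0.
exists d => // h hd; rewrite rcD -PM -!PB (le_trans (Ple _)) //.
by rewrite -[`|h|]cabs_real; apply: dP; rewrite cabs_real.
Qed.

Lemma Re_derive (F : C -> C) u l : is_cderive F u%:C l ->
  is_derive u 1 (fun x : R => complex.Re (F x%:C)) (complex.Re l).
Proof.
apply: real_derive; last 1 first.
- by move=> h [x y] /=; rewrite mulr0 subr0.
- by move=> [? ?] [? ?].
exact: cabs_Re.
Qed.

Lemma clog_real u : 0 < u -> clog u%:C = (ln u)%:C.
Proof.
move=> u0; rewrite /clog cabs_real gtr0_norm // /carg [complex.Re _]/= [complex.Im _]/=.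
by rewrite lexx cabs_real gtr0_norm // divff ?gt_eqF // acos1.
Qed.

Lemma cpow_real s u : 0 < u -> cpow u%:C s = cexp (s * (ln u)%:C).
Proof. by move=> u0; rewrite /cpow clog_real. Qed.

Lemma cabs_cpow s u : 0 < u -> cabs (cpow u%:C s) = u `^ complex.Re s.
Proof.
move=> u0; rewrite cpow_real // cabs_cexp /powR gt_eqF //; congr expR.
by case: s => x y /=; rewrite mulr0 subr0.
Qed.

Lemma cpow_real_exp a u : 0 < u -> cpow u%:C a%:C = (u `^ a)%:C.
Proof. by move=> u0; rewrite cpow_real // -rcM cexp_real /powR gt_eqF. Qed.

Lemma cpowD s c u : 0 < u -> cpow u%:C (s + c) = cpow u%:C s * cpow u%:C c.
Proof. by move=> u0; rewrite /cpow mulrDl cexpD. Qed.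

Lemma cpow_nat u n : 0 < u -> cpow u%:C n%:R = u%:C ^+ n.
Proof.
move=> u0; rewrite -rc_nat cpow_real_exp // powR_mulrn ?ltW //.
by rewrite -[RHS](rmorphXn (real_complex R)).
Qed.

Definition cintegrable (g : R -> C) :=
  mu.-integrable ray (EFin \o (fun u => complex.Re (g u))) /\
  mu.-integrable ray (EFin \o (fun u => complex.Im (g u))).

(** Complex integrands are treated through their real and imaginary parts. *)
Definition cmeas (g : R -> C) :=
  measurable_fun setT (fun u => complex.Re (g u)) /\
  measurable_fun setT (fun u => complex.Im (g u)).

Lemma cReD (z w : C) : complex.Re (z + w) = complex.Re z + complex.Re w.
Proof. by case: z w => ? ? []. Qed.
Lemma cImD (z w : C) : complex.Im (z + w) = complex.Im z + complex.Im w.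
Proof. by case: z w => ? ? []. Qed.
Lemma cReM (z w : C) :
  complex.Re (z * w) = complex.Re z * complex.Re w - complex.Im z * complex.Im w.
Proof. by case: z w => ? ? []. Qed.
Lemma cImM (z w : C) :
  complex.Im (z * w) = complex.Re z * complex.Im w + complex.Im z * complex.Re w.
Proof. by case: z w => ? ? []. Qed.

Lemma cmeas_cst c : cmeas (fun=> c).
Proof. by split; exact: measurable_cst. Qed.

Lemma cmeasD (g h : R -> C) : cmeas g -> cmeas h -> cmeas (fun u => g u + h u).
Proof.
move=> [g1 g2] [h1 h2]; split.
  by under eq_fun do rewrite cReD; exact: measurable_funD.
by under eq_fun do rewrite cImD; exact: measurable_funD.
Qed.

Lemma cmeasM (g h : R -> C) : cmeas g -> cmeas h -> cmeas (fun u => g u * h u).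
Proof.
move=> [g1 g2] [h1 h2]; split.
  by under eq_fun do rewrite cReM; apply: measurable_funB; exact: measurable_funM.
by under eq_fun do rewrite cImM; apply: measurable_funD; exact: measurable_funM.
Qed.

Lemma cmeas_real (f : R -> R) : measurable_fun setT f -> cmeas (fun u => (f u)%:C).
Proof. by move=> mf; split=> //; exact: measurable_cst. Qed.

Lemma measurable_cos (f : R -> R) :
  measurable_fun setT f -> measurable_fun setT (fun u => cos (f u)).
Proof.
by move=> mf; apply: (@measurableT_comp _ _ _ _ _ _ cos) => //;
  apply: continuous_measurable_fun; exact: continuous_cos.
Qed.

Lemma measurable_sin (f : R -> R) :
  measurable_fun setT f -> measurable_fun setT (fun u => sin (f u)).
Proof.
by move=> mf; apply: (@measurableT_comp _ _ _ _ _ _ sin) => //;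
  apply: continuous_measurable_fun; exact: continuous_sin.
Qed.

Lemma cmeas_cexp (g : R -> C) : cmeas g -> cmeas (fun u => cexp (g u)).
Proof.
move=> [g1 g2]; apply: cmeasM.
  by apply: cmeas_real; apply: measurableT_comp g1; exact: measurable_expR.
by split=> /=; [exact: measurable_cos|exact: measurable_sin].
Qed.

Lemma cint_eq (g h : R -> C) : (forall u, 1 <= u -> g u = h u) -> cint g = cint h.
Proof.
move=> gh; rewrite /cint; congr (_ +i* _); apply: eq_Rintegral => u;
  by rewrite inE /= in_itv /= andbT => u1; rewrite gh.
Qed.

Lemma cintegrable_eq (g h : R -> C) : (forall u, 1 <= u -> g u = h u) ->
  cintegrable g -> cintegrable h.
Proof.
move=> gh [g1 g2]; split; [apply: eq_integrable g1|apply: eq_integrable g2] => // u;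
  by rewrite inE /= in_itv /= andbT => u1; rewrite gh.
Qed.

Lemma cintegrableD (g h : R -> C) : cintegrable g -> cintegrable h ->
  cintegrable (fun u => g u + h u).
Proof.
move=> [g1 g2] [h1 h2]; split.
  rewrite (_ : _ \o _ = (EFin \o (fun u => complex.Re (g u))) \+ (EFin \o (fun u => complex.Re (h u)))).
    exact: integrableD.
  by apply/funext => u /=; rewrite cReD EFinD.
rewrite (_ : _ \o _ = (EFin \o (fun u => complex.Im (g u))) \+ (EFin \o (fun u => complex.Im (h u)))).
  exact: integrableD.
by apply/funext => u /=; rewrite cImD EFinD.
Qed.

Lemma cintD (g h : R -> C) : cintegrable g -> cintegrable h ->
  cint (fun u => g u + h u) = cint g + cint h.
Proof.
move=> [g1 g2] [h1 h2]; rewrite /cint.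
under eq_Rintegral do rewrite cReD.
under [X in _ +i* X]eq_Rintegral do rewrite cImD.
by rewrite !RintegralD.
Qed.

Lemma integrable_Zl (f : R -> R) a : mu.-integrable ray (EFin \o f) ->
  mu.-integrable ray (EFin \o (fun u => a * f u)).
Proof. by move=> fi; exact: (integrableZl _ _ fi). Qed.

Lemma cintegrableZ c (g : R -> C) : cintegrable g -> cintegrable (fun u => c * g u).
Proof.
move=> [g1 g2]; split.
  rewrite (_ : _ \o _ = (EFin \o (fun u => complex.Re c * complex.Re (g u))) \+
     (EFin \o (fun u => - complex.Im c * complex.Im (g u)))).
    by apply: integrableD => //; exact: integrable_Zl.
  by apply/funext => u /=; rewrite cReM -EFinD mulNr.
rewrite (_ : _ \o _ = (EFin \o (fun u => complex.Re c * complex.Im (g u))) \+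
   (EFin \o (fun u => complex.Im c * complex.Re (g u)))).
  by apply: integrableD => //; exact: integrable_Zl.
by apply/funext => u /=; rewrite cImM -EFinD.
Qed.

Lemma cintZ c (g : R -> C) : cintegrable g -> cint (fun u => c * g u) = c * cint g.
Proof.
move=> [g1 g2]; rewrite /cint.
under eq_Rintegral do rewrite cReM.
under [X in _ +i* X]eq_Rintegral do rewrite cImM.
rewrite RintegralB ?RintegralD //; try exact: integrable_Zl.
rewrite !RintegralZl //.
by case: c => x y.
Qed.

Let F s (z : C) := - s^-1 * cpow z (- s).

Let F_derive s u : 0 < u -> s != 0 -> is_cderive (F s) u%:C (cpow u%:C (- s) / u%:C).
Proof.
move=> u0 s0; have u0' : u%:C != 0 :> C by rewrite eq_complex /= gt_eqF.
have [_ pD] := @log_derive_cpow R u%:C (- s) u0.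
apply: (is_cderive_eq (is_cderiveZ _ pD)).
by field; rewrite s0 u0'.
Qed.

Let integrand_derive s u : 0 < u ->
  exists l, is_cderive (fun z => cpow z (- s) / z) u%:C l.
Proof.
move=> u0; have u0' : u%:C != 0 :> C by rewrite eq_complex /= gt_eqF.
have [_ pD] := @log_derive_cpow R u%:C (- s) u0.
eexists; exact: (is_cderiveM pD (is_cderive_inv u0')).
Qed.

Lemma powRN_cvg0 a : 0 < a -> u `^ (- a) @[u --> +oo] --> (0 : R).
Proof.
move=> a0; apply/cvgrPdist_le => e e0.
near=> u.
have m0 : 0 < e `^ (- a^-1) by rewrite powR_gt0.
have um : e `^ (- a^-1) < u by near: u; exact: nbhs_pinfty_gt.
have u0 : 0 < u := lt_trans m0 um.
rewrite sub0r normrN ger0_norm ?powR_ge0 // powRN -[leRHS]invrK lef_pV2; last 2 first.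
- by rewrite posrE powR_gt0.
- by rewrite posrE invr_gt0.
have -> : e^-1 = (e `^ (- a^-1)) `^ a.
  by rewrite -powRrM mulNr mulVf ?gt_eqF // powR_inv1 // ltW.
by apply: ge0_ler_powR; rewrite ?nnegrE ltW.
Unshelve. all: by end_near. Qed.

Lemma F_cvg0 (P : C -> R) s : (forall z, `|P z| <= cabs z) -> 0 < complex.Re s ->
  P (F s u%:C) @[u --> +oo] --> (0 : R).
Proof.
move=> Ple s0; apply/cvgrPdist_le => e e0.
have B0 : 0 < cabs s^-1 + 1 by rewrite ltr_wpDl // cabs_ge0.
have /cvgrPdist_le/(_ (e / (cabs s^-1 + 1))) := powRN_cvg0 s0.
move=> /(_ (divr_gt0 e0 B0)) near_e; near=> u.
have u0 : 0 < u by near: u; exact: nbhs_pinfty_gt.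
have : `|0 - u `^ (- complex.Re s)| <= e / (cabs s^-1 + 1) by near: u.
rewrite !sub0r !normrN ger0_norm ?powR_ge0 // => ue.
rewrite (le_trans (Ple _)) // /F cabsM cabsN cabs_cpow //.
have -> : complex.Re (- s) = - complex.Re s by case: (s).
rewrite (le_trans (y := (cabs s^-1 + 1) * (e / (cabs s^-1 + 1)))) //.
  by apply: ler_pM; rewrite ?cabs_ge0 ?powR_ge0 // lerDl.
by rewrite mulrCA divff ?mulr1 // gt_eqF.
Unshelve. all: by end_near. Qed.

(** The fundamental theorem of calculus on an infinite interval requires an
    integrand of constant sign. *)
Lemma ftc_ray (f G : R -> R) (l : R) : (forall x, 1 <= x -> 0 <= f x) ->
  (forall x : R, 0 < x -> is_derive x 1 G (f x)) ->
  (forall x : R, 0 < x -> {for x, continuous f}) ->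
  G x @[x --> +oo] --> l ->
  (\int[mu]_(x in `[1%R, +oo[) (f x)%:E = l%:E - (G 1)%:E)%E.
Proof.
move=> f0 GD fc Gl; apply: ge0_continuous_FTC2y => //.
- apply: continuous_in_subspaceT => x; rewrite inE /= in_itv /= andbT => x1.
  by apply: fc; exact: lt_le_trans x1.
- by move=> x x1; have := GD x (lt_trans ltr01 x1) => xD; exact: (@ex_derive _ _ _ _ _ _ _ xD).
- apply: cvg_at_right_filter; have D1 := GD 1 ltr01.
  by apply/differentiable_continuous/derivable1_diffP; exact: (@ex_derive _ _ _ _ _ _ _ D1).
- move=> x; rewrite in_itv /= andbT => x1; rewrite derive1E.
  have xD := GD x (lt_trans ltr01 x1); exact: (@derive_val _ _ _ _ _ _ _ xD).
Qed.

Let kern s u : C := cpow u%:C (- s) / u%:C.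

Let kern_real a u : 0 < u -> kern a%:C u = (u `^ (- a) / u)%:C.
Proof.
move=> u0; rewrite /kern -rcN cpow_real_exp // rcM; congr (_ * _).
by apply/esym/(@fmorphV _ _ (real_complex R)).
Qed.

Let kern_le s u : 0 < u -> cabs (kern s u) = complex.Re (kern (complex.Re s)%:C u).
Proof.
move=> u0; rewrite kern_real // /kern cabsM cabsV cabs_cpow // cabs_real gtr0_norm //=.
by case: (s).
Qed.

Let kern_meas s : exists2 g, cmeas g & forall u, 1 <= u -> g u = kern s u.
Proof.
exists (fun u => cexp (- s * (ln u)%:C) * (expR (- ln u))%:C); last first.
  move=> u u1; have u0 : 0 < u := lt_le_trans ltr01 u1.
  rewrite /kern cpow_real // expRN lnK ?posrE //; congr (_ * _).
  exact: (@fmorphV _ _ (real_complex R)).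
apply: cmeasM.
  apply: cmeas_cexp; apply: cmeasM; first exact: cmeas_cst.
  by apply: cmeas_real; exact: measurable_ln.
apply: cmeas_real; apply: measurableT_comp; first exact: measurable_expR.
by apply: measurable_funN; exact: measurable_ln.
Qed.

Let ray_meas (P : C -> R) (g : R -> C) :
  (forall h, cmeas h -> measurable_fun setT (P \o h)) ->
  (exists2 h, cmeas h & forall u, 1 <= u -> h u = g u) ->
  measurable_fun ray (EFin \o (fun u => P (g u))).
Proof.
move=> Pm [h hm hg]; apply/measurable_EFinP.
apply: (@eq_measurable_fun _ _ _ _ _ (P \o h)).
  by move=> u; rewrite inE /= in_itv /= andbT => /hg ->.
exact: measurable_funS (Pm h hm).
Qed.

Section Part.
Variable P : C -> R.
Hypotheses (PB : forall z w, P (z - w) = P z - P w)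
  (Ple : forall z, `|P z| <= cabs z)
  (PM : forall (h : R) z, P (z * h%:C) = P z * h)
  (Pm : forall h, cmeas h -> measurable_fun setT (P \o h)).

Let kern_cont s u : 0 < u -> {for u, continuous (fun x => P (kern s x))}.
Proof.
move=> u0; have [l /(real_derive PB Ple PM) kD] := integrand_derive s u0.
by apply/differentiable_continuous/derivable1_diffP; exact: (@ex_derive _ _ _ _ _ _ _ kD).
Qed.

Let F_at1 s : P (F s 1) = - P s^-1.
Proof.
have P0 : P 0 = 0 by rewrite -(subrr 0) PB subrr.
have c1 : cpow 1 (- s) = 1 :> C.
  by rewrite -[X in cpow X _]/(1%:C) cpow_real // ln1 mulr0 cexp0.
by rewrite /F c1 mulr1 -sub0r PB P0 sub0r.
Qed.

Lemma kern_ftc s : 0 < complex.Re s -> (forall u, 1 <= u -> 0 <= P (kern s u)) ->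
  (\int[mu]_(u in ray) (P (kern s u))%:E = (P s^-1)%:E)%E.
Proof.
move=> s0 k0.
have GD (x : R) : 0 < x -> is_derive x 1 (fun x : R => P (F s x%:C)) (P (kern s x)).
  move=> x0; apply: real_derive => //; apply: F_derive => //.
  by apply: contraTneq s0 => ->; rewrite ltxx.
have := ftc_ray k0 GD (@kern_cont s) (F_cvg0 Ple s0).
by rewrite -[1%:C]/(1 : C) F_at1 sub0e EFinN oppeK.
Qed.

Lemma kern_part_integral s : 0 < complex.Re s ->
  mu.-integrable ray (EFin \o (fun u => complex.Re (kern (complex.Re s)%:C u))) ->
  Rintegral mu ray (fun u => complex.Re (kern (complex.Re s)%:C u)) = (complex.Re s)^-1 ->
  (\int[mu]_(u in ray) (P (kern s u) + complex.Re (kern (complex.Re s)%:C u))%:E =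
     (P s^-1 + (complex.Re s)^-1)%:E)%E ->
  mu.-integrable ray (EFin \o (fun u => P (kern s u))) /\
  Rintegral mu ray (fun u => P (kern s u)) = P s^-1.
Proof.
move=> s0 ki kI sumE.
have sum0 u : ray u -> 0 <= P (kern s u) + complex.Re (kern (complex.Re s)%:C u).
  move=> /rayP u1; have u0 : 0 < u := lt_le_trans ltr01 u1.
  by have := Ple (kern s u); rewrite kern_le // ler_norml => /andP[PA PA']; lra.
have mP : measurable_fun ray (EFin \o (fun u => P (kern s u))).
  exact: ray_meas Pm (kern_meas s).
have si : mu.-integrable ray
    (EFin \o (fun u => P (kern s u) + complex.Re (kern (complex.Re s)%:C u))).
  apply/integrableP; split.
    apply/measurable_EFinP; apply: measurable_funD; apply/measurable_EFinP => //.
    by case/integrableP: ki.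
  rewrite (_ : (\int[mu]_(u in ray) _)%E = (P s^-1 + (complex.Re s)^-1)%:E) ?ltry //.
  rewrite -sumE; apply: eq_integral => u; rewrite inE => /sum0 u0.
  by rewrite /comp abse_EFin ger0_norm.
have PE : (fun u => P (kern s u)) =
    (fun u => (P (kern s u) + complex.Re (kern (complex.Re s)%:C u)) -
              complex.Re (kern (complex.Re s)%:C u)).
  by apply/funext => u; rewrite addrK.
split.
  rewrite PE; exact: (@integrableB _ _ _ mu _ mray _ _ si ki).
by rewrite PE RintegralB // kI /Rintegral sumE /= addrK.
Qed.

(** Adding [|kern s u|], which is [kern (Re s) u], makes the integrand
    nonnegative. *)
Lemma kern_sum_ftc s : 0 < complex.Re s ->
  (\int[mu]_(u in ray) (P (kern s u) + complex.Re (kern (complex.Re s)%:C u))%:E =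
     (P s^-1 + (complex.Re s)^-1)%:E)%E.
Proof.
move=> s0; set c := (complex.Re s)%:C.
have c0 : 0 < complex.Re c by [].
have sn0 : s != 0 by apply: contraTneq s0 => ->; rewrite ltxx.
have cn0 : c != 0 by apply: contraTneq c0 => ->; rewrite ltxx.
have k0 u : 1 <= u -> 0 <= P (kern s u) + complex.Re (kern c u).
  move=> u1; have u0 : 0 < u := lt_le_trans ltr01 u1.
  by have := Ple (kern s u); rewrite kern_le // ler_norml => /andP[? ?]; lra.
have GD (x : R) : 0 < x ->
    is_derive x 1 (fun x : R => P (F s x%:C) + complex.Re (F c x%:C))
      (P (kern s x) + complex.Re (kern c x)).
  move=> x0; apply: is_deriveD; first by apply: real_derive => //; exact: F_derive.
  by apply: Re_derive; exact: F_derive.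
have kc (x : R) : 0 < x -> {for x, continuous (fun x => P (kern s x) + complex.Re (kern c x))}.
  move=> x0; apply: continuousD; first exact: kern_cont.
  have [l /Re_derive kD] := integrand_derive c x0.
  by apply/differentiable_continuous/derivable1_diffP; exact: (@ex_derive _ _ _ _ _ _ _ kD).
have lim0 : P (F s u%:C) + complex.Re (F c u%:C) @[u --> +oo] --> (0 : R).
  by rewrite -[0]addr0; apply: cvgD; apply: F_cvg0 => //; exact: cabs_Re.
have := ftc_ray k0 GD kc lim0.
have c1 : cpow 1 (- c) = 1 :> C.
  by rewrite -[X in cpow X _]/(1%:C) cpow_real // ln1 mulr0 cexp0.
have cV : c^-1 = ((complex.Re s)^-1)%:C by apply/esym/(@fmorphV _ _ (real_complex R)).
rewrite -[1%:C]/(1 : C) F_at1 /F c1 mulr1 cV -rcN [complex.Re _]/= => ->.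
by rewrite -EFinB; congr (_%:E); ring.
Qed.

End Part.

Let ReB (z w : C) : complex.Re (z - w) = complex.Re z - complex.Re w.
Proof. by case: z w => ? ? []. Qed.
Let ImB (z w : C) : complex.Im (z - w) = complex.Im z - complex.Im w.
Proof. by case: z w => ? ? []. Qed.
Let ReMr (h : R) z : complex.Re (z * h%:C) = complex.Re z * h.
Proof. by case: z => x y /=; rewrite mulr0 subr0. Qed.
Let ImMr (h : R) z : complex.Im (z * h%:C) = complex.Im z * h.
Proof. by case: z => x y /=; rewrite mulr0 add0r. Qed.

Let Re_meas h : cmeas h -> measurable_fun setT (@complex.Re R \o h).
Proof. by case. Qed.
Let Im_meas h : cmeas h -> measurable_fun setT (@complex.Im R \o h).
Proof. by case. Qed.

Let kernc_int a : 0 < a ->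
  mu.-integrable ray (EFin \o (fun u => complex.Re (kern a%:C u))) /\
  Rintegral mu ray (fun u => complex.Re (kern a%:C u)) = a^-1.
Proof.
move=> a0.
have k0 u : 1 <= u -> 0 <= complex.Re (kern a%:C u).
  move=> u1; have u0 : 0 < u := lt_le_trans ltr01 u1.
  by rewrite kern_real //= divr_ge0 ?powR_ge0 // ltW.
have E : (\int[mu]_(u in ray) (complex.Re (kern a%:C u))%:E = (a^-1)%:E)%E.
  have a0' : 0 < complex.Re a%:C by [].
  rewrite (kern_ftc ReB (@cabs_Re R) ReMr a0' k0).
  by congr (_%:E); rewrite -(@fmorphV _ _ (real_complex R)).
split; last by rewrite /Rintegral E.
apply/integrableP; split; first exact: ray_meas Re_meas (kern_meas _).
rewrite (_ : (\int[mu]_(u in ray) _)%E = (a^-1)%:E) ?ltry //.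
rewrite -E; apply: eq_integral => u; rewrite inE => /rayP /k0 u0.
by rewrite /comp abse_EFin ger0_norm.
Qed.

Let kern_Re s : 0 < complex.Re s ->
  mu.-integrable ray (EFin \o (fun u => complex.Re (kern s u))) /\
  Rintegral mu ray (fun u => complex.Re (kern s u)) = complex.Re s^-1.
Proof.
move=> s0; have [ki kI] := kernc_int s0.
apply: (kern_part_integral (@cabs_Re R) Re_meas s0 ki kI).
exact: (kern_sum_ftc ReB (@cabs_Re R) ReMr s0).
Qed.

Let kern_Im s : 0 < complex.Re s ->
  mu.-integrable ray (EFin \o (fun u => complex.Im (kern s u))) /\
  Rintegral mu ray (fun u => complex.Im (kern s u)) = complex.Im s^-1.
Proof.
move=> s0; have [ki kI] := kernc_int s0.
apply: (kern_part_integral (@cabs_Im R) Im_meas s0 ki kI).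
exact: (kern_sum_ftc ImB (@cabs_Im R) ImMr s0).
Qed.

(** A primitive of [u ^ (- s - 1)] is [- u ^ (- s) / s]. *)
Lemma mellin1 s : 0 < complex.Re s -> mellin (fun=> 1) s = s^-1.
Proof.
move=> s0; rewrite /mellin (@cint_eq _ (kern s)); last by move=> u _; rewrite mul1r.
have [_ kr] := kern_Re s0; have [_ ki] := kern_Im s0.
by rewrite /cint kr ki; case: (s^-1).
Qed.

(** The functions whose Mellin transform converges for [Re s > k]. *)
Definition tame k N := cmeas (fun u => N u%:C) /\ growth N k.

Definition mellin_integrable N s := cintegrable (fun u => N u%:C * cpow u%:C (- s) / u%:C).

Lemma tame_integrable k N s : tame k N -> k < complex.Re s -> mellin_integrable N s.
Proof.
move=> [Nm [K NK]] ks; have c0 : 0 < complex.Re s - k by rewrite subr_gt0.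
have [ki _] := kernc_int c0.
have Ki : mu.-integrable ray (EFin \o (fun u => K * complex.Re (kern (complex.Re s - k)%:C u))).
  exact: integrable_Zl.
have bound u : 1 <= u -> cabs (N u%:C * cpow u%:C (- s) / u%:C) <=
    K * complex.Re (kern (complex.Re s - k)%:C u).
  move=> u1; have u0 : 0 < u := lt_le_trans ltr01 u1.
  rewrite -mulrA cabsM -[_ / u%:C]/(kern s u) kern_le // !kern_real //=.
  have -> : - (complex.Re s - k) = k + - complex.Re s by ring.
  rewrite powRD; last by apply/implyP => _; rewrite gt_eqF.
  rewrite -(mulrA (u `^ k)) (mulrA K); apply: ler_pM => //; first exact: cabs_ge0.
    by rewrite divr_ge0 ?powR_ge0 // ltW.
  exact: NK.
have [g gm gE] := kern_meas s.
have im : exists2 h, cmeas h & forall u, 1 <= u -> h u = N u%:C * cpow u%:C (- s) / u%:C.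
  exists (fun u => N u%:C * g u); first exact: cmeasM.
  by move=> u u1; rewrite gE // /kern mulrA.
split; apply: le_integrable Ki => //.
- exact: ray_meas Re_meas im.
- move=> u /rayP u1; rewrite lee_fin (le_trans (cabs_Re _)) //.
  by rewrite (le_trans (bound u u1)) // ler_norm.
- exact: ray_meas Im_meas im.
move=> u /rayP u1; rewrite lee_fin (le_trans (cabs_Im _)) //.
by rewrite (le_trans (bound u u1)) // ler_norm.
Qed.

Lemma mellin_eq N M s : (forall u, 1 <= u -> N u%:C = M u%:C) -> mellin N s = mellin M s.
Proof. by move=> NM; apply: cint_eq => u u1; rewrite NM. Qed.

Lemma mellinD N M s : mellin_integrable N s -> mellin_integrable M s ->
  mellin_integrable (fun z => N z + M z) s /\
  mellin (fun z => N z + M z) s = mellin N s + mellin M s.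
Proof.
move=> Ni Mi; rewrite /mellin -cintD //; split.
  by apply: cintegrable_eq (cintegrableD Ni Mi) => u _; rewrite !mulrDl.
by apply: cint_eq => u _; rewrite !mulrDl.
Qed.

Lemma mellinZ c N s : mellin_integrable N s ->
  mellin_integrable (fun z => c * N z) s /\
  mellin (fun z => c * N z) s = c * mellin N s.
Proof.
move=> Ni; rewrite /mellin -cintZ //; split.
  by apply: cintegrable_eq (cintegrableZ c Ni) => u _; rewrite !mulrA.
by apply: cint_eq => u _; rewrite !mulrA.
Qed.

Lemma mellin0 s : mellin_integrable (fun=> 0) s /\ mellin (fun=> 0) s = 0.
Proof.
split.
  apply: (@cintegrable_eq (fun=> 0)) => [u _|]; first by rewrite !mul0r.
  by split; exact: integrable0.
rewrite /mellin (@cint_eq _ (fun=> 0)) => [|u _]; last by rewrite !mul0r.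
by rewrite /cint !Rintegral_cst // !mul0r.
Qed.

Lemma mellin_sum (I : Type) (r : seq I) (N : I -> C -> C) s :
  (forall i, mellin_integrable (N i) s) ->
  mellin_integrable (fun z => \sum_(i <- r) N i z) s /\
  mellin (fun z => \sum_(i <- r) N i z) s = \sum_(i <- r) mellin (N i) s.
Proof.
move=> Ni; elim: r => [|i r [IHi IH]].
  by rewrite big_nil; under eq_fun do rewrite big_nil; exact: mellin0.
rewrite big_cons -IH; under eq_fun do rewrite big_cons.
exact: mellinD.
Qed.

Lemma mellin_shift j N s : mellin (fun z => z ^+ j * N z) s = mellin N (s - j%:R).
Proof.
apply: cint_eq => u u1; have u0 : 0 < u := lt_le_trans ltr01 u1.
by rewrite opprB cpowD // cpow_nat //; ring.
Qed.

Lemma mellin_integrable_shift j N s :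
  mellin_integrable N (s - j%:R) -> mellin_integrable (fun z => z ^+ j * N z) s.
Proof.
apply: cintegrable_eq => u u1; have u0 : 0 < u := lt_le_trans ltr01 u1.
by rewrite opprB cpowD // cpow_nat //; ring.
Qed.

End Mellin.

(** * Counting functions and zeta functions *)

Section Assembly.
Variable R : realType.
Local Notation C := R[i].
Implicit Types (N M : C -> C) (s c : C) (a k u : R).

Lemma tame_cst c : tame 0 (fun=> c).
Proof.
split; first exact: cmeas_cst.
by exists (cabs c) => u u1; rewrite powRr0 mulr1.
Qed.

Lemma tameD k N M : tame k N -> tame k M -> tame k (fun z => N z + M z).
Proof.
move=> [Nm [K NK]] [Mm [L ML]]; split; first exact: cmeasD.
exists (K + L) => u u1; rewrite (le_trans (cabsD _ _)) // mulrDl.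
by apply: lerD; [exact: NK|exact: ML].
Qed.

Lemma tameZ k c N : tame k N -> tame k (fun z => c * N z).
Proof.
move=> [Nm [K NK]]; split; first by apply: cmeasM => //; exact: cmeas_cst.
by exists (cabs c * K) => u u1; rewrite cabsM -mulrA ler_wpM2l ?cabs_ge0 ?NK.
Qed.

Lemma tame_sum (I : Type) (r : seq I) k (N : I -> C -> C) : 0 <= k ->
  (forall i, tame k (N i)) -> tame k (fun z => \sum_(i <- r) N i z).
Proof.
move=> k0 Nt; elim: r => [|i r IH]; last first.
  by under eq_fun do rewrite big_cons; exact: tameD.
under eq_fun do rewrite big_nil; split; first exact: cmeas_cst.
by exists 0 => u u1; rewrite mul0r cabs0.
Qed.

Lemma tame_mono k k' N : k <= k' -> tame k N -> tame k' N.
Proof.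
move=> kk [Nm [K NK]]; split=> //; exists `|K| => u u1.
rewrite (le_trans (NK u u1)) // (le_trans (y := `|K| * u `^ k)) //.
  by rewrite ler_wpM2r ?powR_ge0 // ler_norm.
by rewrite ler_wpM2l // ler_powR.
Qed.

Lemma tameX k N : tame k N -> tame (k + 1) (fun z => z * N z).
Proof.
move=> [Nm [K NK]]; split.
  by apply: cmeasM => //; apply: cmeas_real; exact: measurable_id.
exists K => u u1; have u0 : 0 < u := lt_le_trans ltr01 u1.
rewrite cabsM cabs_real gtr0_norm // powRD; last by apply/implyP => _; rewrite gt_eqF.
by rewrite powRr1 ?(ltW u0) // mulrA [leLHS]mulrC ler_wpM2r ?NK // ltW.
Qed.

Lemma tame_cexp a : tame 0 (fun z => cexp ('i%C * a%:C * z)).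
Proof.
split.
  apply: cmeas_cexp; apply: cmeasM; first exact: cmeas_cst.
  by apply: cmeas_real; exact: measurable_id.
exists 1 => u u1; rewrite mul1r powRr0 cabs_cexp -mulrA -rcM.
by rewrite cReM /= mul0r mulr0 subr0 expR0.
Qed.

Lemma tame_dcomb d : tame 0 (@dcomb R d).
Proof.
apply: tameD; first exact: tame_cst.
by apply: tame_sum => // k; apply: tameZ; exact: tame_cexp.
Qed.

Lemma tame_count_fun (H : finZmodType) n : tame n%:R (@count_fun R H n).
Proof.
elim: n => [|n IH].
  apply: (tame_mono (lexx 0)); rewrite /count_fun; under eq_fun do rewrite expr0 mul1r.
  by apply: tame_sum => // d; apply: tameZ; exact: tame_dcomb.
have -> : count_fun H n.+1 = fun z : C => z * count_fun H n z + -1 * count_fun H n z.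
  by apply/funext => z; rewrite /count_fun exprS; ring.
rewrite -natr1; apply: tameD; first exact: tameX.
by apply: tameZ; apply: tame_mono IH; rewrite lerDl.
Qed.

(** The values [N (m + 2)] are the numbers of points over [F_{1^(m + 1)}]. *)
Lemma growth_lower_bound N n k :
  (forall m, (m.+1%:R : R) ^+ n <= cabs (N (m.+2)%:R)) -> growth N k -> n%:R <= k.
Proof.
move=> Nn [K NK]; rewrite leNgt; apply/negP => kn.
pose e := n%:R - k; have e0 : 0 < e by rewrite subr_gt0.
have bound m : (m.+2%:R : R) `^ e <= 2 ^+ n * K.
  have m0 : 0 < m.+2%:R :> R by [].
  have m1 : 1 <= m.+2%:R :> R by rewrite ler1n.
  have := le_trans (Nn m) _; move: (NK m.+2%:R m1); rewrite rc_nat => NKm /(_ _ NKm) h.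
  have p0 : 0 < (m.+2%:R : R) `^ k by rewrite powR_gt0.
  have : (m.+2%:R / 2 : R) ^+ n <= K * m.+2%:R `^ k.
    (* The shift by one costs a factor 2 ^ n at most. *)
    have h2 : m.+2%:R / 2 <= m.+1%:R :> R by rewrite ler_pdivrMr // -natrM ler_nat; lia.
    by apply: le_trans h; apply: lerXn2r; rewrite ?nnegrE ?divr_ge0.
  rewrite expr_div_n ler_pdivrMr ?exprn_gt0 // => h2.
  rewrite /e powRB; last by apply/implyP => _; rewrite gt_eqF.
  rewrite powR_mulrn ?(ltW m0) // ler_pdivrMr //; move: h2; rewrite mulrAC => h2; lra.
have K0 : 0 <= 2 ^+ n * K by exact: le_trans (powR_ge0 _ _) (bound 0%N).
(* A bound beyond which the power of positive exponent e exceeds 2 ^ n K. *)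
pose B := (2 ^+ n * K + 1) `^ e^-1.
pose m := Num.Def.truncn B.
have Bm : B < m.+2%:R.
  by rewrite (lt_trans (truncnS_gt _)) // ltr_nat.
have := bound m; apply/negP; rewrite -ltNge.
have BE : B `^ e = 2 ^+ n * K + 1.
  by rewrite /B -powRrM mulVf ?gt_eqF // powRr1 // addr_ge0.
rewrite (lt_le_trans (y := B `^ e)) //; first by rewrite BE ltrDl.
by apply: ge0_ler_powR; rewrite ?nnegrE ?powR_ge0 // ltW.
Qed.

(** The terms of the sum defining xi_d are the Mellin transforms of the terms of
    [dcomb d]. *)
Lemma mellin_dcomb d (f : R -> C -> C) s : (0 < d)%N -> 0 < complex.Re s ->
  (forall a, a != 0 -> is_f a (f a)) ->
  mellin (@dcomb R d) s = s^-1 + xi_sum d f s.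
Proof.
move=> d0 s0 fP.
have tI (j : int) : tame 0 (fun z => fweight R d j * cexp (- 'i%C * (freq R d j)%:C) *
        cexp ('i%C * (freq R d j)%:C * z)).
  by apply: tameZ; exact: tame_cexp.
have [sumI sumE] := mellin_sum (freqs d) (fun j => tame_integrable (tI j) s0).
have [_ ->] := mellinD (tame_integrable (tame_cst 1) s0) sumI.
rewrite mellin1 // sumE; congr (_ + _); rewrite /xi_sum -[RHS]big_filter.
apply: eq_big_seq => j; rewrite mem_filter => /andP[/andP[j0 _] _].
have [_ ->] := mellinZ (fweight R d j * cexp (- 'i%C * (freq R d j)%:C))
  (tame_integrable (tame_cexp (freq R d j)) s0).
have [|_ fE] := fP (freq R d j).
  by rewrite /freq !mulf_neq0 ?invr_eq0 ?pnatr_eq0 -?lt0n ?intr_eq0 // gt_eqF // pi_gt0.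
by rewrite -fE.
Qed.

Lemma log_derive_xi d xi s : (0 < d)%N -> 0 < complex.Re s -> is_xi d xi ->
  log_derive xi s (- ((totient d)%:R / d%:R * mellin (@dcomb R d) s)).
Proof.
move=> d0 s0 [f [Hd [fP HD xiE]]]; rewrite (mellin_dcomb d0 s0 fP).
have -> : xi = fun s => cpow s (- ((totient d)%:R / d%:R)) *
                         cexp (- ((totient d)%:R / d%:R) * Hd s) by apply/funext.
have -> : - ((totient d)%:R / d%:R * (s^-1 + xi_sum d f s)) =
  - ((totient d)%:R / d%:R) / s + - ((totient d)%:R / d%:R) * xi_sum d f s :> C by ring.
apply: log_deriveM; first exact: log_derive_cpow.
by apply: log_derive_cexp; exact/is_cderiveZ.
Qed.

Section Constituent.
Variable xi : nat -> C -> C.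
Hypothesis xiP : forall d, (0 < d)%N -> is_xi d (xi d).
Variable H : finZmodType.

Lemma divisors_card_gt0 d : d \in divisors #|H| -> (0 < d)%N.
Proof.
rewrite -dvdn_divisors => [dH|]; last by apply/card_gt0P; exists 0.
by apply: dvdn_gt0 dH; apply/card_gt0P; exists 0.
Qed.

Lemma log_derive_zeta_F1 s : 0 < complex.Re s ->
  log_derive (zeta_F1 xi H) s (- mellin (count_fun H 0) s).
Proof.
move=> s0.
have dI d : mellin_integrable (@dcomb R d) s := tame_integrable (tame_dcomb d) s0.
pose w d : C := (gamma H d)%:R * ((totient d)%:R / d%:R).
have -> : mellin (count_fun H 0) s = \sum_(d <- divisors #|H|) w d * mellin (@dcomb R d) s.
  rewrite (@mellin_eq _ _ (fun z => \sum_(d <- divisors #|H|) w d * dcomb d z)); last first.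
    by move=> u _; rewrite /count_fun expr0 mul1r.
  have [_ ->] := mellin_sum (divisors #|H|) (fun d => (mellinZ (w d) (dI d)).1).
  by apply: eq_bigr => d _; rewrite (mellinZ (w d) (dI d)).2.
rewrite -sumrN; apply: (@log_derive_prod _ _ _ (fun d z => xi d z ^+ gamma H d)).
move=> d /divisors_card_gt0 d0; have := log_deriveX (gamma H d) (log_derive_xi d0 s0 (xiP d0)).
by rewrite mulrN mulrA.
Qed.

(** Binomial expansion of [(u - 1) ^ n], each power of [u] being a shift. *)
Lemma mellin_count_fun n s : n%:R < complex.Re s ->
  mellin (count_fun H n) s =
  \sum_(k < n.+1) ((-1) ^+ k * ('C(n, k))%:Z)%:~R * mellin (count_fun H 0) (s - n%:R + k%:R).
Proof.
move=> sn.
pose T (k : 'I_n.+1) (z : C) : C := z ^+ (n - k) * count_fun H 0 z.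
pose c (k : 'I_n.+1) : C := ((-1) ^+ k * ('C(n, k))%:Z)%:~R.
have sE (k : 'I_n.+1) : s - (n - k)%N%:R = s - n%:R + k%:R :> C.
  by rewrite natrB ?opprB ?addrA 1?addrAC // -ltnS.
have TI (k : 'I_n.+1) : mellin_integrable (T k) s.
  apply: mellin_integrable_shift; apply: (tame_integrable (tame_count_fun H 0)).
  rewrite sE cReD -rc_nat /=; apply: ltr_wpDr => //.
  by rewrite cReD -rc_nat /= subr_gt0.
rewrite (@mellin_eq _ _ (fun z => \sum_(k < n.+1) c k * T k z)); last first.
  move=> u _; rewrite /count_fun exprDn mulr_suml; apply: eq_bigr => k _.
  rewrite /c /T /count_fun expr0 mul1r rmorphM rmorphXn rmorphN1 /= -pmulrn.
  by rewrite -mulr_natr; ring.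
have [_ ->] := mellin_sum (index_enum 'I_n.+1) (fun i => (mellinZ (c i) (TI i)).1).
apply: eq_bigr => k _; rewrite (mellinZ (c k) (TI k)).2 /c; congr (_ * _).
by rewrite mellin_shift sE.
Qed.

Lemma log_derive_zeta_constituent n s : n%:R < complex.Re s ->
  log_derive (zeta_constituent xi H n) s (- mellin (count_fun H n) s).
Proof.
move=> sn; rewrite mellin_count_fun // -sumrN.
apply: (@log_derive_prod _ _ _ (fun (k : 'I_n.+1) z =>
  zeta_F1 xi H (z - n%:R + k%:R) ^ ((-1) ^+ k * ('C(n, k))%:Z))) => k _.
rewrite -mulrN; apply: log_derive_exprz.
have Re0 : 0 < complex.Re (s + (k%:R - n%:R)).
  rewrite cReD -!rc_nat -rcN -rcD /=; have : 0 <= k%:R :> R by []; lra.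
have := log_derive_shift (log_derive_zeta_F1 Re0).
have E (z : C) : z + (k%:R - n%:R) = z - n%:R + k%:R by ring.
by rewrite E; under eq_fun do rewrite E.
Qed.

End Constituent.

Lemma is_zetaP N zeta : is_zeta N zeta <->
  forall s, zeta_domain N s -> log_derive zeta s (- mellin N s).
Proof.
split=> h s sN; have := h s sN; last first.
  by move=> [z0 zD]; split=> //; exists (- mellin N s * zeta s); rewrite mulfK.
by move=> [z0 [l [lD <-]]]; split=> //; rewrite divfK.
Qed.

(** The growth condition defines a right half-plane. *)
Lemma zeta_unique N f g : is_zeta N f -> is_zeta N g -> eq_upto_cst (zeta_domain N) f g.
Proof.
move=> /is_zetaP fP /is_zetaP gP; apply: log_derive_unique fP gP.
by move=> s t [k Nk ks] st; exists k => //; exact: lt_le_trans st.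
Qed.

Lemma counting_unique (T : nat -> Type) N M :
  counting_function T N -> counting_function T M -> N =1 M.
Proof.
move=> [Nc NT] [Mc MT]; apply: canonical_unique => // m.
have [k [Tk ->]] := NT m; have [l [Tl ->]] := MT m.
congr (_%:R); apply/card_eq_II.
exact: card_eq_trans (card_esym Tk) Tl.
Qed.

Lemma finite_enum (T : Type) : finite_set [set: T] ->
  exists n (e : 'I_n -> T), bijective e.
Proof.
move=> [n /card_set_bijP[h [hS hI hJ]]]; exists n.
have e_ex (j : 'I_n) : exists x : T, h x = j :> nat.
  by have [x _ <-] := hJ j (ltn_ord j); exists x.
have [e eE] := choice e_ex; exists e, (fun x => Ordinal (hS x I)) => [j|x].
  by apply: val_inj; rewrite /= eE.
by apply: hI; rewrite ?inE // eE.
Qed.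

Lemma fsbig_enum (T : choiceType) n (e : 'I_n -> T) (F : T -> C) : bijective e ->
  \big[*%R/1]_(x \in [set: T]) F x = \prod_(i < n) F (e i).
Proof.
move=> eB; rewrite (reindex_fsbigT e) //.
have -> : [set: 'I_n] = [set` index_enum 'I_n].
  by apply/seteqP; split=> // i _ /=; exact: mem_index_enum.
by rewrite -fsbig_seq ?index_enum_uniq.
Qed.

Lemma counting_units (U : zmodType) (H : finZmodType) n
    (f : {additive U -> (H * 'rV[int]_n)%type}) : bijective f ->
  counting_function (fun m => {additive U -> 'I_m.+1}) (@count_fun R H n).
Proof.
move=> fB; split; first exact: count_fun_canonical.
move=> m; exists (#|hom_ffun H 'I_m.+1| * m.+1 ^ n)%N; split; last exact: count_fun_nat.
by have := card_hom_split 'I_m.+1 fB; rewrite card_ord.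
Qed.

Lemma count_fun_ge (H : finZmodType) n m :
  (m.+1%:R : R) ^+ n <= cabs (count_fun H n (m.+2)%:R : C).
Proof.
rewrite count_fun_nat -rc_nat cabs_real normr_nat -natrX ler_nat leq_pmull //.
rewrite finite_self_dual; apply/card_gt0P; exists 0.
by rewrite inE mul0rn.
Qed.

Lemma count_fun_domain (H : finZmodType) n s :
  zeta_domain (@count_fun R H n) s -> n%:R < complex.Re s.
Proof.
move=> [k Nk]; apply: le_lt_trans.
by apply: growth_lower_bound Nk => m; exact: count_fun_ge.
Qed.

End Assembly.

Theorem theorem4p13 (R : realType) (X : F1_scheme) (G : geom_Mo_scheme)
  (XG : geometric_realization (restrict_mon X) G)
  (noethX : noetherian_F1_scheme X G) :
  [/\ finite_set [set: G],
      forall x : G, exists (H : finZmodType) (n : nat), units_type x H n,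
      (exists N : R[i] -> R[i], counting_function (points_F1n X) N) /\
      (forall x : G, exists N : R[i] -> R[i],
         counting_function (units_characters x) N) &
      forall (NX : R[i] -> R[i]) (Nx : G -> R[i] -> R[i]),
        counting_function (points_F1n X) NX ->
        (forall x, counting_function (units_characters x) (Nx x)) ->
        (forall zetax : G -> R[i] -> R[i],
           (forall x, is_zeta (Nx x) (zetax x)) ->
           let P s := \big[*%R/1]_(x \in [set: G]) zetax x s in
           is_zeta NX P /\
           forall zetaX, is_zeta NX zetaX ->
             eq_upto_cst (zeta_domain NX) zetaX P) /\
        (forall xi : nat -> R[i] -> R[i],
           (forall d, (0 < d)%N -> is_xi d (xi d)) ->
           forall (x : G) (H : finZmodType) (n : nat), units_type x H n ->
             (forall NH : R[i] -> R[i],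
                counting_function (fun m => {additive H -> 'I_m.+1}) NH ->
                is_zeta NH (zeta_F1 xi H)) /\
             is_zeta (Nx x) (zeta_constituent xi H n) /\
             forall zetax, is_zeta (Nx x) zetax ->
               eq_upto_cst (zeta_domain (Nx x)) zetax
                 (zeta_constituent xi H n))].
Proof.
have [_ noethG] := noethX.
have finG := noetherian_finite noethG.
have chart (x : G) : exists (M : Mo) (f : mspace_mor (Spec_space M) G) (p : Spec_space M),
    [/\ fin_gen_cmon M, open_immersion f & f p = x].
  have [n [M [f [fP fcov]]]] := noethG.
  have [i [p _ px]] := fcov x; have [Mfg fo] := fP i.
  by exists (M i), (f i), p.
have nontriv (x : G) : ~ is_unit (cm0 : stalk x).
  by have [M [f [p [_ fo <-]]]] := chart x; exact: stalk_nontrivial.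
have unitsP (x : G) : exists p : finZmodType * nat, units_type x p.1 p.2.
  have [M [f [p [Mfg fo <-]]]] := chart x.
  have [m [g gen]] := units_fg fo p Mfg.
  have [H [n [h [hB _]]]] := fg_zmod_structure gen.
  by exists (H, n); exists h.
have [U UP] := choice unitsP.
have NxP (x : G) : counting_function (units_characters x) (@count_fun R (U x).1 (U x).2).
  by have [f fB] := UP x; exact: counting_units fB.
have [r [e eB]] := finite_enum finG.
pose N0 (z : R[i]) := \sum_(i < r) count_fun (U (e i)).1 (U (e i)).2 z.
have N0E m : N0 (m.+2)%:R =
    (\sum_(i < r) #|hom_ffun (U (e i)).1 'I_m.+1| * m.+1 ^ (U (e i)).2)%N%:R.
  by rewrite natr_sum; apply: eq_bigr => i _; exact: count_fun_nat.
have NXP : counting_function (points_F1n X) N0.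
  split.
    by apply: span_canonical; apply: span_form_sum => i _; exact/canonical_span/count_fun_canonical.
  move=> m; rewrite N0E; eexists; split; last by [].
  have [theta [thetaB _]] := XG.
  apply: (card_bijective (thetaB (Defs.F1 'I_m.+1))).
  apply: (card_bijective (pt_mor_of_bij 'I_m.+1 nontriv)).
  apply: (card_sigT (k := fun x => (#|hom_ffun (U x).1 'I_m.+1| * m.+1 ^ (U x).2)%N) eB) => x.
  have [f fB] := UP x.
  by have := card_hom_split 'I_m.+1 fB; rewrite card_ord.
split=> //.
- by move=> x; exists (U x).1, (U x).2.
- by split; [exists N0|move=> x; exists (count_fun (U x).1 (U x).2)].
move=> NX Nx NXc Nxc.
have NXE := counting_unique NXc NXP.
have NxE x := counting_unique (Nxc x) (NxP x).
split=> [zetax zetaxP P|xi xiP x H n Hn].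
  suff Pz : is_zeta NX P by split=> // zetaX zX; exact: zeta_unique zX Pz.
  apply/is_zetaP => s [k NXk ks].
  (* The points over x alone bound the growth exponent of NX from below. *)
  have dom i : (U (e i)).2%:R < complex.Re s.
    apply: le_lt_trans ks; apply: growth_lower_bound NXk => m.
    rewrite NXE N0E -rc_nat cabs_real normr_nat -natrX ler_nat (bigD1 i) //=.
    rewrite (leq_trans _ (leq_addr _ _)) // leq_pmull // finite_self_dual.
    by apply/card_gt0P; exists 0; rewrite inE mul0rn.
  have zD i : log_derive (zetax (e i)) s (- mellin (count_fun (U (e i)).1 (U (e i)).2) s).
    have -> : count_fun (U (e i)).1 (U (e i)).2 = Nx (e i) by apply/funext => z; rewrite NxE.
    have /is_zetaP := zetaxP (e i); apply; exists (U (e i)).2%:R => //.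
    have [_ [K KP]] := @tame_count_fun R (U (e i)).1 (U (e i)).2.
    by exists K => u u1; rewrite NxE; exact: KP.
  have -> : P = fun z => \prod_(i < r) zetax (e i) z.
    by apply/funext => z; exact: fsbig_enum.
  have -> : NX = N0 by apply/funext.
  have NI i : mellin_integrable (count_fun (U (e i)).1 (U (e i)).2) s.
    exact: (tame_integrable (tame_count_fun R _ _) (dom i)).
  have [_ ->] := mellin_sum (index_enum 'I_r) NI.
  by rewrite -sumrN; apply: log_derive_prod => i _; exact: zD.
have [f fB] := Hn.
have NxE' : Nx x =1 count_fun H n := counting_unique (Nxc x) (counting_units R fB).
have zc : is_zeta (Nx x) (zeta_constituent xi H n).
  have -> : Nx x = count_fun H n by apply/funext.
  by apply/is_zetaP => s /count_fun_domain; exact: log_derive_zeta_constituent.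
split; last by split=> // zetax zP; exact: zeta_unique zP zc.
move=> NH NHc.
have gD : {morph (fun h : H => (h, 0 : 'rV[int]_0)) : a b / a + b}.
  by move=> a b; rewrite pairD addr0.
have [g gE] := mkadditive gD.
have gB : bijective g.
  exists fst => [h|[h v]]; rewrite gE //=; by rewrite [v]thinmx0.
have -> : NH = count_fun H 0.
  by apply/funext; exact: counting_unique NHc (counting_units R gB).
by apply/is_zetaP => s /count_fun_domain; exact: log_derive_zeta_F1.
Qed.
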